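(* Let $n_1,\ldots,n_k$ be positive integers and let $d_1,\ldots,d_k$ be positive integers such that $\#\{i\mid d_i=1\}\leq 1$. Let $X=\mathrm{SV}_{n_1\times\cdots\times n_k}^{d_1,\dots,d_k}$ be the Segre-Veronese variety, let \[r=\min\left\{\left\lceil\tfrac{d_i+2}{2}\right\rceil\;\middle|\; i\in\{1,\ldots,k\}\right\},\qquad J=\left\{i\in\{1,\ldots,k\}\;\middle|\;\left\lceil\tfrac{d_i+2}{2}\right\rceil=r\right\}.\] For $i\in\{1,\ldots,k\}$, define \[\mathcal{T}_i=\{S\in(\mathbb{P}^{n_1}\times\cdots\times\mathbb{P}^{n_k})^{(r)}\mid\dim\langle\pi_i(S)\rangle=1\text{ and }\pi_j(S)\text{ is a point for all } j\neq i\}.\] Then \[\mathrm{Ter}_r(X)=\bigcup_{i\in J}\overline{\{\nu(S)\mid S\in\mathcal{T}_i\}}\] has an irreducible component of dimension $(n_1+\cdots+n_k)+n_i+r-2$ for each $i\in J$.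
   Context: The base field $\mathbb{K}$ is algebraically closed of characteristic $0$. With $N=\prod_{i=1}^k\binom{n_i+d_i}{n_i}-1$, $\nu:\mathbb{P}^{n_1}\times\cdots\times\mathbb{P}^{n_k}\to\mathrm{SV}^{d_1,\ldots,d_k}_{n_1\times\cdots\times n_k}\subset\mathbb{P}^N$ is the Segre-Veronese embedding (by the complete linear system $\mathcal{O}(d_1,\ldots,d_k)$), and $\pi_i$ is the projection of $\mathbb{P}^{n_1}\times\cdots\times\mathbb{P}^{n_k}$ onto the $i$th factor. For a variety $V$, $V^{(r)}$ denotes the variety of unordered sets of $r$ distinct points of $V$. For a nondegenerate irreducible variety $X\subset\mathbb{P}^N$ with set of smooth points $X_{sm}$ and embedded tangent spaces $T_pX$, the $r$-Terracini locus is \[\mathrm{Ter}_r(X)=\overline{\{\{p_1,\ldots,p_r\}\in X_{sm}^{(r)}\mid \dim\langle T_{p_1}X,\ldots,T_{p_r}X\rangle<r(\dim X+1)-1\}},\] where $\langle\cdot\rangle$ denotes linear span and the closure is taken in $X_{sm}^{(r)}$. Closures in the claim are taken in $X^{(r)}$. *)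

(* Defs.v *)
From HB Require Import structures.
From mathcomp Require Import all_boot all_order all_algebra finmap.
From mathcomp Require Import all_classical topology mpoly.

Set Implicit Arguments.
Unset Strict Implicit.
Unset Printing Implicit Defensive.

Import GRing.Theory.

Local Open Scope fset_scope.
Local Open Scope classical_set_scope.
Local Open Scope ring_scope.

Section Irreducible.
Context {T : topologicalType}.
Implicit Types Y Z A : set T.

Definition irreducible_set A : Prop :=
  A !=set0 /\
  forall F G : set T, closed F -> closed G -> A `<=` F `|` G ->
    A `<=` F \/ A `<=` G.

Definition irreducible_component A Z : Prop :=
  [/\ Z `<=` A, irreducible_set Z &
    forall Z', irreducible_set Z' -> Z `<=` Z' -> Z' `<=` A -> Z' = Z].

(* The closure of A in the subspace Y. *)
Definition closure_in Y A : set T := closure A `&` Y.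

Definition irreducible_chain Z (m : nat) (C : nat -> set T) : Prop :=
  (forall i, (i <= m)%N ->
     irreducible_set (C i) /\ exists2 F, closed F & C i = F `&` Z) /\
  (forall i, (i < m)%N -> C i `<` C i.+1).

(* The Krull dimension of the subspace Z is m. A chain of length m.+1 exists as
   soon as a longer one does, so excluding length m.+1 is enough. *)
Definition has_dim Z (m : nat) : Prop :=
  (exists C, irreducible_chain Z m C) /\ ~ (exists C, irreducible_chain Z m.+1 C).

(* 0 when Z is empty or of infinite dimension. *)
Definition krull_dim Z : nat := xget 0%N [set m | has_dim Z m].

End Irreducible.

(* P^n is the set of lines of K^(n+1). *)
Record projspace (K : fieldType) (n : nat) := Projspace {
  line :> {vspace 'rV[K]_n.+1};
  dim_line : \dim line == 1%N }.

HB.instance Definition _ K n := [isSub for @line K n].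
HB.instance Definition _ K n := [Choice of projspace K n by <:].

(* A linear subspace of P^n is given by the corresponding subspace of K^(n+1);
   the empty subspace has dimension -1. *)
Definition pdim (K : fieldType) (n : nat) (U : {vspace 'rV[K]_n.+1}) : int :=
  (\dim U)%:Z - 1.

Section ProjectiveSpace.
Context {K : fieldType} {n : nat}.
Implicit Types (p : projspace K n) (v : 'rV[K]_n.+1).

(* Homogeneous coordinates of p. *)
Definition coords p : 'rV[K]_n.+1 := vpick (line p).

Lemma coords_neq0 p : coords p != 0.
Proof. by rewrite vpick0 -dimv_eq0 (eqP (dim_line p)). Qed.

Lemma line_coords p : <[coords p]>%VS = line p.
Proof.
apply/eqP; rewrite eqEdim -memvE memv_pick (eqP (dim_line p)).
by rewrite dim_vline coords_neq0.
Qed.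

Lemma coordsP p v : v != 0 -> <[v]>%VS = line p ->
  exists2 c, c != 0 & v = c *: coords p.
Proof.
move=> v0 vp; have /vlineP[c vc] : v \in <[coords p]>%VS.
  by rewrite line_coords -vp memv_line.
by exists c => //; apply: contraNneq v0 => c0; rewrite vc c0 scale0r.
Qed.

Lemma dim_point v : v != 0 -> \dim <[v]> == 1%N.
Proof. by move=> v0; rewrite dim_vline v0. Qed.

Definition proj_point v (v0 : v != 0) : projspace K n := Projspace (dim_point v0).

Definition pspan (A : {fset projspace K n}) : {vspace 'rV[K]_n.+1} :=
  (\sum_(p <- A) line p)%VS.

(* Vanishing of F at p does not depend on the choice of coordinates of p when F
   is homogeneous, the only case in which pvalue is used. *)
Definition pvalue (F : {mpoly K[n.+1]}) p : K :=
  F.@[fun j => coords p 0 j].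

Definition basic_open (U : set (projspace K n)) : Prop :=
  exists d F, F \is d.-homog /\ U = [set p | pvalue F p != 0].

Lemma basic_openT : \bigcup_(U in basic_open) U = setT.
Proof.
rewrite -subTset => p _.
exists [set p | pvalue (1 : {mpoly K[n.+1]}) p != 0].
  by exists 0%N, 1; split => //; exact: dhomog1.
by rewrite /= /pvalue rmorph1 oner_eq0.
Qed.

Lemma basic_openI (U V : set (projspace K n)) p : basic_open U -> basic_open V ->
  U p -> V p -> exists W, [/\ basic_open W, W p & W `<=` U `&` V].
Proof.
move=> [d [F [hF ->]]] [e [G [hG ->]]] Up Vp; exists [set p | pvalue (F * G) p != 0].
split; first by exists (d + e)%N, (F * G); split=> //; apply: dhomogM.
  by rewrite /= /pvalue rmorphM mulf_neq0.
by move=> q; rewrite /= /pvalue rmorphM mulf_eq0 negb_or => /andP[].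
Qed.

End ProjectiveSpace.

(* Zariski topology: the closed sets are the common zero loci of families of
   homogeneous polynomials. *)
HB.instance Definition _ K n := @isBaseTopological.Build (projspace K n)
  (set (projspace K n)) basic_open id basic_openT basic_openI.

(* (P^n)^r, as a type of its own in order to carry the Zariski topology rather
   than the product topology. *)
Definition proj_power (K : fieldType) (n r : nat) : Type := r.-tuple (projspace K n).

HB.instance Definition _ K n r := Choice.on (proj_power K n r).

Section ProjectivePower.
Context {K : fieldType} {n r : nat}.
Implicit Types (t : proj_power K n r) (F G : {mpoly K[r * n.+1]}).

(* The coordinates on the r copies of K^(n+1) are numbered by mxvec_index. *)
Definition pwvalue F t : K :=
  F.@[fun a => mxvec (\matrix_(i < r, j < n.+1) coords (tnth t i) 0 j) 0 a].

Definition multihomogeneous (e : 'I_r -> nat) F : Prop :=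
  forall m, m \in msupp F ->
    forall i, (\sum_(j < n.+1) m (mxvec_index i j) = e i)%N.

Definition pwbasic_open (U : set (proj_power K n r)) : Prop :=
  exists e F, multihomogeneous e F /\ U = [set t | pwvalue F t != 0].

Lemma pwbasic_openT : \bigcup_(U in pwbasic_open) U = setT.
Proof.
rewrite -subTset => t _.
exists [set t | pwvalue (1 : {mpoly K[r * n.+1]}) t != 0].
  exists (fun=> 0%N), 1; split=> // m; rewrite msupp1 inE => /eqP-> i.
  by rewrite big1 // => j _; rewrite mnmE.
by rewrite /= /pwvalue rmorph1 oner_eq0.
Qed.

Lemma pwbasic_openI (U V : set (proj_power K n r)) t :
  pwbasic_open U -> pwbasic_open V -> U t -> V t ->
  exists W, [/\ pwbasic_open W, W t & W `<=` U `&` V].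
Proof.
move=> [d [F [hF ->]]] [e [G [hG ->]]] Ut Vt.
exists [set t | pwvalue (F * G) t != 0]; split.
- exists (fun i => d i + e i)%N, (F * G); split=> // m /msuppM_le.
  case/allpairsP=> -[m1 m2] /= [m1F m2G ->] i.
  rewrite -(hF _ m1F) -(hG _ m2G) -big_split.
  by apply: eq_bigr => j _; rewrite mnmDE.
- by rewrite /= /pwvalue rmorphM mulf_neq0.
- by move=> u; rewrite /= /pwvalue rmorphM mulf_eq0 negb_or => /andP[].
Qed.

End ProjectivePower.

(* The closed sets of (P^n)^r are the common zero loci of families of
   multihomogeneous polynomials. *)
HB.instance Definition _ K n r := @isBaseTopological.Build (proj_power K n r)
  (set (proj_power K n r)) pwbasic_open id pwbasic_openT pwbasic_openI.

Record conf (T : choiceType) (r : nat) := Conf {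
  conf_fset :> {fset T};
  card_conf : #|` conf_fset| == r }.

HB.instance Definition _ T r := [isSub for @conf_fset T r].
HB.instance Definition _ T r := [Choice of conf T r by <:].

(* V^(r), for V a subset of T. *)
Definition conf_in (T : choiceType) (r : nat) (V : set T) : set (conf T r) :=
  [set A | forall x, x \in conf_fset A -> V x].

Section ConfTopology.
Context {K : fieldType} {n r : nat}.
Local Notation cnf := (conf (projspace K n) r).

(* (P^n)^(r) is the quotient by the symmetric group of the subspace of (P^n)^r
   formed by the r-tuples of distinct points: U is open iff its preimage is the
   trace on that subspace of an open subset of (P^n)^r. *)
Definition conf_open (U : set cnf) : Prop :=
  exists2 O : set (proj_power K n r), open O &
    forall (t : r.-tuple (projspace K n)) (A : cnf),
      uniq t -> conf_fset A =i t -> (U A <-> O t).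

Lemma conf_openT : conf_open setT.
Proof. by exists setT; [exact: openT|]. Qed.

Lemma conf_openI : setI_closed conf_open.
Proof.
move=> U V [O Oo OU] [Q Qo QV]; exists (O `&` Q); first exact: openI.
move=> t A ut At; have [UO OU'] := OU t A ut At; have [VQ QV'] := QV t A ut At.
by split=> -[? ?]; split; auto.
Qed.

Lemma conf_open_bigU (I : Type) (f : I -> set cnf) :
  (forall i, conf_open (f i)) -> conf_open (\bigcup_i f i).
Proof.
move=> fo; have /choice[O OP] : forall i, exists O : set (proj_power K n r),
    open O /\ forall (t : r.-tuple (projspace K n)) (A : cnf),
      uniq t -> conf_fset A =i t -> (f i A <-> O t).
  by move=> i; have [O] := fo i; exists O.
exists (\bigcup_i O i); first by apply: bigcup_open => i _; case: (OP i).
move=> t A ut At; split=> -[i _ fiA]; exists i => //;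
  by have [_ /(_ t A ut At)[]] := OP i; auto.
Qed.

End ConfTopology.

HB.instance Definition _ K n r := @isOpenTopological.Build (conf (projspace K n) r)
  conf_open conf_openT conf_openI conf_open_bigU.

Section Terracini.
Context {K : fieldType} {n : nat}.
Implicit Types (X : set (projspace K n)) (p : projspace K n).

(* w is killed by the differential at p of every homogeneous polynomial of the
   ideal of X; for homogeneous F, rescaling the coordinates of p only rescales
   this differential. *)
Definition tangent_vector X p (w : 'rV[K]_n.+1) : Prop :=
  forall d F, F \is d.-homog -> (forall q, X q -> pvalue F q = 0) ->
    \sum_(j < n.+1) pvalue F^`M(j) p * w 0 j = 0.

Lemma exists_tangent_space X p :
  exists U : {vspace 'rV[K]_n.+1}, forall w, w \in U <-> tangent_vector X p w.
Proof.
pose P m := `[< exists U : {vspace 'rV[K]_n.+1}, \dim U = m /\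
                 forall w, w \in U -> tangent_vector X p w >].
have P0 : exists m, P m.
  exists 0%N; apply/asboolP; exists 0%VS; rewrite dimv0; split=> // w.
  by rewrite memv0 => /eqP-> d F _ _; rewrite big1 // => j _; rewrite mxE mulr0.
have Pub m : P m -> (m <= \dim {:'rV[K]_n.+1})%N.
  by move=> /asboolP[U [<- _]]; apply: dimvS; apply: subvf.
have [m /asboolP[U [dU UP]] mmax] := ex_maxnP P0 Pub.
exists U => w; split=> [/UP//|wt].
have Pw : P (\dim (U + <[w]>)%VS).
  apply/asboolP; exists (U + <[w]>)%VS; split=> // _ /memv_addP[u uU [_ /vlineP[c ->] ->]].
  move=> d F hF F0; have u0 := UP _ uU d F hF F0; have w0 := wt d F hF F0.
  rewrite (eq_bigr (fun j => pvalue F^`M(j) p * u 0 j +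
      c * (pvalue F^`M(j) p * w 0 j))); last first.
    by move=> j _; rewrite !mxE mulrDr mulrCA.
  by rewrite big_split /= u0 -mulr_sumr w0 mulr0 addr0.
have /eqP UE : U == (U + <[w]>)%VS by rewrite eqEdim addvSl dU mmax.
by rewrite UE; apply: (subvP (addvSr U <[w]>)); apply: memv_line.
Qed.

(* The embedded tangent space of X at p, as a subspace of K^(n+1). *)
Definition tangent_space X p : {vspace 'rV[K]_n.+1} :=
  sval (cid (exists_tangent_space X p)).

Lemma tangent_spaceP X p w : w \in tangent_space X p <-> tangent_vector X p w.
Proof. exact: (svalP (cid (exists_tangent_space X p))). Qed.

Definition smooth_points X : set (projspace K n) :=
  [set p | X p /\ pdim (tangent_space X p) = (krull_dim X)%:Z].

Definition Terracini (r : nat) X : set (conf (projspace K n) r) :=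
  closure_in (conf_in (smooth_points X))
    [set A | conf_in (smooth_points X) A /\
      pdim (\sum_(p <- conf_fset A) tangent_space X p)%VS
        < (r * (krull_dim X).+1)%:Z - 1].

End Terracini.

Arguments Terracini {K n} r X.

Section SegreVeronese.
Context (K : fieldType) {k : nat} (n d : 'I_k -> nat).

(* P^(n_1) x ... x P^(n_k), as a type of its own so that it is a choiceType. *)
Definition multiproj : Type := {dffun forall i : 'I_k, projspace K (n i)}.

HB.instance Definition _ := Choice.on multiproj.

(* Exponents of the monomials of degree d_i in n_i + 1 variables. *)
Definition exponent (i : 'I_k) : finType :=
  {t : (n i).+1.-tuple 'I_(d i).+1 | (\sum_(a <- t) a == d i)%N}.

(* Exponents of the monomials of multidegree (d_1, ..., d_k). *)
Definition multiexponent : finType := {dffun forall i : 'I_k, exponent i}.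

Definition SV_N : nat := (\prod_(i < k) 'C(n i + d i, n i)).-1.

Lemma card_multiexponent : #|multiexponent| = SV_N.+1.
Proof.
rewrite /SV_N prednK; last by rewrite prodn_gt0 // => i; rewrite bin_gt0 leq_addr.
rewrite card_dep_ffun foldrE big_map big_enum; apply: eq_bigr => i _.
rewrite /exponent card_sig -card_ord_partitions.
by apply: eq_card => t; rewrite !inE.
Qed.

(* The exponents of the j-th homogeneous coordinate of P^N. *)
Definition exponent_of (j : 'I_SV_N.+1) : multiexponent :=
  enum_val (cast_ord (esym card_multiexponent) j).

Definition SV_vector (v : forall i, 'rV[K]_(n i).+1) : 'rV[K]_SV_N.+1 :=
  \row_j \prod_(i < k) \prod_(a < (n i).+1)
    v i 0 a ^+ tnth (val (exponent_of j i)) a.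

Lemma SV_vector_neq0 v : (forall i, v i != 0) -> SV_vector v != 0.
Proof.
move=> v0; have /fin_all_exists[a va] : forall i, exists a, v i 0 a != 0.
  by move=> i; have /rV0Pn := v0 i.
pose e i : (n i).+1.-tuple 'I_(d i).+1 :=
  [tuple (if b == a i then ord_max else ord0) | b < (n i).+1].
have eP i : (\sum_(b <- e i) b == d i)%N.
  rewrite big_tuple (bigD1 (a i)) //= tnth_mktuple eqxx big1 ?addn0 // => b ba.
  by rewrite tnth_mktuple (negbTE ba).
pose m : multiexponent := [ffun i => Sub (e i) (eP i)].
apply/rV0Pn; exists (cast_ord card_multiexponent (enum_rank m)).
rewrite mxE /exponent_of cast_ordK enum_rankK.
apply/prodf_neq0 => i _; apply/prodf_neq0 => b _; rewrite ffunE /= tnth_mktuple.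
by case: (b =P a i) => [->|_]; [rewrite expf_neq0|rewrite expr0 oner_neq0].
Qed.

Definition SV_map (x : multiproj) : projspace K SV_N :=
  proj_point (SV_vector_neq0 (fun i => coords_neq0 (x i))).

(* SV_map does not depend on the choice of homogeneous coordinates. *)
Lemma SV_mapE (x : multiproj) (v : forall i, 'rV[K]_(n i).+1) :
  (forall i, v i != 0) -> (forall i, <[v i]>%VS = line (x i)) ->
  line (SV_map x) = <[SV_vector v]>%VS.
Proof.
move=> v0 vx; have /fin_all_exists2[c c0 vc] i := coordsP (v0 i) (vx i).
have -> : SV_vector v =
    (\prod_i c i ^+ d i) *: SV_vector (fun i => coords (x i)).
  apply/rowP => j; rewrite !mxE -big_split; apply: eq_bigr => i _ /=.
  rewrite -[X in _ ^+ X](eqP (valP (exponent_of j i))) big_tuple.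
  rewrite expr_sum -big_split; apply: eq_bigr => a _ /=.
  by rewrite vc mxE exprMn.
set a := \prod_i _; have a0 : a != 0 by apply/prodf_neq0 => i _; rewrite expf_neq0.
apply/esym/eqP; rewrite eqEdim !dim_vline scaler_eq0 (negbTE a0) /= leqnn andbT.
by rewrite -memvE memvZ ?memv_line.
Qed.

Definition SV : set (projspace K SV_N) := range SV_map.

Definition proj_set (r : nat) (S : conf multiproj r) (i : 'I_k) :
  {fset projspace K (n i)} := [fset (x : multiproj) i | x in conf_fset S]%fset.

Definition SV_T (r : nat) (i : 'I_k) : set (conf multiproj r) :=
  [set S | pdim (pspan (proj_set S i)) = 1 /\
    forall j, j != i -> exists p, proj_set S j = [fset p]%fset].

(* The set of all nu(S), for S in a set of configurations. *)
Definition SV_conf (r : nat) (A : set (conf multiproj r)) :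
  set (conf (projspace K SV_N) r) :=
  [set B | exists2 S, A S &
    conf_fset B = [fset SV_map x | x in conf_fset S]%fset].

End SegreVeronese.

Arguments SV K {k} n d.
Arguments SV_T K {k} n r i.
Arguments SV_conf {K k n} d {r} A.

(* uphalf m is the ceiling of m / 2. *)
Definition SV_bound (d : nat) : nat := uphalf (d + 2).

(* The value for i = 0 also serves as the initial value of the minimum. *)
Definition SV_r (k : nat) (d : 'I_k.+1 -> nat) : nat :=
  \big[minn/SV_bound (d ord0)]_(i < k.+1) SV_bound (d i).

Definition SV_J (k : nat) (d : 'I_k.+1 -> nat) : set 'I_k.+1 :=
  [set i | SV_bound (d i) = SV_r d].

(* Main.v *)
Require Import Defs.
From mathcomp Require Import all_boot all_order all_algebra fingroup perm finmap.
From mathcomp Require Import all_classical topology mpoly zify ring.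

Set Implicit Arguments.
Unset Strict Implicit.
Unset Printing Implicit Defensive.

Import GRing.Theory.

Local Open Scope classical_set_scope.
Local Open Scope ring_scope.

(** X is smooth, and its tangent space at nu(x) is spanned by nu(x) and the
    partial derivatives of nu: the quadrics X_J X_L - X_J' X_L' of its ideal
    leave no room for more. A linear form on P^N is a form of multidegree d, so
    the tangent spaces at r points are independent as soon as, for each point and
    each factor, some product of linear forms is nonzero at that point, is doubly
    zero at the others, and has one degree to spare in that factor. Since
    r <= ceil((d_i + 2) / 2), such products exist unless the points only differ
    in one factor i in J, where they are collinear: a hyperplane through two of
    the points, when it avoids the third one, saves a degree. For collinear points
    in a factor i in J the 2r tangent directions along the line live in the
    (d_i + 1)-dimensional span of a rational normal curve, and 2r > d_i + 1. Hence
    the degenerate configurations are exactly those of the families T_i, i in J.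

    For the dimension, T_i contains a dense family with polynomial parameters in
    affine space of the expected dimension m. A chain of irreducible closed sets
    of length m + 1 in its closure would provide m + 1 algebraically independent
    functions, more than polynomials in m variables allow; freezing the parameters
    one after the other gives a chain of length m. Functions on configurations are
    symmetrized multihomogeneous forms. *)

(** * Polynomial functions and the dimension of parametrized sets *)

(** The hypothesis on degrees equal to 1 matters for r = 2: two points that differ exactly in two
    factors of degree 1 have tangent spaces that meet, since exchanging one of the two coordinates
    gives a point of both. With at most one such factor, a double zero at the other point comes from
    the square of a form, or from two forms taken in different factors. Configurations form a
    quotient space without a coordinate ring at hand, and dimension is defined by chains of closed
    sets. Hence the notion of a class of functions with degrees ([form_system]), checked once for
    P^N, where it gives the dimension of X and so its smoothness, and once for configurations.
    Independence contradicts a parametrization by counting: m + 1 functions have B^(m+1) monomials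
    with exponents less than B, but their pullbacks have degree linear in B, hence lie in a space of
    dimension O(B^m). General position is always obtained in the same way: restrict to an affine
    line, and take a parameter that is not a root of some nonzero univariate polynomial. *)

Section PolynomialFunctions.
Context {K : fieldType} {I : finType}.
Implicit Types f g : (I -> K) -> K.

Definition polyfun D f := exists P : {mpoly K[#|I|]},
  (msize P <= D.+1)%N /\ forall x, f x = P.@[x \o enum_val].

Lemma polyfun_ext D f g : f =1 g -> polyfun D f -> polyfun D g.
Proof. by move=> fg [P [sP fP]]; exists P; split=> // x; rewrite -fg. Qed.

Lemma polyfunW D D' f : (D <= D')%N -> polyfun D f -> polyfun D' f.
Proof. by move=> DD' [P [sP fP]]; exists P; split=> //; exact: leq_trans sP _. Qed.

Lemma polyfunC D c : polyfun D (fun=> c).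
Proof.
exists c%:MP; split=> [|x]; last by rewrite mevalC.
by rewrite msizeC; case: (c != 0).
Qed.

Lemma polyfun_var i : polyfun 1 (fun x => x i).
Proof.
exists 'X_(enum_rank i); split=> [|x]; first by rewrite msizeX mdeg1.
by rewrite mevalXU /= enum_rankK.
Qed.

Lemma polyfunD D f g : polyfun D f -> polyfun D g -> polyfun D (fun x => f x + g x).
Proof.
move=> [P [sP fP]] [Q [sQ gQ]]; exists (P + Q); split=> [|x].
  by apply: leq_trans (msizeD_le _ _) _; rewrite geq_max sP.
by rewrite mevalD fP gQ.
Qed.

Lemma polyfunM D E f g :
  polyfun D f -> polyfun E g -> polyfun (D + E) (fun x => f x * g x).
Proof.
move=> [P [sP fP]] [Q [sQ gQ]]; exists (P * Q); split=> [|x]; last by rewrite mevalM fP gQ.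
have [->|P0] := eqVneq P 0; first by rewrite mul0r msize0.
have [->|Q0] := eqVneq Q 0; first by rewrite mulr0 msize0.
rewrite msizeM //; move: sP sQ; case: (msize P) => [|a]; case: (msize Q) => [|b] //=.
- by rewrite ltnS => _ /leq_trans; apply; rewrite leqW // leq_addl.
- by rewrite addn0 ltnS => /leq_trans + _; apply; rewrite leqW // leq_addr.
- by rewrite addnS !ltnS; exact: leq_add.
Qed.

Lemma polyfunZ D c f : polyfun D f -> polyfun D (fun x => c * f x).
Proof. by move=> /(polyfunM (polyfunC 0 c)). Qed.

Lemma polyfun_sum (J : Type) (r : seq J) (R : pred J) D (F : J -> (I -> K) -> K) :
  (forall j, R j -> polyfun D (F j)) ->
  polyfun D (fun x => \sum_(j <- r | R j) F j x).
Proof.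
move=> FD; elim: r => [|j r IH].
  by apply: polyfun_ext (polyfunC D 0) => x; rewrite big_nil.
have [Rj|Rj] := boolP (R j); last first.
  by apply: polyfun_ext IH => x; rewrite big_cons (negbTE Rj).
by apply: polyfun_ext (polyfunD (FD j Rj) IH) => x; rewrite big_cons Rj.
Qed.

Lemma polyfun_prod (J : Type) (r : seq J) (R : pred J) (D : J -> nat)
    (F : J -> (I -> K) -> K) :
  (forall j, R j -> polyfun (D j) (F j)) ->
  polyfun (\sum_(j <- r | R j) D j) (fun x => \prod_(j <- r | R j) F j x).
Proof.
move=> FD; elim: r => [|j r IH].
  by rewrite big_nil; apply: polyfun_ext (polyfunC 0 1) => x; rewrite big_nil.
have [Rj|Rj] := boolP (R j); last first.
  by rewrite big_cons (negbTE Rj); apply: polyfun_ext IH => x; rewrite big_cons (negbTE Rj).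
by rewrite big_cons Rj; apply: polyfun_ext (polyfunM (FD j Rj) IH) => x; rewrite big_cons Rj.
Qed.

Lemma polyfunX D k f : polyfun D f -> polyfun (k * D) (fun x => f x ^+ k).
Proof.
move=> fD; have := @polyfun_prod 'I_k (index_enum _) xpredT (fun=> D) (fun=> f) (fun _ _ => fD).
rewrite sum_nat_const card_ord; apply: polyfun_ext => x.
by rewrite prodr_const card_ord.
Qed.

Lemma polyfun_meval N D E (F : {mpoly K[N]}) (G : 'I_N -> (I -> K) -> K) :
  (forall j, polyfun D (G j)) -> (forall m, m \in msupp F -> (mdeg m <= E)%N) ->
  polyfun (E * D) (fun x => F.@[fun j => G j x]).
Proof.
move=> GD FE; apply: (@polyfun_ext _
    (fun x => \sum_(m <- msupp F | m \in msupp F) F@_m * \prod_j G j x ^+ m j)).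
  by move=> x; rewrite mevalE -big_seq.
apply: polyfun_sum => m mF; apply: polyfunZ.
have := @polyfun_prod _ (index_enum 'I_N) xpredT (fun j => m j * D)%N
  (fun j x => G j x ^+ m j) (fun j _ => polyfunX (m j) (GD j)).
apply: polyfunW; rewrite -big_distrl /=; apply: leq_mul => //.
by rewrite -mdegE; exact: FE.
Qed.

Lemma meval_horner N (P : {mpoly K[N]}) (p : 'I_N -> {poly K}) :
  exists q : {poly K}, forall t, q.[t] = P.@[fun j => (p j).[t]].
Proof.
exists (\sum_(m <- msupp P) (P@_m)%:P * \prod_j p j ^+ m j) => t.
rewrite mevalE horner_sum; apply: eq_bigr => m _.
rewrite hornerM hornerC horner_prod; congr (_ * _); apply: eq_bigr => j _.
by rewrite horner_exp.
Qed.

Lemma polyfun_line D f (x y : I -> K) : polyfun D f ->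
  exists q : {poly K}, forall t, q.[t] = f (fun i => x i + t * (y i - x i)).
Proof.
move=> [P [_ fP]].
have [q qP] := meval_horner P (fun j => (x (enum_val j))%:P + 'X * (y (enum_val j) - x (enum_val j))%:P).
exists q => t; rewrite qP fP; apply: meval_eq => j /=.
by rewrite hornerD hornerM !hornerC hornerX.
Qed.

(** The exponents of a polynomial of degree at most D lie in a box of side D + 1, so the matrix of
    coefficients has more rows than columns. *)
Lemma polyfun_dep (A : finType) D (f : A -> (I -> K) -> K) :
  (forall a, polyfun D (f a)) -> (D.+1 ^ #|I| < #|A|)%N ->
  exists2 c : A -> K, (exists a, c a != 0) & forall x, \sum_a c a * f a x = 0.
Proof.
move=> /choice[P PP] cardA.
pose mon (b : {ffun 'I_#|I| -> 'I_D.+1}) : 'X_{1..#|I|} := [multinom (b i : nat) | i < #|I|].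
pose M := \matrix_(a < #|A|, b < #|{ffun 'I_#|I| -> 'I_D.+1}|)
  (P (enum_val a))@_(mon (enum_val b)).
have : kermx M != 0.
  rewrite kermx_eq0 /row_free neq_ltn (leq_ltn_trans (rank_leq_col M)) //.
  by rewrite card_ffun !card_ord.
case/rowV0Pn => v /sub_kermxP vM /rV0Pn[a0 va0].
exists (fun a => v 0 (enum_rank a)); first by exists (enum_val a0); rewrite enum_valK.
move=> x; have -> : \sum_a v 0 (enum_rank a) * f a x =
    (\sum_a v 0 (enum_rank a) *: P a).@[x \o enum_val].
  by rewrite raddf_sum /=; apply: eq_bigr => a _; rewrite mevalZ; have [_ ->] := PP a.
suff -> : \sum_a v 0 (enum_rank a) *: P a = 0 by rewrite meval0.
apply/mpolyP => m; rewrite mcoeff0 raddf_sum /=.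
have [mD|mD] := boolP [forall i, (m i < D.+1)%N]; last first.
  apply: big1 => a _; rewrite mcoeffZ memN_msupp_eq0 ?mulr0 //.
  have [sP _] := PP a; apply: contra mD => mP; apply/forallP => i.
  have /leq_trans/(_ sP) := msize_mdeg_lt mP; rewrite !ltnS; apply: leq_trans.
  by rewrite mdegE (bigD1 i) //= leq_addr.
pose b : {ffun 'I_#|I| -> 'I_D.+1} := [ffun i => Ordinal (forallP mD i)].
have mb : mon b = m by apply/mnmP => i; rewrite mnmE ffunE.
have := congr1 (fun w : 'rV_ _ => w 0 (enum_rank b)) vM; rewrite !mxE => E.
rewrite -[RHS]E (reindex _ (onW_bij _ (enum_val_bij A))) /=.
by apply: eq_bigr => j _; rewrite mcoeffZ mxE enum_valK enum_rankK mb.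
Qed.

End PolynomialFunctions.

Lemma poly_nonroot (K : closedFieldType) (p : {poly K}) :
  p != 0 -> exists t, p.[t] != 0.
Proof. by move=> /closed_nonrootP. Qed.

Lemma horner_neq0 (R : nzRingType) (p : {poly R}) t : p.[t] != 0 -> p != 0.
Proof. by apply: contraNneq => ->; rewrite horner0. Qed.

(* A graded algebra of K-valued functions that defines the topology of T. *)
Record form_system (K : fieldType) (T : topologicalType)
    (form : nat -> (T -> K) -> Prop) : Prop := FormSystem {
  form_zero : forall e, form e (fun=> 0);
  form_one : form 0%N (fun=> 1);
  form_add : forall e f g, form e f -> form e g -> form e (fun t => f t + g t);
  form_scale : forall e c f, form e f -> form e (fun t => c * f t);
  form_mul : forall e1 e2 f g, form e1 f -> form e2 g ->
    form (e1 + e2)%N (fun t => f t * g t);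
  form_closed : forall e f, form e f -> closed [set t | f t = 0];
  form_sep : forall W t, closed W -> ~ W t ->
    exists e f, [/\ form e f, forall u, W u -> f u = 0 & f t != 0];
  form_pos : forall t, exists e f, [/\ (0 < e)%N, form e f & f t != 0] }.

Section FormSystem.
Context {K : fieldType} {T : topologicalType} {form : nat -> (T -> K) -> Prop}.
Hypothesis FS : form_system form.

Lemma form_ext e f g : f =1 g -> form e f -> form e g.
Proof. by move=> /funext->. Qed.

Lemma form_sum (J : Type) (r : seq J) (R : pred J) e (F : J -> T -> K) :
  (forall j, R j -> form e (F j)) ->
  form e (fun t => \sum_(j <- r | R j) F j t).
Proof.
move=> Fe; elim: r => [|j r IH].
  by apply: form_ext (form_zero FS e) => t; rewrite big_nil.
have [Rj|Rj] := boolP (R j); last first.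
  by apply: form_ext IH => t; rewrite big_cons (negbTE Rj).
by apply: form_ext (form_add FS (Fe j Rj) IH) => t; rewrite big_cons Rj.
Qed.

Lemma form_exp e k f : form e f -> form (k * e)%N (fun t => f t ^+ k).
Proof.
move=> fe; elim: k => [|k IH]; first exact: form_ext (form_one FS).
by rewrite mulSn; apply: form_ext (form_mul FS fe IH) => t; rewrite exprS.
Qed.

(** On an irreducible set forms multiply as in an integral domain: the zero loci of f and g are
    closed and cover C, and that of f misses t0. *)
Lemma irr_cancel (C : set T) d e f g t0 : irreducible_set C ->
  form d f -> form e g -> C t0 -> f t0 != 0 -> (forall t, C t -> f t * g t = 0) ->
  forall t, C t -> g t = 0.
Proof.
move=> [_ irrC] fd ge Ct0 ft0 fg0 t Ct.
have [|/(_ _ Ct0)/= f0|] := irrC _ _ (form_closed FS fd) (form_closed FS ge).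
- by move=> u Cu /=; have /eqP := fg0 u Cu; rewrite mulf_eq0 => /orP[]/eqP; [left|right].
- by rewrite f0 eqxx in ft0.
- by apply.
Qed.

Lemma form_closure e f A : form e f -> (forall t, A t -> f t = 0) ->
  forall t, closure A t -> f t = 0.
Proof.
move=> fe fA t; move/(form_closed FS): fe => /closure_id fE clAt.
have : closure [set t | f t = 0] t by apply: closureS clAt.
by rewrite -fE.
Qed.

(** * Algebraic independence along a chain of irreducible closed sets *)

Section ChainIndependence.
Variables (B E M : nat) (C : nat -> set T) (h : nat -> T -> K) (L : T -> K) (t0 : T).
Hypotheses (irrC : forall i, (i <= M)%N -> irreducible_set (C i))
  (subC : forall i, (i < M)%N -> C i `<=` C i.+1)
  (hE : forall i, (i < M)%N -> form E (h i)) (LE : form E L)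
  (h0 : forall i t, (i < M)%N -> C i t -> h i t = 0)
  (hn0 : forall i, (i < M)%N -> exists2 t, C i.+1 t & h i t != 0)
  (Ct0 : C 0%N t0) (Lt0 : L t0 != 0).

(** Exponents are nested pairs with the last function outermost, so that the induction on k can
    isolate its powers. *)
Fixpoint mon_idx k : finType :=
  if k is k'.+1 then ('I_B * mon_idx k')%type : finType else unit.

Lemma card_mon_idx k : #|mon_idx k| = (B ^ k)%N.
Proof.
by elim: k => [|k IH]; rewrite ?card_unit // expnS -IH -[in RHS](card_ord B) -card_prod.
Qed.

(* The monomials in h_0, ..., h_(k-1) with exponents less than B, made
   homogeneous by powers of L. *)
Fixpoint hmon k : mon_idx k -> T -> K :=
  if k is k'.+1 return mon_idx k -> T -> K then
    fun a t => h k' t ^+ a.1 * L t ^+ (B - a.1) * hmon a.2 t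
  else fun _ _ => 1.

Lemma form_hmon k (a : mon_idx k) : (k <= M)%N -> form (k * (B * E))%N (hmon a).
Proof.
elim: k a => [|k IH] a kM; first exact: form_one.
rewrite mulSn; apply: (form_mul FS); last by apply: IH; exact: ltnW.
have -> : (B * E = a.1 * E + (B - a.1) * E)%N by rewrite -mulnDl subnKC // ltnW.
by apply: (form_mul FS); apply: form_exp => //; exact: hE.
Qed.

Lemma chain_t0 k : (k <= M)%N -> C k t0.
Proof. by elim: k => [//|k IH] kM; apply: subC => //; apply: IH; exact: ltnW. Qed.

(* The least power of h_k cancels on C_(k+1); then restrict to C_k, where h_k
   vanishes. *)
Lemma chain_independence k (c : mon_idx k -> K) : (k <= M)%N ->
  (forall t, C k t -> \sum_a c a * hmon a t = 0) -> forall a, c a = 0.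
Proof.
elim: k c => [|k IH] c kM c0.
  by move=> []; have := c0 _ Ct0; rewrite (bigD1 tt) //= big1 ?mulr1 ?addr0 // => -[].
have kM' := ltnW kM.
pose S q t := \sum_(a : mon_idx k) c (q, a) * hmon a t.
have Sform q : form (k * (B * E))%N (S q).
  by apply: form_sum => a _; apply: (form_scale FS); exact: form_hmon.
have cS t : C k.+1 t -> \sum_(q < B) h k t ^+ q * L t ^+ (B - q) * S q t = 0.
  move=> /c0 ct; rewrite -[RHS]ct /S; under eq_bigr do rewrite mulr_sumr.
  by rewrite pair_bigA; apply: eq_bigr => -[q a] _ /=; rewrite mulrCA.
suff IHq q : forall q' : 'I_B, (q' < q)%N -> forall a, c (q', a) = 0.
  by move=> [q a]; apply: (IHq B).
elim: q => [//|q IHq] q' q'q a.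
have [/IHq->//|qq'] := ltnP q' q.
have {qq' q'q} q'q : q' = q :> nat by apply/eqP; rewrite eqn_leq qq' -ltnS q'q.
suff : forall t, C k t -> S q' t = 0 by move=> /IH; apply.
(* With the exponents below q already discarded, the relation on C_(k+1) is h_k^q * G; R collects
   the higher powers, and on C_k only the first term of G survives. *)
pose R t := \sum_(p < B | (q < p)%N) h k t ^+ (p - q.+1) * L t ^+ (B - p) * S p t.
pose G t := L t ^+ (B - q) * S q' t + h k t * R t.
have qB : (q < B)%N by rewrite -q'q.
have Gform : form ((B - q) * E + k * (B * E))%N G.
  apply: (form_add FS); first by apply: (form_mul FS) => //; exact: form_exp.
  have -> : ((B - q) * E + k * (B * E) = E + ((B - q.+1) * E + k * (B * E)))%N.
    by rewrite addnA -mulSn -subSn // subSS.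
  apply: (form_mul FS); first exact: hE.
  apply: form_sum => p qp; apply: (form_mul FS) => //.
  have -> : (B - q.+1 = (p - q.+1) + (B - p))%N by rewrite addnC addnBA // subnK // ltnW.
  by rewrite mulnDl; apply: (form_mul FS); apply: form_exp => //; exact: hE.
have hG t : C k.+1 t -> h k t ^+ q * G t = 0.
  move=> /cS ct; rewrite -[RHS]ct (bigID (fun p : 'I_B => (q < p)%N)) /= addrC.
  rewrite [X in _ = X + _](bigD1 q') /= ?q'q ?ltnn // big1 ?addr0; last first.
    move=> p /andP[]; rewrite -leqNgt => pq pq'.
    have pq2 : (p < q)%N by rewrite ltn_neqAle pq andbT -q'q.
    by rewrite /S big1 ?mulr0 // => b _; rewrite IHq // mul0r.
  rewrite mulrDr mulrA; congr (_ + _).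
  rewrite mulrA mulr_sumr; apply: eq_bigr => p qp.
  by rewrite !mulrA -exprSr -exprD subnKC.
have G0 : forall t, C k.+1 t -> G t = 0.
  have [t1 Ct1 ht1] := hn0 kM.
  apply: (irr_cancel (irrC kM) (form_exp q (hE kM)) Gform Ct1 _ hG).
  by rewrite expf_neq0.
apply: (irr_cancel (irrC kM') (form_exp (B - q) LE) (Sform _) (chain_t0 kM')).
  by rewrite expf_neq0.
move=> t Ckt; have := G0 t (subC kM Ckt).
by rewrite /G h0 // mul0r addr0.
Qed.

End ChainIndependence.
End FormSystem.

Lemma irreducible_closure_in (T : topologicalType) (A Z : set T) :
  A `<=` Z -> irreducible_set A -> irreducible_set (closure_in Z A).
Proof.
move=> AZ [[a Aa] irrA]; split; first by exists a; split; [exact: subset_closure|exact: AZ].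
move=> F G cF cG sub.
have {}sub : A `<=` F `|` G.
  by move=> x Ax; apply: sub; split; [exact: subset_closure|exact: AZ].
by have [AF|AG] := irrA _ _ cF cG sub; [left|right] => x -[clx _];
  [rewrite ((closure_id F).1 cF)|rewrite ((closure_id G).1 cG)];
  apply: closureS clx.
Qed.

Lemma closure_in_closed (T : topologicalType) (A Z F : set T) :
  closed F -> A `<=` F -> closure_in Z A `<=` F.
Proof.
by move=> cF AF x -[clx _]; rewrite ((closure_id F).1 cF); apply: closureS clx.
Qed.

Definition upd (K : Type) (I : eqType) (x : I -> K) (i : I) (v : K) : I -> K :=
  fun j => if j == i then v else x j.

(** * Irreducibility and dimension of parametrized sets *)

Section Parametrization.
Context {K : closedFieldType} {T : topologicalType} {form : nat -> (T -> K) -> Prop}.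
Hypothesis FS : form_system form.
Context {I : finType}.
Implicit Types (x y : I -> K) (A U : set (I -> K)).

(** The points of T have no canonical coordinates, so phi is only tested through forms. The factor u
    x absorbs the choice of homogeneous coordinates and need not be polynomial in x; the degree of
    the pullback is linear in e. *)
Record parametrization (phi : (I -> K) -> T) U : Prop := Parametrization {
  param_dom : exists D g, polyfun D g /\ forall x, U x <-> g x != 0;
  param_form : exists D u, (forall x, U x -> u x != 0) /\
    forall e f, form e f -> exists2 P, polyfun (D * e) P &
      forall x, U x -> P x = u x ^+ e * f (phi x) }.

Context {phi : (I -> K) -> T} {U : set (I -> K)}.
Hypothesis param : parametrization phi U.

Definition line_closed A :=
  forall x y t, A x -> A y -> A (fun i => x i + t * (y i - x i)).

(** If x and y show that neither F nor G contains the image, the forms that separate them restrict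
    to nonzero polynomials on the line from x to y; a general point of this line then escapes both F
    and G. *)
Lemma param_irreducible A : line_closed A -> (A `&` U) !=set0 ->
  irreducible_set (phi @` (A `&` U)).
Proof.
move=> lA [a [Aa Ua]]; split; first by exists (phi a); exists a.
move=> F G cF cG sub; apply: contrapT => /not_orP[/existsNP[_ /not_implyP[[x [Ax Ux] <-] nFx]]].
move=> /existsNP[_ /not_implyP[[y [Ay Uy] <-] nGy]].
have [e [f [fe f0 fx]]] := form_sep FS cF nFx.
have [e' [f' [fe' f0' fy]]] := form_sep FS cG nGy.
have [D [g [gD Ug]]] := param_dom param.
have [D' [u [u0 uP]]] := param_form param.
have [P PD PE] := uP _ _ fe; have [P' PD' PE'] := uP _ _ fe'.
have [p pE] := polyfun_line x y PD; have [p' pE'] := polyfun_line x y PD'.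
have [q qE] := polyfun_line x y gD.
have line0 : (fun i => x i + 0 * (y i - x i)) = x by apply/funext => i; rewrite mul0r addr0.
have line1 : (fun i => x i + 1 * (y i - x i)) = y by apply/funext => i; rewrite mul1r addrC subrK.
have p0 : p != 0.
  by apply: (@horner_neq0 _ _ 0); rewrite pE line0 PE // mulf_neq0 // expf_neq0 // u0.
have p0' : p' != 0.
  by apply: (@horner_neq0 _ _ 1); rewrite pE' line1 PE' // mulf_neq0 // expf_neq0 // u0.
have q0 : q != 0 by apply: (@horner_neq0 _ _ 0); rewrite qE line0; apply/Ug.
have [t] := poly_nonroot (mulf_neq0 q0 (mulf_neq0 p0 p0')).
rewrite !hornerM !mulf_eq0 !negb_or qE pE pE' => /and3P[/Ug Uz].
rewrite PE // PE' // !mulf_eq0 !negb_or => /andP[_ fz] /andP[_ fz'].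
have : (F `|` G) (phi (fun i => x i + t * (y i - x i))).
  by apply: sub; exists (fun i => x i + t * (y i - x i)) => //; split=> //; exact: lA.
by case=> [/f0|/f0'] E; [rewrite E eqxx in fz|rewrite E eqxx in fz'].
Qed.

Lemma param_no_chain (Z : set T) : Z `<=` closure (phi @` U) ->
  ~ exists C, irreducible_chain Z #|I|.+1 C.
Proof.
move=> ZU [C]; have [M EM] : exists M, M = #|I|.+1 by exists #|I|.+1.
rewrite -EM => -[irrC subC].
have sub i : (i < M)%N -> C i `<=` C i.+1 by move=> /subC/properW.
have CZ i t : (i <= M)%N -> C i t -> Z t.
  by move=> /irrC[_ [F _ ->]] [].
have [t0 Ct0] : C 0%N !=set0 by have [[]] := irrC 0%N isT.
have [e0 [l [e0_gt0 le lt0]]] := form_pos FS t0.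
have /choice[h hP] : forall i, exists ef : nat * (T -> K), (i < M)%N ->
    [/\ form ef.1 ef.2, forall t, C i t -> ef.2 t = 0 & exists2 t, C i.+1 t & ef.2 t != 0].
  move=> i; have [iM|] := ltnP i M; last by exists (0%N, fun=> 0).
  have [_ /existsNP[t /not_implyP[Ct nCt]]] := subC i iM.
  have [_ [F cF CF]] := irrC i (ltnW iM).
  have nFt : ~ F t by move=> Ft; apply: nCt; rewrite CF; split=> //; apply: CZ Ct.
  have [e [f [fe f0 ft]]] := form_sep FS cF nFt.
  exists (e, f) => _; split=> //=; last by exists t.
  by move=> u; rewrite CF => -[Fu _]; exact: f0.
pose E := (\max_(i < M) (h i).1)%N.
have hE i : (i < M)%N -> ((h i).1 <= E)%N.
  by move=> iM; exact: (leq_bigmax (Ordinal iM)).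
(* The separating forms have various degrees; the power e0 and a power of l bring them all to degree
   E * e0. The form l is nonzero at t0, a point of every member of the chain. *)
pose H i t := (h i).2 t ^+ e0 * l t ^+ (E - (h i).1).
pose L t := l t ^+ E.
have Hform i : (i < M)%N -> form (E * e0)%N (H i).
  move=> iM; have [hform _ _] := hP i iM.
  have -> : (E * e0 = e0 * (h i).1 + (E - (h i).1) * e0)%N.
    by rewrite [(e0 * _)%N]mulnC -mulnDl subnKC // hE.
  by apply: (form_mul FS); exact: form_exp.
have Lform : form (E * e0)%N L by exact: form_exp.
have H0 i t : (i < M)%N -> C i t -> H i t = 0.
  move=> iM Ct; have [_ h0 _] := hP i iM.
  by rewrite /H h0 // expr0n eqn0Ngt e0_gt0 mul0r.
have C0 i : (i <= M)%N -> C i t0 by exact: chain_t0.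
have Hn0 i : (i < M)%N -> exists2 t, C i.+1 t & H i t != 0.
  move=> iM; have [hform _ [t Ct ht]] := hP i iM.
  (* Otherwise a power of l, nonzero at t0, would annihilate [(h i).2 ^+ e0] on C_(i+1), and it can
     be cancelled there. *)
  apply: contrapT => /forall2NP nH; suff ht0 : (h i).2 t ^+ e0 = 0.
    by move: ht0 => /eqP; rewrite expf_eq0 (negbTE ht) andbF.
  have [irr _] := irrC i.+1 iM.
  apply: (irr_cancel FS irr (form_exp FS (E - (h i).1) le) (form_exp FS e0 hform) (C0 _ iM)) Ct.
    by rewrite expf_neq0.
  move=> u Cu; have [|/negP/negPn/eqP] := nH u; first by [].
  by rewrite /H mulrC.
have [D [u [u0 uP]]] := param_form param.
(* Pulled back, a monomial has degree less than k * B, which leaves room for at most (k * B) ^ #|I|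
   coefficients. This is less than B ^ #|I|.+1, the number of monomials, because B exceeds k ^
   #|I|. *)
pose k := (D * (M * (E * e0))).+1; pose B := (k ^ #|I|).+1.
have irrC' i : (i <= M)%N -> irreducible_set (C i) by move=> /irrC[].
have /choice[P PP] : forall a : mon_idx B M, exists P, polyfun (D * (M * (B * (E * e0)))) P /\
    forall x, U x -> P x = u x ^+ (M * (B * (E * e0))) * hmon H L a (phi x).
  move=> a; have [P PD PE] := uP _ _ (form_hmon FS Hform Lform a (leqnn M)).
  by exists P.
have cardM : ((D * (M * (B * (E * e0)))).+1 ^ #|I| < #|mon_idx B M|)%N.
  rewrite card_mon_idx {2}EM; apply: (@leq_ltn_trans ((k * B) ^ #|I|)).
    have [->//|I0] := posnP #|I|; rewrite leq_exp2r //.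
    have -> : (D * (M * (B * (E * e0))) = D * (M * (E * e0)) * B)%N.
      by rewrite [(B * _)%N]mulnC !mulnA.
    by rewrite /k mulSn -add1n leq_add2r.
  by rewrite expnMn [X in (_ < X)%N]expnS ltn_pmul2r // expn_gt0.
have [c [a ca] c0] := polyfun_dep (fun a => (PP a).1) cardM.
case/eqP: ca; apply: (chain_independence FS irrC' sub Hform Lform H0 Hn0 Ct0 _ (leqnn M)).
  by rewrite expf_neq0.
move=> t Ct; pose f t := \sum_(b : mon_idx B M) c b * hmon H L b t.
have ff : form (M * (B * (E * e0))) f.
  rewrite /f; apply: (form_sum FS) => b _.
  exact: (form_scale FS (c b) (form_hmon FS Hform Lform b (leqnn M))).
(* The relation is a form, so it is enough to check it on the image of phi, whose closure contains
   the chain. *)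
apply: (form_closure FS ff) (ZU _ (CZ _ _ (leqnn M) Ct)) => _ [x Ux <-].
apply: (mulfI (expf_neq0 (M * (B * (E * e0))) (u0 x Ux))).
rewrite mulr0 -[RHS](c0 x) /f mulr_sumr; apply: eq_bigr => b _.
by have [_ ->] := PP b; rewrite // mulrCA.
Qed.

(** The closed set W attached to i holds as soon as the i-th parameter has its base value and fails
    after moving that parameter alone: this makes the inclusion of consecutive closures strict. *)
Lemma param_has_dim (x0 : I -> K) (Z : set T) : U x0 ->
  (forall i, exists W, [/\ closed W, forall x, U x -> x i = x0 i -> W (phi x) &
     exists v, U (upd x0 i v) /\ ~ W (phi (upd x0 i v))]) ->
  phi @` U `<=` Z -> Z `<=` closure (phi @` U) -> has_dim Z #|I|.
Proof.
move=> Ux0 sep UZ ZU; split; last exact: param_no_chain.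
pose A l := [set x : I -> K | forall i, (l <= enum_rank i)%N -> x i = x0 i].
have lA l : line_closed (A l).
  by move=> x y t Ax Ay i li; rewrite Ax // Ay // subrr mulr0 addr0.
have AUZ l : phi @` (A l `&` U) `<=` Z.
  by move=> _ [x [_ Ux] <-]; apply: UZ; exists x.
exists (fun l => closure_in Z (phi @` (A l `&` U))); split=> l lI.
  split; last by exists (closure (phi @` (A l `&` U))) => //; exact: closed_closure.
  by apply: irreducible_closure_in => //; apply: param_irreducible => //; exists x0.
have [W [cW WU [v [Uv nW]]]] := sep (enum_val (Ordinal lI)).
split.
  move=> t [clt Zt]; split=> //; apply: closureS clt.
  by move=> _ [x [Ax Ux] <-]; exists x => //; split=> // i li; apply: Ax; exact: ltnW.
move=> sub; apply: nW; apply: (@closure_in_closed _ (phi @` (A l `&` U)) Z) => //.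
  by move=> _ [x [Ax Ux] <-]; apply: WU => //; apply: Ax; rewrite enum_valK.
apply: sub; split; last by apply: UZ; exists (upd x0 (enum_val (Ordinal lI)) v).
apply: subset_closure; exists (upd x0 (enum_val (Ordinal lI)) v) => //; split=> //.
by move=> i li; rewrite /upd; case: eqP => // ii; move: li; rewrite ii enum_valK ltnn.
Qed.

End Parametrization.

Arguments parametrization {K T} form {I} phi U.

(** * Forms on projective spaces and on configurations *)

Lemma mxvec_index_inj m n (i i' : 'I_m) (j j' : 'I_n) :
  mxvec_index i j = mxvec_index i' j' -> (i, j) = (i', j').
Proof.
case: (curry_mxvec_bij m n) => g gK _ E.
by rewrite -(gK (i, j) isT) -(gK (i', j') isT) /= E.
Qed.

Lemma big_mxvec (R : Type) (idx : R) (op : Monoid.com_law idx) m n (F : 'I_(m * n) -> R) :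
  \big[op/idx]_a F a = \big[op/idx]_i \big[op/idx]_j F (mxvec_index i j).
Proof.
by rewrite (reindex _ (curry_mxvec_bij m n)) pair_bigA; apply: eq_bigr => -[].
Qed.

Section ProjectiveForms.
Context {K : closedFieldType} {N : nat}.
Implicit Types (W : set (projspace K N)) (F : {mpoly K[N.+1]}).

Definition pform e (f : projspace K N -> K) :=
  exists2 F : {mpoly K[N.+1]}, F \is e.-homog & f =1 pvalue F.

Lemma basic_open_sub W p : open W -> W p ->
  exists e F, [/\ F \is e.-homog, pvalue F p != 0 &
    forall q, pvalue F q != 0 -> W q].
Proof.
move=> [D sD <-] [V DV Vp]; have [e [F [hF VE]]] := sD _ DV.
exists e, F; split=> //; first by move: Vp; rewrite VE.
by move=> q Fq; exists V => //; rewrite VE.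
Qed.

Lemma basic_open_open (V : set (projspace K N)) : basic_open V -> open V.
Proof. by move=> bV; exists [set V]; rewrite ?bigcup_set1 // => _ ->. Qed.

Lemma closed_zeros e F : F \is e.-homog -> closed [set p | pvalue F p = 0].
Proof.
move=> hF; rewrite -openC; apply: basic_open_open; exists e, F; split=> //.
by apply/seteqP; split=> p /= /eqP.
Qed.

Lemma pform_system : form_system pform.
Proof.
split.
- by move=> e; exists 0 => [|p]; [exact: dhomog0|rewrite /pvalue meval0].
- by exists 1 => [|p]; [exact: dhomog1|rewrite /pvalue meval1].
- move=> e f g [F hF fF] [G hG gG]; exists (F + G) => [|p]; first exact: dhomogD.
  by rewrite /pvalue mevalD fF gG.
- move=> e c f [F hF fF]; exists (c *: F) => [|p]; first exact: dhomogZ.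
  by rewrite /pvalue mevalZ fF.
- move=> d e f g [F hF fF] [G hG gG]; exists (F * G) => [|p]; first exact: dhomogM.
  by rewrite /pvalue mevalM fF gG.
- move=> e f [F hF /funext->]; exact: closed_zeros hF.
- move=> W p /closed_openC oW nWp.
  have [e [F [hF Fp FW]]] := basic_open_sub oW nWp.
  exists e, (pvalue F); split=> //; first by exists F.
  by move=> q Wq; apply/eqP; apply: contraPT Wq => /FW.
- move=> p; have /rV0Pn[j pj] := coords_neq0 p.
  exists 1%N, (pvalue 'X_j); split=> //; last by rewrite /pvalue mevalXU.
  by exists 'X_j => //; rewrite dhomogX; apply/eqP; exact: mdeg1.
Qed.

Lemma pvalue_scale e F p (v : 'rV[K]_N.+1) c : F \is e.-homog -> v = c *: coords p ->
  F.@[fun j => v 0 j] = c ^+ e * pvalue F p.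
Proof.
move=> /dhomogP hF ->; rewrite /pvalue !mevalE mulr_sumr !big_seq.
apply: eq_bigr => m mF; rewrite mulrCA; congr (_ * _).
rewrite -(hF m mF) /= mdegE expr_sum -big_split /=; apply: eq_bigr => j _.
by rewrite mxE exprMn.
Qed.

End ProjectiveForms.

Section PowerForms.
Context {K : closedFieldType} {N r : nat}.
Local Notation cnf := (conf (projspace K N) r).
Implicit Types (F G : {mpoly K[r * N.+1]}) (t : r.-tuple (projspace K N)) (A : cnf)
  (e : 'I_r -> nat).

Definition enumerates t A := uniq t /\ conf_fset A =i t.

Lemma pwbasic_open_sub (W : set (proj_power K N r)) (t : proj_power K N r) :
  open W -> W t ->
  exists e F, [/\ multihomogeneous e F, pwvalue F t != 0 &
    forall u : proj_power K N r, pwvalue F u != 0 -> W u].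
Proof.
move=> [D sD <-] [V DV Vp]; have [e [F [hF VE]]] := sD _ DV.
exists e, F; split=> //; first by move: Vp; rewrite VE.
by move=> q Fq; exists V => //; rewrite VE.
Qed.

Lemma closed_pwzeros e F : multihomogeneous e F ->
  closed [set t : proj_power K N r | pwvalue F t = 0].
Proof.
move=> hF; rewrite -openC.
exists [set [set t : proj_power K N r | pwvalue F t != 0]].
  by move=> _ ->; exists e, F.
by rewrite bigcup_set1; apply/seteqP; split=> p /= /eqP.
Qed.

Lemma multihomog0 e : multihomogeneous e (0 : {mpoly K[r * N.+1]}).
Proof. by move=> m; rewrite msupp0. Qed.

Lemma multihomog1 : multihomogeneous (fun=> 0%N) (1 : {mpoly K[r * N.+1]}).
Proof. by move=> m; rewrite msupp1 inE => /eqP-> i; rewrite big1 // => j _; rewrite mnmE. Qed.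

Lemma multihomogD e F G : multihomogeneous e F -> multihomogeneous e G ->
  multihomogeneous e (F + G).
Proof.
by move=> hF hG m /msuppD_le; rewrite mem_cat => /orP[/hF|/hG].
Qed.

Lemma multihomogZ e c F : multihomogeneous e F -> multihomogeneous e (c *: F).
Proof. by move=> hF m /msuppZ_le/hF. Qed.

Lemma multihomogM e e' F G : multihomogeneous e F -> multihomogeneous e' G ->
  multihomogeneous (fun i => e i + e' i)%N (F * G).
Proof.
move=> hF hG m /msuppM_le/allpairsP[[m1 m2] /= [m1F m2G ->] i].
rewrite -(hF _ m1F) -(hG _ m2G) -big_split.
by apply: eq_bigr => j _; rewrite mnmDE.
Qed.

Lemma multihomog_ext e e' F : e =1 e' -> multihomogeneous e F -> multihomogeneous e' F.
Proof. by move=> /funext->. Qed.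

Lemma multihomogX e k F : multihomogeneous e F ->
  multihomogeneous (fun i => k * e i)%N (F ^+ k).
Proof.
move=> hF; elim: k => [|k IH].
  by apply: multihomog_ext multihomog1 => i.
by rewrite exprS; apply: multihomog_ext (multihomogM hF IH) => i; rewrite mulSn.
Qed.

Lemma multihomog_sum (J : Type) (s : seq J) (R : pred J) e (F : J -> {mpoly K[r * N.+1]}) :
  (forall j, R j -> multihomogeneous e (F j)) ->
  multihomogeneous e (\sum_(j <- s | R j) F j).
Proof.
move=> hF; elim/big_ind: _ => //; [exact: multihomog0|].
by move=> ? ?; exact: multihomogD.
Qed.

Lemma multihomog_prod (J : Type) (s : seq J) (R : pred J) (e : J -> 'I_r -> nat)
    (F : J -> {mpoly K[r * N.+1]}) :
  (forall j, R j -> multihomogeneous (e j) (F j)) ->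
  multihomogeneous (fun i => \sum_(j <- s | R j) e j i)%N (\prod_(j <- s | R j) F j).
Proof.
move=> hF; elim: s => [|j s IH].
  by rewrite big_nil; apply: multihomog_ext multihomog1 => i; rewrite big_nil.
rewrite big_cons; case: ifPn => Rj.
  by apply: multihomog_ext (multihomogM (hF j Rj) IH) => i; rewrite big_cons Rj.
by apply: multihomog_ext IH => i; rewrite big_cons (negbTE Rj).
Qed.

Lemma multihomog_var (l : 'I_r) (a : 'I_N.+1) :
  multihomogeneous (fun i => (i == l : nat)) ('X_(mxvec_index l a) : {mpoly K[r * N.+1]}).
Proof.
move=> m; rewrite msuppX inE => /eqP-> i; case: (i =P l) => [->|il].
  rewrite (bigD1 a) //= mnm1E eqxx big1 // => b ba; rewrite mnm1E.
  by case: eqP => // /mxvec_index_inj[ab]; rewrite ab eqxx in ba.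
by rewrite big1 // => b _; rewrite mnm1E; case: eqP => // /mxvec_index_inj[/esym].
Qed.

Lemma pwvalue_scale e F t (V : 'M[K]_(r, N.+1)) (c : 'I_r -> K) :
  multihomogeneous e F -> (forall i j, V i j = c i * coords (tnth t i) 0 j) ->
  F.@[fun a => mxvec V 0 a] = (\prod_i c i ^+ e i) * pwvalue F t.
Proof.
move=> hF VE; rewrite /pwvalue !mevalE mulr_sumr big_seq [RHS]big_seq.
apply: eq_bigr => m mF; rewrite mulrCA; congr (_ * _).
rewrite !big_mxvec -big_split /=; apply: eq_bigr => i _.
rewrite -(hF m mF i) expr_sum -big_split /=; apply: eq_bigr => j _.
by rewrite !mxvecE mxE VE exprMn.
Qed.

Lemma enumerates_ex A : exists t, enumerates t A.
Proof. by exists (Tuple (card_conf A)); split=> //=; exact: fset_uniq. Qed.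

Lemma closed_conf (W : set cnf) (W' : set (proj_power K N r)) : closed W' ->
  (forall t A, enumerates t A -> (W A <-> W' t)) -> closed W.
Proof.
move=> cW' WW'; rewrite -openC; exists (~` W'); first exact: closed_openC.
move=> t A ut At; have [WA WA'] := WW' t A (conj ut At).
by split=> nW /= ?; apply: nW; auto.
Qed.

Definition tuple_perm (s : 'S_r) t : r.-tuple (projspace K N) :=
  [tuple tnth t (s l) | l < r].

Lemma enumerates_perm s t A : enumerates t A -> enumerates (tuple_perm s t) A.
Proof.
move=> [ut At]; have pt : perm_eq (tuple_perm s t) t by apply/tuple_permP; exists s.
split; first by rewrite (perm_uniq pt).
by move=> p; rewrite At (perm_mem pt).
Qed.

Lemma enumerates_permP t t' A : enumerates t A -> enumerates t' A ->
  exists s, t' = tuple_perm s t.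
Proof.
move=> [ut At] [ut' At']; have /tuple_permP[s E] : perm_eq t' t.
  by apply: uniq_perm => // p; rewrite -At At'.
by exists s; apply: val_inj.
Qed.

Lemma tuple_permM s s' t : tuple_perm s (tuple_perm s' t) = tuple_perm (s * s')%g t.
Proof. by apply: eq_from_tnth => l; rewrite !tnth_mktuple permM. Qed.

(** The action of s on the r blocks of variables, written monomial by monomial so that multidegrees
    can be read off. *)
Definition mpoly_perm (s : 'S_r) F : {mpoly K[r * N.+1]} :=
  \sum_(m <- msupp F | m \in msupp F) F@_m *:
    \prod_l \prod_j 'X_(mxvec_index (s l) j) ^+ m (mxvec_index l j).

Lemma pwvalue_perm s F t : pwvalue (mpoly_perm s F) t = pwvalue F (tuple_perm s t).
Proof.
rewrite /pwvalue /mpoly_perm raddf_sum mevalE -big_seq; apply: eq_bigr => m _ /=.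
rewrite mevalZ big_mxvec rmorph_prod; congr (_ * _); apply: eq_bigr => l _.
rewrite rmorph_prod; apply: eq_bigr => j _.
by rewrite rmorphXn /= mevalXU !mxvecE !mxE tnth_mktuple.
Qed.

Lemma multihomog_perm s d F : multihomogeneous (fun=> d) F ->
  multihomogeneous (fun=> d) (mpoly_perm s F).
Proof.
move=> hF; apply: multihomog_sum => m mF; apply: multihomogZ.
have := @multihomog_prod _ (index_enum 'I_r) xpredT _ _
  (fun l _ => @multihomog_prod _ (index_enum 'I_N.+1) xpredT _ _
  (fun j _ => @multihomogX _ (m (mxvec_index l j)) _ (@multihomog_var (s l) j))).
apply: multihomog_ext => i; rewrite (bigD1 (s^-1%g i)) //= permKV.
rewrite [X in (_ + X)%N]big1 ?addn0; last first.
  move=> l li; rewrite big1 // => j _; case: eqP => [E|_]; rewrite ?muln0 //.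
  by rewrite E permK eqxx in li.
by rewrite -[RHS](hF m mF (s^-1%g i)); apply: eq_bigr => j _; rewrite eqxx muln1.
Qed.

(** All blocks have the same degree, since permuting the points would mix different ones. F itself
    need not be symmetric; only its values at enumerations of a configuration must not depend on the
    order. *)
Definition cform d (f : cnf -> K) := exists2 F : {mpoly K[r * N.+1]},
  multihomogeneous (fun=> d) F & forall A t, enumerates t A -> f A = pwvalue F t.

(* Symmetrization by an elementary symmetric function of the conjugates of F,
   whose degree is the number of conjugates that do not vanish at t. *)
Lemma cform_symmetrize d F t A : multihomogeneous (fun=> d) F -> enumerates t A ->
  pwvalue F t != 0 -> exists j f, [/\ (0 < j)%N, cform (j * d)%N f, f A != 0 &
    forall A', (forall t', enumerates t' A' -> pwvalue F t' = 0) -> f A' = 0].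
Proof.
move=> hF tA Ft; pose Z := [set s : 'S_r | pwvalue F (tuple_perm s t) != 0]%SET.
pose G : {mpoly K[r * N.+1]} :=
  \sum_(B : {set 'S_r} | #|B| == #|Z|) \prod_(s in B) mpoly_perm s F.
have GE u : pwvalue G u =
    \sum_(B : {set 'S_r} | #|B| == #|Z|) \prod_(s in B) pwvalue F (tuple_perm s u).
  rewrite /pwvalue raddf_sum /=; apply: eq_bigr => B _; rewrite rmorph_prod.
  by apply: eq_bigr => s _; exact: pwvalue_perm.
have Gperm s u : pwvalue G (tuple_perm s u) = pwvalue G u.
  pose h (B : {set 'S_r}) := ((fun x => x * s)%g @: B)%SET.
  have hI : injective h by exact: imset_inj (mulIg s).
  rewrite !GE [RHS](reindex_inj hI) /=; apply: eq_big => B.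
    by rewrite card_imset //; exact: mulIg.
  move=> _; rewrite big_imset /=; last by move=> ? ? _ _; exact: mulIg.
  by apply: eq_bigr => x _; rewrite tuple_permM.
have Genum A' u u' : enumerates u A' -> enumerates u' A' -> pwvalue G u = pwvalue G u'.
  by move=> uA uA'; have [s ->] := enumerates_permP uA' uA; exact: Gperm.
have Z_gt0 : (0 < #|Z|)%N.
  rewrite card_gt0; apply/set0Pn; exists 1%g; rewrite inE.
  suff -> : tuple_perm 1 t = t by [].
  by apply: eq_from_tnth => l; rewrite tnth_mktuple perm1.
exists #|Z|, (fun A' => pwvalue G (Tuple (card_conf A'))); split=> //.
- exists G.
    apply: multihomog_sum => B /eqP cB.
    have := @multihomog_prod _ (index_enum 'S_r) (fun s => s \in B) _ _
      (fun s _ => @multihomog_perm s _ _ hF).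
    by apply: multihomog_ext => i; rewrite sum_nat_const cB.
  by move=> A' u uA'; apply: Genum uA'; split=> //=; exact: fset_uniq.
- rewrite (@Genum A _ t) //; last by split=> //=; exact: fset_uniq.
  (* A set of #|Z| permutations other than Z contains a conjugate that vanishes at t, so a single
     product survives. *)
  rewrite GE (bigD1 Z) //= [X in _ + X]big1 ?addr0.
    by apply/prodf_neq0 => s; rewrite inE.
  move=> B /andP[/eqP cB BZ].
  have /subsetPn[s sB sZ] : ~~ (B \subset Z).
    by apply: contra BZ => BZ; rewrite eqEcard BZ cB /=.
  by rewrite (bigD1 s) //=; move: sZ; rewrite inE negbK => /eqP->; rewrite mul0r.
- move=> A' FA'; rewrite GE big1 // => B /eqP cB.
  have [s sB] : exists s, s \in B by apply/set0Pn; rewrite -card_gt0 cB.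
  rewrite (bigD1 s) //= FA' ?mul0r //; apply: enumerates_perm.
  by split=> //=; exact: fset_uniq.
Qed.

Lemma coords_choice t : exists a : 'I_r -> 'I_N.+1,
  forall l, coords (tnth t l) 0 (a l) != 0.
Proof.
have /fin_all_exists[a ta] : forall l, exists a, coords (tnth t l) 0 a != 0.
  by move=> l; apply/rV0Pn; exact: coords_neq0.
by exists a.
Qed.

Lemma cform_system : form_system cform.
Proof.
split.
- by move=> e; exists 0 => [|A t _]; [exact: multihomog0|rewrite /pwvalue meval0].
- by exists 1 => [|A t _]; [exact: multihomog1|rewrite /pwvalue meval1].
- move=> e f g [F hF fF] [G hG gG]; exists (F + G) => [|A t tA]; first exact: multihomogD.
  by rewrite /pwvalue mevalD (fF A t tA) (gG A t tA).
- move=> e c f [F hF fF]; exists (c *: F) => [|A t tA]; first exact: multihomogZ.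
  by rewrite /pwvalue mevalZ (fF A t tA).
- move=> d e f g [F hF fF] [G hG gG]; exists (F * G) => [|A t tA]; first exact: multihomogM.
  by rewrite /pwvalue mevalM (fF A t tA) (gG A t tA).
- move=> e f [F hF fF]; apply: closed_conf (closed_pwzeros hF) _ => t A tA.
  by rewrite /= (fF A t tA).
- move=> W A /closed_openC[O oO WO] nWA; have [t tA] := enumerates_ex A.
  have Ot : O t by apply/(WO t A); [case: tA|case: tA|].
  have [e [F [hF Ft FO]]] := pwbasic_open_sub oO Ot.
  have [a at0] := coords_choice t.
  pose E := (\sum_l e l)%N.
  (* The multidegree e is evened out to the constant E by powers of coordinates that do not vanish
     at t; G still vanishes wherever F does. *)
  pose G : {mpoly K[r * N.+1]} := F * \prod_l 'X_(mxvec_index l (a l)) ^+ (E - e l).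
  have GE u : pwvalue G u = pwvalue F u * \prod_l coords (tnth u l) 0 (a l) ^+ (E - e l).
    rewrite /pwvalue mevalM rmorph_prod; congr (_ * _); apply: eq_bigr => l _.
    by rewrite rmorphXn /= mevalXU mxvecE mxE.
  have hG : multihomogeneous (fun=> E) G.
    have := multihomogM hF (@multihomog_prod _ (index_enum 'I_r) xpredT _ _
      (fun l _ => @multihomogX _ (E - e l) _ (@multihomog_var l (a l)))).
    apply: multihomog_ext => i; rewrite (bigD1 i) //= eqxx muln1 big1 ?addn0.
      by rewrite subnKC // /E (bigD1 i) //= leq_addr.
    by move=> l li; rewrite eq_sym (negbTE li) muln0.
  have Gt : pwvalue G t != 0.
    by rewrite GE mulf_neq0 //; apply/prodf_neq0 => l _; rewrite expf_neq0.
  have [j [f [j_gt0 cf fA f0]]] := cform_symmetrize hG tA Gt.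
  exists (j * E)%N, f; split=> // A' WA'; apply: f0 => t' [ut' At'].
  rewrite GE; have [->|/FO Ot'] := eqVneq (pwvalue F t') 0; first by rewrite mul0r.
  by have [_ /(_ Ot')] := WO t' A' ut' At'.
- move=> A; have [t tA] := enumerates_ex A; have [a at0] := coords_choice t.
  pose G : {mpoly K[r * N.+1]} := \prod_l 'X_(mxvec_index l (a l)).
  have hG : multihomogeneous (fun=> 1%N) G.
    have := @multihomog_prod _ (index_enum 'I_r) xpredT _ _
      (fun l _ => @multihomog_var l (a l)).
    apply: multihomog_ext => i; rewrite (bigD1 i) //= eqxx big1 ?addn0 //.
    by move=> l li; rewrite eq_sym (negbTE li).
  have Gt : pwvalue G t != 0.
    rewrite /pwvalue rmorph_prod; apply/prodf_neq0 => l _ /=.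
    by rewrite mevalXU mxvecE mxE.
  have [j [f [j_gt0 cf fA _]]] := cform_symmetrize hG tA Gt.
  by exists (j * 1)%N, f; split=> //; rewrite muln1.
Qed.

End PowerForms.

(** * Tangent spaces of Segre-Veronese varieties *)

Section SegreVeroneseForms.
Context {K : fieldType} {k : nat} (n d : 'I_k -> nat).
Local Notation N := (SV_N n d).
Local Notation vectors := (forall i, 'rV[K]_(n i).+1).
Local Notation linform := {i : 'I_k & 'rV[K]_(n i).+1}.
Implicit Types (v z : vectors) (x : linform) (s : seq linform).

Definition expo (J : 'I_N.+1) i (a : 'I_(n i).+1) : nat :=
  tnth (val (exponent_of J i)) a.

Arguments expo J i a : clear implicits.

Lemma expo_sum J i : (\sum_a expo J i a = d i)%N.
Proof. by rewrite -(eqP (valP (exponent_of J i))) big_tuple. Qed.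

Lemma expo_ex (m : forall i, 'I_(n i).+1 -> nat) :
  (forall i, \sum_a m i a = d i)%N -> exists J, forall i a, expo J i a = m i a.
Proof.
move=> md; have mlt i a : (m i a < (d i).+1)%N by rewrite ltnS -md (bigD1 a) //= leq_addr.
pose e i : (n i).+1.-tuple 'I_(d i).+1 := [tuple Ordinal (mlt i a) | a < (n i).+1].
have eP i : (\sum_(a <- e i) a == d i)%N.
  rewrite big_tuple; apply/eqP; rewrite -[RHS](md i).
  by apply: eq_bigr => a _; rewrite tnth_mktuple.
pose f : multiexponent n d := [ffun i => Sub (e i) (eP i)].
exists (cast_ord (card_multiexponent n d) (enum_rank f)) => i a.
by rewrite /expo /exponent_of cast_ordK enum_rankK ffunE /= tnth_mktuple.
Qed.

Lemma expo_inj J J' : (forall i a, expo J i a = expo J' i a) -> J = J'.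
Proof.
move=> JJ; suff /enum_val_inj/cast_ord_inj : exponent_of J = exponent_of J' by [].
apply/ffunP => i; apply: val_inj; apply: eq_from_tnth => a; apply: val_inj.
exact: JJ.
Qed.

(** Over any commutative ring, so that one formula serves for points, with values in K, and for
    curves, with values in [{poly K}]. *)
Definition SVm (R : comNzRingType) (V : forall i, 'I_(n i).+1 -> R) (J : 'I_N.+1) : R :=
  \prod_i \prod_a V i a ^+ expo J i a.

Lemma SV_vectorE v J : SV_vector d v 0 J = SVm (fun i a => v i 0 a) J.
Proof. by rewrite mxE. Qed.

Lemma SVm_horner (V : forall i, 'I_(n i).+1 -> {poly K}) J t :
  (SVm V J).[t] = SVm (fun i a => (V i a).[t]) J.
Proof.
rewrite /SVm horner_prod; apply: eq_bigr => i _; rewrite horner_prod.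
by apply: eq_bigr => a _; rewrite horner_exp.
Qed.

Definition lineval (R : lmodType K) x (V : forall i, 'I_(n i).+1 -> R) : R :=
  \sum_a tagged x 0 a *: V (tag x) a.

Definition tags i s := count (fun x => tag x == i) s.

(** The expansion is indexed by the choices of a variable in each linear form. It is fixed before V,
    so that a single linear form on P^N will represent the product along all curves. *)
Lemma linear_product_monomials s : exists (A : finType) (c : A -> K)
    (m : A -> forall i, 'I_(n i).+1 -> nat),
  (forall y i, \sum_a m y i a = tags i s)%N /\
  forall V : forall i, 'I_(n i).+1 -> {poly K}, \prod_(x <- s) lineval x V =
    \sum_y c y *: \prod_i \prod_a V i a ^+ m y i a.
Proof.
elim: s => [|x s [A [c [m [mE IH]]]]].
  exists unit, (fun=> 1), (fun _ _ _ => 0%N); split=> [y i|V]; first by rewrite big1.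
  rewrite big_nil (bigD1 tt) //= [X in _ + X]big1; last by case.
  by rewrite addr0 scale1r big1 // => i _; rewrite big1.
pose u (b : 'I_(n (tag x)).+1) i (a : 'I_(n i).+1) : nat :=
  Tagged (fun i => 'I_(n i).+1) a == Tagged (fun i => 'I_(n i).+1) b.
exists ('I_(n (tag x)).+1 * A)%type, (fun y => tagged x 0 y.1 * c y.2),
  (fun y i a => u y.1 i a + m y.2 i a)%N; split=> [[b y] i|V] /=.
  rewrite big_split /= mE /tags /=; congr (_ + _)%N.
  case: eqP => [xi|xi].
    case: i / xi; rewrite (bigD1 b) //= /u eqxx big1 // => a ab.
    by rewrite eq_Tagged /= (negbTE ab).
  by rewrite big1 // => a _; rewrite /u; case: eqP => // /(congr1 tag)/= /esym.
rewrite big_cons IH /lineval mulr_suml.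
under [LHS]eq_bigr do rewrite mulr_sumr.
rewrite pair_bigA; apply: eq_bigr => -[b y] _ /=.
rewrite -scalerAl -scalerAr scalerA; congr (_ *: _).
transitivity (\prod_i ((\prod_a V i a ^+ u b i a) * \prod_a V i a ^+ m y i a)).
  rewrite big_split /=; congr (_ * _); rewrite (bigD1 (tag x)) //= (bigD1 b) //=.
  rewrite /u eqxx expr1 big1 ?mulr1 => [|a ab]; last by rewrite eq_Tagged /= (negbTE ab).
  rewrite big1 ?mulr1 // => i ix; rewrite big1 // => a _.
  by case: eqP => // /(congr1 tag)/= E; rewrite E eqxx in ix.
apply: eq_bigr => i _; rewrite -big_split; apply: eq_bigr => a _ /=.
by rewrite exprD.
Qed.

Lemma linear_product_SVm s : (forall i, tags i s = d i) ->
  exists l : 'cV[K]_N.+1, forall V : forall i, 'I_(n i).+1 -> {poly K},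
    \sum_J l J 0 *: SVm V J = \prod_(x <- s) lineval x V.
Proof.
move=> sd; have [A [c [m [mE mP]]]] := linear_product_monomials s.
have /fin_all_exists[J JE] y : exists J, forall i a, expo J i a = m y i a.
  by apply: expo_ex => i; rewrite mE sd.
exists (\col_j \sum_(y | J y == j) c y) => V; rewrite mP.
rewrite [RHS](partition_big J xpredT) //=; apply: eq_bigr => j _.
rewrite mxE scaler_suml; apply: eq_bigr => y /eqP <-; congr (_ *: _).
by apply: eq_bigr => i _; apply: eq_bigr => a _; rewrite JE.
Qed.

Definition curve v z i (a : 'I_(n i).+1) : {poly K} := (v i 0 a)%:P + z i 0 a *: 'X.

(** The differential of [SV_vector] at v in the direction z. *)
Definition dSV v z : 'rV[K]_N.+1 := \row_J (SVm (curve v z) J)^`().[0].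

Lemma SVm_curve0 v z J : (SVm (curve v z) J).[0] = SV_vector d v 0 J.
Proof.
rewrite SVm_horner SV_vectorE; apply: eq_bigr => i _; apply: eq_bigr => a _.
by rewrite hornerD hornerC hornerZ hornerX mulr0 addr0.
Qed.

Definition linval x v : K := \sum_a tagged x 0 a * v (tag x) 0 a.

Lemma lineval_curve x v z : lineval x (curve v z) = (linval x v)%:P + linval x z *: 'X.
Proof.
rewrite /lineval /linval rmorph_sum scaler_suml -big_split; apply: eq_bigr => a _ /=.
by rewrite scalerDr scalerA -mul_polyC polyCM.
Qed.

Lemma linear_product_functional s : (forall i, tags i s = d i) ->
  exists l : 'cV[K]_N.+1, forall v z,
    (SV_vector d v *m l) 0 0 = (\prod_(x <- s) lineval x (curve v z)).[0] /\
    (dSV v z *m l) 0 0 = (\prod_(x <- s) lineval x (curve v z))^`().[0].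
Proof.
move=> /linear_product_SVm[l lP]; exists l => v z; rewrite -lP.
split.
  rewrite mxE horner_sum; apply: eq_bigr => J _.
  by rewrite hornerZ SVm_curve0 mulrC.
rewrite mxE raddf_sum horner_sum; apply: eq_bigr => J _ /=.
by rewrite derivZ hornerZ mxE mulrC.
Qed.

Lemma linear_product0 s v z :
  (\prod_(x <- s) lineval x (curve v z)).[0] = \prod_(x <- s) linval x v.
Proof.
rewrite horner_prod; apply: eq_bigr => x _.
by rewrite lineval_curve hornerD hornerC hornerZ hornerX mulr0 addr0.
Qed.

Lemma linear_product_cons x s v z :
  (\prod_(y <- x :: s) lineval y (curve v z))^`().[0] =
  linval x z * (\prod_(y <- s) linval y v) +
  linval x v * (\prod_(y <- s) lineval y (curve v z))^`().[0].
Proof.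
rewrite big_cons derivM lineval_curve hornerD !hornerM derivD derivC add0r derivZ derivX.
by rewrite !(hornerD, hornerC, hornerZ, hornerX) mulr0 addr0 mulr1 linear_product0.
Qed.

Lemma linear_product_eq0 s v : has (fun x => linval x v == 0) s ->
  \prod_(x <- s) linval x v = 0.
Proof. by move=> h; apply/eqP; rewrite prodf_seq_eq0. Qed.

Lemma linear_product_double s v z : (1 < count (fun x => linval x v == 0%R) s)%N ->
  (\prod_(y <- s) lineval y (curve v z))^`().[0] = 0.
Proof.
elim: s => [//|x s IH]; rewrite linear_product_cons /=.
case: eqP => [->|_]; rewrite ?add0n => cs.
  by rewrite mul0r addr0 linear_product_eq0 ?mulr0 // has_count -ltnS.
by rewrite IH // mulr0 linear_product_eq0 ?mulr0 ?addr0 // has_count; exact: ltnW.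
Qed.

End SegreVeroneseForms.

(** * Tangent vectors from polynomial curves *)

Section TangentCurves.
Context {K : closedFieldType}.

Lemma poly_eq0 (p : {poly K}) : (forall t, p.[t] = 0) -> p = 0.
Proof.
move=> p0; apply/eqP; apply: contraT => /poly_nonroot[t].
by rewrite p0 eqxx.
Qed.

(** Values and derivatives are treated together because the product rule for the latter involves the
    former. *)
Lemma mpoly_horner_deriv N (F : {mpoly K[N]}) (p : 'I_N -> {poly K}) t :
  ((mmap (@polyC K) p F).[t] = F.@[fun j => (p j).[t]]) *
  ((mmap (@polyC K) p F)^`().[t] =
     \sum_j F^`M(j).@[fun j => (p j).[t]] * (p j)^`().[t]).
Proof.
pose P (F : {mpoly K[N]}) := (mmap (@polyC K) p F).[t] = F.@[fun j => (p j).[t]] /\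
  (mmap (@polyC K) p F)^`().[t] = \sum_j F^`M(j).@[fun j => (p j).[t]] * (p j)^`().[t].
suff [] : P F by split.
have PM G H : P G -> P H -> P (G * H).
  move=> [G1 G2] [H1 H2]; split; first by rewrite rmorphM hornerM G1 H1 mevalM.
  rewrite rmorphM derivM hornerD !hornerM G1 H1 G2 H2 mulr_suml mulr_sumr -big_split.
  apply: eq_bigr => j _ /=; rewrite mderivM mevalD !mevalM mulrDl mulrAC -!mulrA.
  by congr (_ + _).
have PD G H : P G -> P H -> P (G + H).
  move=> [G1 G2] [H1 H2]; split; first by rewrite rmorphD hornerD G1 H1 mevalD.
  rewrite rmorphD derivD hornerD G2 H2 -big_split.
  by apply: eq_bigr => j _ /=; rewrite mderivD mevalD mulrDl.
have PC c : P c%:MP.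
  split; first by rewrite mmapC hornerC mevalC.
  rewrite mmapC derivC horner0 big1 // => j _.
  by rewrite mderivC meval0 mul0r.
have PX i : P 'X_i.
  have XE : mmap (@polyC K) p 'X_i = p i by rewrite mmapX mmap1U.
  split; first by rewrite XE mevalXU.
  rewrite XE (bigD1 i) //= big1 => [|j ji]; rewrite mderivX mnm1E.
    have -> : (U_(i) - U_(i) = 0 :> 'X_{1..N})%MM.
      by apply/mnmP => j; rewrite mnmBE subnn mnm0E.
    by rewrite eqxx scale1r mpolyX0 meval1 mul1r addr0.
  by rewrite eq_sym (negbTE ji) scale0r meval0 mul0r.
elim/mpolyind: F => [|c m F _ _ IH]; first exact: PC.
apply: PD IH; rewrite -mul_mpolyC; apply: (PM _ _ (PC c)).
rewrite mpolyXE_id; apply: (big_ind P) => [||i _]; [exact: (PC 1)|exact: PM|].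
elim: (m i) => [|e IH]; first exact: (PC 1).
by rewrite exprS; exact: PM.
Qed.

(** An equation F of X vanishes along the curve outside the roots of g, hence identically; its
    derivative at 0 is the tangency condition. The polynomial g discards the parameters at which the
    curve may leave the cone over X. *)
Lemma tangent_curve N (X : set (projspace K N)) q (p : 'I_N.+1 -> {poly K}) (g : {poly K}) :
  (forall j, (p j).[0] = coords q 0 j) -> g != 0 ->
  (forall t, g.[t] != 0 -> exists c q', X q' /\ \row_j (p j).[t] = c *: coords q') ->
  \row_j (p j)^`().[0] \in tangent_space X q.
Proof.
move=> pq g0 pX; apply/tangent_spaceP => e F hF F0.
suff f0 : mmap (@polyC K) p F = 0.
  have := (mpoly_horner_deriv F p 0).2; rewrite f0 deriv0 horner0 => E.
  rewrite [RHS]E; apply: eq_bigr => j _; rewrite mxE; congr (_ * _).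
  by apply: meval_eq => i; rewrite pq.
suff /eqP : mmap (@polyC K) p F * g = 0 by rewrite mulf_eq0 (negbTE g0) orbF => /eqP.
apply: poly_eq0 => t; rewrite hornerM (mpoly_horner_deriv F p t).
have [->|/pX[c [q' [Xq' pq']]]] := eqVneq g.[t] 0; first by rewrite mulr0.
rewrite (_ : F.@[_] = F.@[fun j => (\row_j (p j).[t]) 0 j]); last first.
  by apply: meval_eq => j; rewrite mxE.
by rewrite (pvalue_scale hF pq') F0 // mulr0 mul0r.
Qed.

End TangentCurves.

Arguments expo {k n d} J i a.

(** * Quadrics of the ideal and descent on monomials *)

Section SegreVeroneseTangent.
Context {K : closedFieldType} {k : nat} (n d : 'I_k -> nat).
Hypothesis d_gt0 : forall i, (0 < d i)%N.
Local Notation N := (SV_N n d).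
Local Notation vectors := (forall i, 'rV[K]_(n i).+1).
Local Notation X := (SV K n d).
Local Notation exponents := (forall i, 'I_(n i).+1 -> nat).
Implicit Types (v z : vectors) (x : multiproj K n) (f : exponents).

Definition represents v x := forall i, v i != 0 /\ <[v i]>%VS = line (x i).

Lemma represents_coords x : represents (fun i => coords (x i)) x.
Proof. by move=> i; rewrite coords_neq0 line_coords. Qed.

Lemma represents_ex v : (forall i, v i != 0) -> exists x, represents v x.
Proof.
by move=> v0; exists [ffun i => proj_point (v0 i)] => i; rewrite ffunE v0.
Qed.

Lemma SV_vector_scale v x : represents v x ->
  exists2 c, c != 0 & SV_vector d v = c *: coords (SV_map d x).
Proof.
move=> vx; have v0 i := (vx i).1; apply: coordsP (SV_vector_neq0 _ v0) _.
by rewrite (SV_mapE _ v0) // => i; case: (vx i).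
Qed.

(** Variables of different factors have different types; tagging makes them comparable. *)
Definition tgt (i : 'I_k) (b : 'I_(n i).+1) := Tagged (fun i => 'I_(n i).+1) b.

Lemma tgt_pivotF (a : forall i, 'I_(n i).+1) i (b : 'I_(n i).+1) j :
  b != a i -> (tgt b == tgt (a j)) = false.
Proof.
move=> ba; apply/eqP => E; have : tagged (tgt b) == a (tag (tgt b)) by rewrite E /=.
by rewrite /= (negbTE ba).
Qed.

Definition move_exp f i (b b' : 'I_(n i).+1) : exponents :=
  fun j c => (f j c + (tgt c == tgt b') - (tgt c == tgt b))%N.
Arguments move_exp _ {_} _ _ _ _.

Lemma sum_tgt i (b : 'I_(n i).+1) j : (\sum_(c : 'I_(n j).+1) (tgt c == tgt b) = (j == i))%N.
Proof.
case: eqP => [ji|ji].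
  case: i / ji b => b; rewrite (bigD1 b) //= eqxx big1 // => c cb.
  by rewrite eq_Tagged /= (negbTE cb).
by rewrite big1 // => c _; case: eqP => // /(congr1 tag)/= /ji.
Qed.

Lemma move_exp_sum f i (b b' : 'I_(n i).+1) j : (0 < f i b)%N ->
  (\sum_c move_exp f b b' j c = \sum_c f j c)%N.
Proof.
move=> fb; apply: (@addIn (j == i)); rewrite -{1}(sum_tgt b) -(sum_tgt b' j).
rewrite -!big_split; apply: eq_bigr => c _ /=; rewrite /move_exp subnK //.
case: eqP => // cb; have : (0 < f j c)%N.
  by move: fb; rewrite -[f i b]/(f (tag (tgt b)) (tagged (tgt b))) -cb.
by move=> /leq_trans; apply; rewrite leq_addr.
Qed.

Variable a : forall i, 'I_(n i).+1.

Definition pivot_exp : exponents := fun j c => if c == a j then d j else 0%N.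
Arguments pivot_exp _ _ : clear implicits.

Lemma pivot_exp_sum j : (\sum_c pivot_exp j c = d j)%N.
Proof.
rewrite (bigD1 (a j)) //= /pivot_exp eqxx big1 ?addn0 // => c.
by move=> /negbTE->.
Qed.

Definition near_exp i (b : 'I_(n i).+1) : exponents := move_exp pivot_exp (a i) b.
Arguments near_exp {_} _ _ _.

Lemma near_exp_sum i (b : 'I_(n i).+1) j : (\sum_c near_exp b j c = d j)%N.
Proof. by rewrite move_exp_sum ?pivot_exp_sum // /pivot_exp eqxx. Qed.

(** The measure of the descent in [tangent_vector_eq0]; it is 0 exactly on the pivot monomial. *)
Definition off_pivot J := (\sum_i \sum_(c | c != a i) @expo k n d J i c)%N.

Lemma SVm_quadric (R : comNzRingType) (V : forall i, 'I_(n i).+1 -> R) (J1 J2 J3 J4 : 'I_N.+1) :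
  (forall i c, expo J1 i c + expo J2 i c = expo J3 i c + expo J4 i c)%N ->
  SVm V J1 * SVm V J2 = SVm V J3 * SVm V J4.
Proof.
move=> JJ; rewrite -!big_split; apply: eq_bigr => i _ /=.
rewrite -!big_split; apply: eq_bigr => c _ /=.
by rewrite -!exprD JJ.
Qed.

Lemma tangent_quadric x (J1 J2 J3 J4 : 'I_N.+1) w :
  (forall i c, expo J1 i c + expo J2 i c = expo J3 i c + expo J4 i c)%N ->
  w \in tangent_space X (SV_map d x) ->
  let p := coords (SV_map d x) in
  w 0 J1 * p 0 J2 + p 0 J1 * w 0 J2 = w 0 J3 * p 0 J4 + p 0 J3 * w 0 J4.
Proof.
move=> JJ /tangent_spaceP wT p.
pose F : {mpoly K[N.+1]} := 'X_J1 * 'X_J2 - 'X_J3 * 'X_J4.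
have hX J : ('X_J : {mpoly K[N.+1]}) \is 1.-homog.
  by rewrite dhomogX; apply/eqP; exact: mdeg1.
have hF : F \is 2.-homog.
  by rewrite dhomogD ?dhomogN //; exact: (dhomogM (hX _) (hX _)).
have F0 q : X q -> pvalue F q = 0.
  move=> [y _ <-]; have [c c0 E] := SV_vector_scale (represents_coords y).
  apply: (mulfI (expf_neq0 2 c0)); rewrite -(pvalue_scale hF E) mulr0.
  by rewrite mevalB !mevalM !mevalXU !SV_vectorE (SVm_quadric _ JJ) subrr.
have := wT _ _ hF F0.
have dX (J j : 'I_N.+1) : pvalue ('X_J)^`M(j) (SV_map d x) = (J == j)%:R.
  rewrite mderivX mnm1E /pvalue; case: eqP => [->|_]; last by rewrite scale0r meval0.
  have -> : (U_(j) - U_(j) = 0 :> 'X_{1..N.+1})%MM.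
    by apply/mnmP => i; rewrite mnmBE subnn mnm0E.
  by rewrite scale1r mpolyX0 meval1.
have dXX (J J' : 'I_N.+1) : \sum_j pvalue ('X_J * 'X_J')^`M(j) (SV_map d x) * w 0 j =
    w 0 J * p 0 J' + p 0 J * w 0 J'.
  under eq_bigr => j _.
    rewrite mderivM /pvalue mevalD !mevalM -!/(pvalue _ _) !dX /pvalue !mevalXU mulrDl.
    over.
  rewrite big_split /= (bigD1 J) //= eqxx big1 ?addr0; last first.
    by move=> j jJ; rewrite eq_sym (negbTE jJ) !mul0r.
  rewrite [X in _ + X](bigD1 J') //= eqxx [X in _ + (_ + X)]big1 ?addr0; last first.
    by move=> j jJ; rewrite eq_sym (negbTE jJ) mulr0 mul0r.
  by rewrite mul1r mulr1 mulrC.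
rewrite /F; under eq_bigr => j _ do rewrite mderivB /pvalue mevalB mulrBl -!/(pvalue _ _).
by rewrite sumrB !dXX => /eqP; rewrite subr_eq0 => /eqP.
Qed.

Lemma tgt_le f i (b : 'I_(n i).+1) j c : (0 < f i b)%N -> ((tgt c == tgt b) <= f j c)%N.
Proof.
case: eqP => // cb; rewrite -[f i b]/(f (tag (tgt b)) (tagged (tgt b))).
by rewrite -cb.
Qed.

(** This is the quadric of the descent: it trades J and the pivot monomial for J', which has one
    variable fewer off the pivots, and a near monomial. *)
Lemma move_exp_balance (J J' J0 J1 : 'I_N.+1) i (b : 'I_(n i).+1) : (0 < expo J i b)%N ->
  (forall j c, expo J' j c = move_exp (expo J) b (a i) j c) ->
  (forall j c, expo J0 j c = pivot_exp j c) ->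
  (forall j c, expo J1 j c = near_exp b j c) ->
  forall j c, (expo J j c + expo J0 j c = expo J' j c + expo J1 j c)%N.
Proof.
move=> Jb J'E J0E J1E j c; rewrite J'E J0E J1E /near_exp /move_exp.
have := tgt_le c Jb; have : ((tgt c == tgt (a i)) <= pivot_exp j c)%N.
  by apply: tgt_le; rewrite /pivot_exp eqxx.
lia.
Qed.

Lemma off_pivot_lt (J J' : 'I_N.+1) i (b : 'I_(n i).+1) : b != a i -> (0 < expo J i b)%N ->
  (forall j c, expo J' j c = move_exp (expo J) b (a i) j c) ->
  (off_pivot J' < off_pivot J)%N.
Proof.
move=> ba Jb J'E; apply: (@leq_trans (\sum_j \sum_(c | c != a j)
    (expo J' j c + (tgt c == tgt b)))%N); last first.
  apply: leq_sum => j _; apply: leq_sum => c ca; rewrite J'E /move_exp.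
  have := tgt_le c Jb; have : (tgt c == tgt (a i)) = false.
    exact: tgt_pivotF.
  lia.
under eq_bigr do rewrite big_split.
rewrite big_split /= -addn1 leq_add2l (bigD1 i) //= (bigD1 b) //=.
by rewrite eqxx.
Qed.

Lemma off_pivot_eq0 J : off_pivot J = 0%N -> forall j c, expo J j c = pivot_exp j c.
Proof.
move=> /eqP; rewrite sum_nat_eq0 => /forallP J0 j c; rewrite /pivot_exp.
have {}J0 b : b != a j -> expo J j b = 0%N.
  move=> ba; have := J0 j; rewrite implyTb sum_nat_eq0 => /forallP/(_ b).
  by rewrite ba => /eqP.
case: eqP => [->|/eqP/J0//]; rewrite -(expo_sum J j) (bigD1 (a j)) //= big1 ?addn0 //.
Qed.

Variables (x : multiproj K n) (v : vectors).
Hypotheses (vx : represents v x) (va : forall i, v i 0 (a i) != 0).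

Lemma SVm_pivot (J : 'I_N.+1) : (forall j c, expo J j c = pivot_exp j c) ->
  SVm (fun i c => v i 0 c) J != 0.
Proof.
move=> JE; apply/prodf_neq0 => i _; apply/prodf_neq0 => c _; rewrite JE /pivot_exp.
by case: (c =P a i) => [->|_]; rewrite ?expr0 ?oner_neq0 // expf_neq0.
Qed.

(* Quadrics of the ideal bring a monomial closer to the power of the pivots. *)
Lemma tangent_vector_eq0 w : w \in tangent_space X (SV_map d x) ->
  (forall J, (forall j c, expo J j c = pivot_exp j c) -> w 0 J = 0) ->
  (forall J i (b : 'I_(n i).+1), b != a i ->
     (forall j c, expo J j c = near_exp b j c) -> w 0 J = 0) -> w = 0.
Proof.
move=> wT w0 w1; apply/rowP => J; rewrite mxE.
have [J0 J0E] := expo_ex pivot_exp_sum.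
have [m] := ubnP (off_pivot J); elim: m J => [//|m IH] J Jm.
have [/off_pivot_eq0/w0//|] := eqVneq (off_pivot J) 0%N.
rewrite sum_nat_eq0 negb_forall => /existsP[i]; rewrite implyTb sum_nat_eq0 negb_forall.
move=> /existsP[b]; rewrite negb_imply -lt0n => /andP[ba Jb].
have J'sum j : (\sum_c move_exp (expo J) b (a i) j c = d j)%N.
  by rewrite move_exp_sum // expo_sum.
have [J' J'E] := expo_ex J'sum.
have [J1 J1E] := expo_ex (near_exp_sum b).
(* Only w_J p_(J0) remains: w vanishes at J0 and J1 by hypothesis, and at J' by induction. *)
have := tangent_quadric (move_exp_balance Jb J'E J0E J1E) wT.
rewrite /= (w0 J0 J0E) (w1 J1 i b ba J1E) (IH J') ?(mulr0, mul0r, addr0); last first.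
  by apply: leq_trans (off_pivot_lt ba Jb J'E) _.
have [c c0 vE] := SV_vector_scale vx.
move=> /eqP; rewrite mulf_eq0 => /orP[/eqP//|/eqP p0].
have := SVm_pivot J0E; rewrite -SV_vectorE vE mxE p0 mulr0 eqxx.
by [].
Qed.

End SegreVeroneseTangent.

Arguments near_exp {_ _} _ _ {_} _ _ _.
Arguments pivot_exp {_ _} _ _ _ _.

Section SegreVeroneseTangentSpace.
Context {K : closedFieldType} {k : nat} (n d : 'I_k -> nat).
Hypothesis d_gt0 : forall i, (0 < d i)%N.
Local Notation N := (SV_N n d).
Local Notation vectors := (forall i, 'rV[K]_(n i).+1).
Local Notation X := (SV K n d).
Local Notation Q := {i : 'I_k & 'I_(n i)}.

Variables (x : multiproj K n) (v : vectors).
Hypotheses (vx : represents v x).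
Local Notation T := (tangent_space X (SV_map d x)).

Lemma SV_tangent : SV_vector d v \in T.
Proof.
have [c c0 ->] := SV_vector_scale d vx; apply: memvZ.
(* The curve (1 + t) q does not leave the line q and has derivative q. *)
set q := SV_map d x; pose p j := (coords q 0 j)%:P + coords q 0 j *: 'X.
have -> : coords q = \row_j (p j)^`().[0].
  apply/rowP => j; rewrite mxE derivD derivC add0r derivZ derivX hornerZ.
  by rewrite -[1]/(1%:P) hornerC mulr1.
apply: (@tangent_curve _ _ _ _ _ 1) => [j||t _].
- by rewrite hornerD hornerC hornerZ hornerX mulr0 addr0.
- exact: oner_neq0.
exists (1 + t), q; split; first by exists x.
by apply/rowP => j; rewrite !mxE hornerD hornerC hornerZ hornerX mulrDl mul1r mulrC.
Qed.

Lemma dSV_tangent z : dSV d v z \in T.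
Proof.
have [c c0 vc] := SV_vector_scale d vx.
have /fin_all_exists[a va] i : exists b, v i 0 b != 0 by apply/rV0Pn; case: (vx i).
(* The curve has to start at the chosen coordinates of the point, whence c^-1. Where the product of
   the coordinates [a i] along the curve is nonzero, every v i + t z i is nonzero and defines a
   point of the factor. *)
pose p j := c^-1 *: SVm (d := d) (curve v z) j.
have -> : dSV d v z = c *: \row_j (p j)^`().[0].
  by apply/rowP => j; rewrite !mxE derivZ hornerZ mulrA mulfV // mul1r.
apply: memvZ; apply: (@tangent_curve _ _ _ _ _
    (\prod_i ((v i 0 (a i))%:P + z i 0 (a i) *: 'X))) => [j||t].
- by rewrite hornerZ SVm_curve0 vc mxE mulrA mulVf // mul1r.
- apply/prodf_neq0 => i _; apply: (@horner_neq0 _ _ 0).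
  by rewrite hornerD hornerC hornerZ hornerX mulr0 addr0.
rewrite horner_prod => /prodf_neq0 vt.
have vt0 i : v i + t *: z i != 0.
  apply: contra (vt i isT) => /eqP/rowP/(_ (a i)); rewrite !mxE.
  by rewrite hornerD hornerC hornerZ hornerX mulrC => ->.
have [y vy] := represents_ex vt0.
have [c' c0' vc'] := SV_vector_scale d vy.
exists (c^-1 * c'), (SV_map d y); split; first by exists y.
rewrite -scalerA -vc'; apply/rowP => j; rewrite mxE hornerZ SVm_horner mxE SV_vectorE.
congr (_ * _); apply: eq_bigr => i _; apply: eq_bigr => b _.
by rewrite !mxE hornerD hornerC hornerZ hornerX mulrC.
Qed.

Definition unit_dir i (b : 'I_(n i).+1) : vectors := fun j => \row_c (tgt c == tgt b)%:R.
Arguments unit_dir {_} _ _.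

Lemma dSV_unit0 i (b : 'I_(n i).+1) (J : 'I_N.+1) : expo J i b = 0%N ->
  dSV d v (unit_dir b) 0 J = 0.
Proof.
move=> Jb; rewrite mxE (_ : SVm _ J = (SVm (fun j c => v j 0 c) J)%:P) ?derivC ?horner0 //.
rewrite /SVm rmorph_prod; apply: eq_bigr => j _; rewrite rmorph_prod.
apply: eq_bigr => c _; rewrite rmorphXn /curve mxE.
case: eqP => [cb|_]; last by rewrite scale0r addr0.
suff -> : expo J j c = 0%N by rewrite !expr0.
by rewrite -[expo J j c]/(expo J (tag (tgt c)) (tagged (tgt c))) cb.
Qed.

Variable a : forall i, 'I_(n i).+1.
Hypothesis va : forall i, v i 0 (a i) != 0.

Lemma near_expE i (b : 'I_(n i).+1) j c : b != a i -> near_exp d a b j c =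
  (if tgt c == tgt b then 1 else if tgt c == tgt (a i) then (d j).-1 else
   if c == a j then d j else 0)%N.
Proof.
move=> ba; rewrite /near_exp /move_exp /pivot_exp.
have cE (e : forall i, 'I_(n i).+1) : (c == e j) = (tagged (tgt c) == e (tag (tgt c))) by [].
rewrite cE; case: (tgt c =P tgt b) => [cb|_].
  rewrite cb tgt_pivotF //.
  by rewrite /= (negbTE ba).
by case: (tgt c =P tgt (a i)) => [ca|_]; rewrite ?addn0 ?subn0 ?subn1 // ca /= eqxx.
Qed.

Lemma dSV_unit1 i (b : 'I_(n i).+1) (J : 'I_N.+1) : b != a i ->
  (forall j c, expo J j c = near_exp d a b j c) -> dSV d v (unit_dir b) 0 J != 0.
Proof.
move=> ba JE; rewrite mxE.
pose R := \prod_j \prod_c (if tgt c == tgt b then 1 else v j 0 c ^+ expo J j c).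
have -> : SVm (curve v (unit_dir b)) J = ((v i 0 b)%:P + 'X) * R%:P.
  pose A j (c : 'I_(n j).+1) : {poly K} := if tgt c == tgt b then (v i 0 b)%:P + 'X else 1.
  transitivity ((\prod_j \prod_c A j c) * R%:P).
    rewrite /R rmorph_prod -big_split; apply: eq_bigr => j _ /=.
    rewrite rmorph_prod -big_split; apply: eq_bigr => c _ /=.
    rewrite /A /curve mxE JE near_expE //; case: eqP => [cb|_].
      rewrite mulr1 expr1 scale1r; congr (_%:P + _).
      by rewrite -[v j 0 c]/(v (tag (tgt c)) 0 (tagged (tgt c))) cb.
    by rewrite scale0r addr0 mul1r rmorphXn.
  congr (_ * _); rewrite (bigD1 i) //= (bigD1 b) //= {1}/A eqxx.
  rewrite big1 ?mulr1 => [|c cb]; last by rewrite /A eq_Tagged /= (negbTE cb).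
  rewrite big1 ?mulr1 // => j ji; rewrite big1 // => c _; rewrite /A.
  by case: eqP => // /(congr1 tag)/= E; rewrite E eqxx in ji.
rewrite derivM derivC mulr0 addr0 derivD derivC add0r derivX mul1r hornerC.
apply/prodf_neq0 => j _; apply/prodf_neq0 => c _.
case: (tgt c =P tgt b) => [_|/eqP cb]; first exact: oner_neq0.
rewrite JE near_expE // (negbTE cb); case: (tgt c =P tgt (a i)) => [ca|_].
  rewrite expf_neq0 // -[v j 0 c]/(v (tag (tgt c)) 0 (tagged (tgt c))) ca.
  exact: va.
by case: (c =P a j) => [->|_]; rewrite ?expr0 ?oner_neq0 // expf_neq0.
Qed.

(** [lift] skips the pivot: by Euler's relation, the derivative along a pivot is a combination of
    the point and of the other derivatives. *)
Definition tangent_gen (o : option Q) : 'rV[K]_N.+1 :=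
  if o is Some q then dSV d v (unit_dir (lift (a (tag q)) (tagged q))) else SV_vector d v.

Arguments tangent_gen o : simpl never.

Lemma tangent_gen_mem o : tangent_gen o \in T.
Proof. by case: o => [q|]; [exact: dSV_tangent|exact: SV_tangent]. Qed.

Lemma tgt_lift_eq (q q' : Q) :
  (tgt (lift (a (tag q)) (tagged q)) == tgt (lift (a (tag q')) (tagged q'))) = (q == q').
Proof.
apply/eqP/eqP => [|->//]; case: q q' => [i b] [i' b'] /= E.
have ii' := congr1 tag E; rewrite /= in ii'; case: i' / ii' b' E => b' /eqP.
by rewrite eq_Tagged /= => /eqP/lift_inj->.
Qed.

(* Coordinates in which the matrix of the generators is triangular. *)
Lemma tangent_coord : exists Jo : option Q -> 'I_N.+1,
  [/\ forall j c, expo (Jo None) j c = pivot_exp d a j c,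
      forall q j c, expo (Jo (Some q)) j c = near_exp d a (lift (a (tag q)) (tagged q)) j c,
      forall o, tangent_gen o 0 (Jo o) != 0 &
      forall q o, o != Some q -> tangent_gen (Some q) 0 (Jo o) = 0].
Proof.
have [J0 J0E] := expo_ex (pivot_exp_sum d a).
have /fin_all_exists[J1 J1E] (q : Q) : exists J : 'I_N.+1, forall j c,
    expo J j c = near_exp d a (lift (a (tag q)) (tagged q)) j c.
  by apply: expo_ex; exact: near_exp_sum.
have lifta (q : Q) : lift (a (tag q)) (tagged q) != a (tag q) by rewrite eq_sym neq_lift.
exists (fun o => if o is Some q then J1 q else J0); split=> //.
- case=> [q|]; first by rewrite /tangent_gen (@dSV_unit1 _ _ (J1 q)) // lifta.
  by rewrite /tangent_gen SV_vectorE; exact: SVm_pivot J0E.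
- move=> q [q'|] qq'; apply: dSV_unit0; last first.
    by rewrite J0E /pivot_exp (negbTE (lifta q)).
  rewrite J1E near_expE //.
  rewrite tgt_lift_eq ifF; last by apply/eqP => E; case/eqP: qq'; rewrite E.
  by rewrite tgt_pivotF // (negbTE (lifta q)).
Qed.

(** Subtracting the combination that agrees with w at the coordinates [Jo], found by solving a
    triangular system, leaves a tangent vector to which [tangent_vector_eq0] applies. *)
Lemma tangent_span w : w \in T -> exists c : option Q -> K, w = \sum_o c o *: tangent_gen o.
Proof.
have scaleE (u : K) (A : 'rV[K]_N.+1) j : (u *: A) 0 j = u * A 0 j by rewrite mxE.
have [Jo [J0E J1E g0 g1]] := tangent_coord => wT.
pose c0 := w 0 (Jo None) / tangent_gen None 0 (Jo None).
pose c o := if o is Some q then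
  (w 0 (Jo o) - c0 * tangent_gen None 0 (Jo o)) / tangent_gen o 0 (Jo o) else c0.
exists c; apply/eqP; rewrite -subr_eq0; apply/eqP.
have sumE o : (\sum_o' c o' *: tangent_gen o') 0 (Jo o) = w 0 (Jo o).
  rewrite summxE (bigD1 None) //= scaleE.
  case: o => [q|].
    rewrite (bigD1 (Some q)) //= big1 => [|[q'|] // /eqP q'q]; last first.
      by rewrite scaleE g1 ?mulr0 //; apply/eqP => E; case: q'q.
    by rewrite addr0 scaleE /c divfK ?g0 // addrC subrK.
  rewrite big1 => [|[q|] // _]; last by rewrite scaleE g1 ?mulr0.
  by rewrite addr0 /c /c0 divfK ?g0.
apply: (@tangent_vector_eq0 _ _ n d d_gt0 a x v vx va).
- by rewrite memvB // memv_suml // => o _; rewrite memvZ // tangent_gen_mem.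
- move=> J JE; have -> : J = Jo None by apply: expo_inj => j b; rewrite JE J0E.
  by rewrite mxE [X in _ + X]mxE sumE subrr.
- move=> J i b ba JE; case: (unliftP (a i) b) ba JE => [b' ->|->]; last by rewrite eqxx.
  move=> _ JE; have -> : J = Jo (Some (Tagged (fun i => 'I_(n i)) b')).
    by apply: expo_inj => j c'; rewrite JE J1E.
  by rewrite mxE [X in _ + X]mxE sumE subrr.
Qed.

Lemma tangent_gen_free (c : option Q -> K) :
  \sum_o c o *: tangent_gen o = 0 -> forall o, c o = 0.
Proof.
have scaleE (u : K) (A : 'rV[K]_N.+1) j : (u *: A) 0 j = u * A 0 j by rewrite mxE.
have [Jo [J0E J1E g0 g1]] := tangent_coord => sum0.
have sumo o : (\sum_o' c o' *: tangent_gen o') 0 (Jo o) = 0 by rewrite sum0 mxE.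
have c0 : c None = 0.
  have /eqP := sumo None; rewrite summxE (bigD1 None) //= scaleE.
  rewrite big1 => [|[q|] // _]; last by rewrite scaleE g1 ?mulr0.
  by rewrite addr0 mulf_eq0 (negbTE (g0 None)) orbF => /eqP.
case=> [q|//]; have /eqP := sumo (Some q); rewrite summxE (bigD1 None) //= scaleE c0 mul0r add0r.
rewrite (bigD1 (Some q)) //= big1 => [|[q'|] // /eqP q'q]; last first.
  by rewrite scaleE g1 ?mulr0 //; apply/eqP => E; case: q'q.
by rewrite addr0 scaleE mulf_eq0 (negbTE (g0 (Some q))) orbF => /eqP.
Qed.

Lemma dim_tangent : \dim T = (\sum_i n i).+1.
Proof.
pose B := \matrix_(o < #|{: option Q}|) tangent_gen (enum_val o).
pose f : 'Hom('rV[K]_#|{: option Q}|, 'rV[K]_N.+1) := linfun (mulmxr B).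
have fE u : f u = \sum_o u 0 (enum_rank o) *: tangent_gen o.
  rewrite lfunE /= mulmx_sum_row (reindex _ (onW_bij _ (enum_rank_bij (option Q)))) /=.
  by apply: eq_bigr => o _; rewrite rowK enum_rankK.
have kerf : lker f == 0%VS.
  apply/lker0P => u u' uu'; have : f (u - u') = 0 by rewrite linearB /= uu' subrr.
  rewrite fE => /tangent_gen_free u0.
  apply/rowP => j; apply/eqP; rewrite -subr_eq0.
  by have := u0 (enum_val j); rewrite enum_valK !mxE => ->.
have -> : T = limg f.
  apply/vspaceP => w; apply/idP/idP => [/tangent_span[c ->]|/memv_imgP[u _ ->]].
    apply/memv_imgP; exists (\row_j c (enum_val j)); rewrite ?memvf // fE.
    by apply: eq_bigr => o _; rewrite mxE enum_rankK.
  by rewrite fE memv_suml // => o _; rewrite memvZ // tangent_gen_mem.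
rewrite limg_dim_eq; last by rewrite (eqP kerf) capv0.
rewrite dimvf /dim /= mul1n card_option card_tagged sumnE big_map big_enum /=.
by congr _.+1; apply: eq_bigr => i _; rewrite card_ord.
Qed.

End SegreVeroneseTangentSpace.

Arguments unit_dir {K k n} {i} b _ : rename.

(** * Independence of tangent spaces *)

Lemma separating_form (K : fieldType) m (U : {vspace 'rV[K]_m}) v : v \notin U ->
  exists c : 'rV[K]_m, \sum_a c 0 a * v 0 a != 0 /\
    forall u, u \in U -> \sum_a c 0 a * u 0 a = 0.
Proof.
move=> vU; have : v - projv U v != 0.
  by apply: contra vU; rewrite subr_eq0 => /eqP->; exact: memv_proj.
case/rV0Pn => j vj.
pose c : 'rV[K]_m := \row_a (delta_mx 0 a - projv U (delta_mx 0 a)) 0 j.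
have cE (u : 'rV[K]_m) : \sum_a c 0 a * u 0 a = (u - projv U u) 0 j.
  rewrite [in RHS](row_sum_delta u) linear_sum -sumrB summxE; apply: eq_bigr => a _.
  by rewrite linearZ -scalerBr !mxE mulrC.
exists c; split=> [|u uU]; first by rewrite cE.
by rewrite cE projv_id // subrr mxE.
Qed.

Section Independence.
Context {K : closedFieldType} {k : nat} (n d : 'I_k -> nat).
Hypothesis d_gt0 : forall i, (0 < d i)%N.
Local Notation N := (SV_N n d).
Local Notation vectors := (forall i, 'rV[K]_(n i).+1).
Local Notation X := (SV K n d).
Local Notation linform := {i : 'I_k & 'rV[K]_(n i).+1}.
Implicit Types (v z u : vectors) (s : seq linform).

(** Multiplying by coordinates that are nonzero at v raises the multidegree without losing any zero
    elsewhere. *)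
Lemma pad_forms v s (e : 'I_k -> nat) : (forall i, v i != 0) ->
  (forall i, tags i s <= e i)%N -> all (fun x => linval x v != 0) s ->
  exists s', [/\ forall i, tags i s' = e i, all (fun x => linval x v != 0) s' &
    forall P, (count P s <= count P s')%N].
Proof.
move=> v0 se sv; have /fin_all_exists[a va] i : exists b, v i 0 b != 0 by apply/rV0Pn.
pose x i : linform := Tagged _ (delta_mx 0 (a i) : 'rV[K]_(n i).+1).
have xv i : linval (x i) v != 0.
  rewrite /linval (bigD1 (a i)) //= mxE !eqxx mul1r big1 ?addr0 ?va // => b ba.
  by rewrite mxE (negbTE ba) andbF mul0r.
exists (s ++ flatten [seq nseq (e i - tags i s) (x i) | i <- enum 'I_k]); split.
- move=> i; rewrite /tags count_cat count_flatten -map_comp sumnE big_map big_enum /=.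
  rewrite (bigD1 i) //= count_nseq eqxx mul1n big1 ?addn0; first exact: subnKC (se i).
  by move=> j /negbTE ji; rewrite count_nseq /= ji.
- rewrite all_cat sv; apply/allP => y /flattenP[_ /mapP[i _ ->]].
  by rewrite mem_nseq => /andP[_ /eqP->].
- by move=> P; rewrite count_cat leq_addr.
Qed.

(** The spare degree in the factor i0 is spent on m. If m vanishes at v, the product agrees there to
    first order with m times a nonzero constant; where two forms of s vanish, it has a double
    zero. *)
Lemma separating_functional v i0 s (m : 'rV[K]_(n i0).+1) : (forall i, v i != 0) ->
  (forall i, tags i s + (i == i0) <= d i)%N -> all (fun x => linval x v != 0) s ->
  exists l : 'cV[K]_N.+1, exists2 g, g != 0 &
   [/\ (SV_vector d v *m l) 0 0 = (\sum_a m 0 a * v i0 0 a) * g,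
       \sum_a m 0 a * v i0 0 a = 0 -> forall z,
         (dSV d v z *m l) 0 0 = (\sum_a m 0 a * z i0 0 a) * g &
       forall u z, (1 < count (fun x => linval x u == 0%R) s)%N ->
         (SV_vector d u *m l) 0 0 = 0 /\ (dSV d u z *m l) 0 0 = 0].
Proof.
move=> v0 se sv; have [|s' [s'e s'v s'c]] := @pad_forms v s (fun i => d i - (i == i0))%N v0 _ sv.
  by move=> i; rewrite -(leq_add2r (i == i0)) subnK //; have := d_gt0 i; case: (i == i0).
pose x : linform := Tagged _ m.
have [|l lP] := @linear_product_functional K k n d (x :: s').
  move=> i; rewrite /tags /= -/(tags i s') s'e eq_sym subnKC //.
  by have := d_gt0 i; case: (i == i0).
exists l, (\prod_(y <- s') linval y v).
  by rewrite prodf_seq_neq0; apply: sub_all s'v => y ->; rewrite implybT.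
split=> [|mv z|u z cu].
- by have [-> _] := lP v v; rewrite linear_product0 big_cons.
- have [_ ->] := lP v z; rewrite linear_product_cons.
  by rewrite [linval x v]mv mul0r addr0.
- have cxu : (1 < count (fun x => linval x u == 0%R) (x :: s'))%N.
    by rewrite /= ltn_addl // (leq_trans cu).
  have [-> ->] := lP u z; rewrite linear_product_double // linear_product0.
  by rewrite linear_product_eq0 // has_count ltnW.
Qed.

Variables (r : nat) (x : 'I_r -> multiproj K n) (v : 'I_r -> vectors).
Hypothesis vx : forall l, represents (v l) (x l).
Local Notation T l := (tangent_space X (SV_map d (x l))).

Let v0 l i : v l i != 0. Proof. by case: (vx l i). Qed.

Lemma tangent_killed l (m : 'cV[K]_N.+1) : (SV_vector d (v l) *m m) 0 0 = 0 ->
  (forall z, (dSV d (v l) z *m m) 0 0 = 0) -> forall w, w \in T l -> (w *m m) 0 0 = 0.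
Proof.
move=> m0 m1 w; have /fin_all_exists[a va] i : exists b, v l i 0 b != 0 by apply/rV0Pn.
move=> /(tangent_span d_gt0 (vx l) va)[c ->].
rewrite mulmx_suml summxE big1 // => o _; rewrite -scalemxAl mxE.
by case: o => [q|]; rewrite /tangent_gen ?m1 ?m0 mulr0.
Qed.

Lemma sum_tangent_killed l (m : 'cV[K]_N.+1) :
  (forall l', l' != l -> forall w, w \in T l' -> (w *m m) 0 0 = 0) ->
  forall w, w \in (\sum_(l' | l' != l) T l')%VS -> (w *m m) 0 0 = 0.
Proof.
move=> mT w /memv_sumP[u uT ->]; rewrite mulmx_suml summxE big1 // => l' l'l.
by apply: (mT l') => //; exact: uT.
Qed.

Lemma tangent_independent : 'I_k -> (forall l i0, exists s,
    [/\ forall i, (tags i s + (i == i0) <= d i)%N, all (fun y => linval y (v l) != 0) s &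
        forall l', l' != l -> (1 < count (fun y => linval y (v l') == 0%R) s)%N]) ->
  directv (\sum_l T l).
Proof.
move=> i1 cov; apply/directv_sumP => l _; apply/eqP; rewrite -subv0; apply/subvP => w.
rewrite memv_cap memv0 => /andP[wT].
rewrite (eq_bigl (fun l' => l' != l)) // => wS.
have /fin_all_exists[a va] i : exists b, v l i 0 b != 0 by apply/rV0Pn.
have [c wE] := tangent_span d_gt0 (vx l) va wT.
have kill s (m' : 'cV[K]_N.+1) :
    (forall l', l' != l -> (1 < count (fun y => linval y (v l') == 0%R) s)%N) ->
    (forall u z, (1 < count (fun x => linval x u == 0%R) s)%N ->
         (SV_vector d u *m m') 0 0 = 0 /\ (dSV d u z *m m') 0 0 = 0) ->
    (w *m m') 0 0 = 0.
  move=> sl mm; apply: sum_tangent_killed wS => l' l'l; apply: tangent_killed => [|z].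
    by have [] := mm _ (v l') (sl l' l'l).
  by have [] := mm _ z (sl l' l'l).
pose qtgt (q : {i : 'I_k & 'I_(n i)}) := lift (a (tag q)) (tagged q).
have cS q : c (Some q) = 0.
  (* z is the component of the direction of w in the factor of q. Its pivot coordinate is 0, so if
     nonzero it is not proportional to [v l i], and some form m kills [v l i] but not z. *)
  pose i := tag q; pose z := \sum_q' c (Some q') *: unit_dir (qtgt q') i : 'rV[K]_(n i).+1.
  have zq : z 0 (qtgt q) = c (Some q).
    rewrite summxE (bigD1 q) //= big1 ?addr0 => [|q' qq'].
      by rewrite !mxE eqxx mulr1.
    by rewrite !mxE tgt_lift_eq eq_sym (negbTE qq') mulr0.
  have za : z 0 (a i) = 0.
    rewrite summxE big1 // => q' _; rewrite !mxE eq_sym tgt_pivotF ?mulr0 //.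
    by rewrite eq_sym neq_lift.
  have [z0|z0] := eqVneq z 0; first by rewrite -zq z0 mxE.
  have zv : z \notin <[v l i]>%VS.
    apply/vlineP => -[t zt]; case/eqP: z0; move/eqP: za; rewrite zt mxE mulf_eq0.
    by rewrite (negbTE (va i)) orbF => /eqP->; rewrite scale0r.
  have [m [mz mv]] := separating_form zv.
  have [s [sd sv sl]] := cov l i.
  have [m' [g g0 [mSV mdSV mm]]] := separating_functional m (v0 l) sd sv.
  have {}mv := mv _ (memv_line _).
  have := kill s m' sl mm; rewrite wE mulmx_suml summxE (bigD1 None) //=.
  rewrite -scalemxAl mxE /tangent_gen mSV mv mul0r mulr0 add0r => /eqP.
  suff -> : \sum_(o | o != None) (c o *: tangent_gen d (v l) a o *m m') 0 0 =
      (\sum_a m 0 a * z 0 a) * g by rewrite mulf_eq0 (negbTE mz) (negbTE g0).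
  rewrite (reindex_onto (Some : _ -> option _) (odflt q)) /=; last by case.
  rewrite (eq_bigl xpredT) => [|q']; last by rewrite eqxx.
  under [in RHS]eq_bigr => b _ do rewrite summxE mulr_sumr.
  rewrite exchange_big mulr_suml; apply: eq_bigr => q' _ /=.
  rewrite -scalemxAl mxE /tangent_gen mdSV // mulrA; congr (_ * _).
  by rewrite mulr_sumr; apply: eq_bigr => b _; rewrite [in RHS]mxE mulrCA.
(* What is left of w is a multiple of the point; a form that is nonzero at the point detects it. *)
have m0 : v l i1 \notin 0%VS by rewrite memv0 v0.
have [m [mv _]] := separating_form m0.
have [s [sd sv sl]] := cov l i1.
have [m' [g g0 [mSV mdSV mm]]] := separating_functional m (v0 l) sd sv.
have := kill s m' sl mm; rewrite wE mulmx_suml summxE (bigD1 None) //= big1; last first.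
  by case=> [q|] // _; rewrite cS scale0r mul0mx mxE.
rewrite addr0 -scalemxAl mxE /tangent_gen mSV => /eqP.
rewrite !mulf_eq0 (negbTE mv) (negbTE g0) !orbF => /eqP c0.
by rewrite big1 // => -[q|] _; rewrite ?cS ?c0 scale0r.
Qed.

End Independence.

(** * Dependence of the tangent spaces at collinear points *)

Section Dependence.
Context {K : closedFieldType} {k : nat} (n d : 'I_k -> nat).
Hypothesis d_gt0 : forall i, (0 < d i)%N.
Local Notation N := (SV_N n d).
Local Notation vectors := (forall i, 'rV[K]_(n i).+1).
Local Notation X := (SV K n d).

Variables (r : nat) (x : 'I_r -> multiproj K n) (v : 'I_r -> vectors).
Hypothesis vx : forall l, represents (v l) (x l).
Local Notation T l := (tangent_space X (SV_map d (x l))).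

Lemma size_prod_le (I : Type) (s : seq I) (F : I -> {poly K}) (D : I -> nat) :
  (forall i, size (F i) <= (D i).+1)%N ->
  (size (\prod_(i <- s) F i)%R <= (\sum_(i <- s) D i).+1)%N.
Proof.
move=> FD; elim: s => [|i s IH]; first by rewrite !big_nil size_poly1.
rewrite !big_cons; apply: leq_trans (size_polyMleq _ _) _.
by have := leq_add (FD i) IH; lia.
Qed.

Lemma horner_deriv_wide D (p : {poly K}) s : (size p <= D)%N ->
  p^`().[s] = \sum_(e < D) p`_e * (s ^+ e.-1 *+ e).
Proof.
move=> pD; rewrite -{1}[p](coefK) (poly_def (size p)).
rewrite (big_ord_widen D (fun e => p`_e *: 'X^e)) // raddf_sum horner_sum big_mkcond /=.
apply: eq_bigr => e _; case: ltnP => [_|es]; last by rewrite nth_default // mul0r.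
by rewrite derivZ derivXn hornerZ hornerMn hornerXn.
Qed.

Variables (i : 'I_k) (V0 z : vectors) (s : 'I_r -> K).
Hypotheses (zi : forall j, j != i -> z j = 0)
  (vE : forall l j, v l j = V0 j + s l *: z j)
  (zv : forall l, z i \notin <[v l i]>%VS)
  (dr : ((d i).+1 < r + r)%N).

Lemma size_curve_SVm (J : 'I_N.+1) : (size (SVm (curve V0 z) J) <= (d i).+1)%N.
Proof.
apply: leq_trans (size_prod_le (D := fun j => if j == i then d i else 0%N) _ _) _.
  move=> j; case: (j =P i) => [->|/eqP ji].
    rewrite -(expo_sum J i); apply: size_prod_le => c.
    apply: leq_trans (size_poly_exp_leq _ _) _; rewrite ltnS.
    have sc : (size (curve V0 z c) <= 2)%N.
      rewrite /curve; apply: leq_trans (size_polyD _ _) _; rewrite geq_max.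
      by rewrite (leq_trans (size_polyC_leq1 _)) // (leq_trans (size_scale_leq _ _)) // size_polyX.
    by rewrite -[leqRHS]mul1n leq_mul2r; apply/orP; right; rewrite -subn1 leq_subLR; exact: sc.
  have -> : \prod_c curve V0 z c ^+ expo J j c = (\prod_c V0 j 0 c ^+ expo J j c)%:P.
    rewrite rmorph_prod; apply: eq_bigr => c _.
    by rewrite /curve zi // mxE scale0r addr0 rmorphXn.
  exact: size_polyC_leq1.
by rewrite -big_mkcond big_pred1_eq.
Qed.

Lemma SV_line l J : SV_vector d (v l) 0 J = (SVm (curve V0 z) J).[s l].
Proof.
rewrite SVm_horner SV_vectorE; apply: eq_bigr => j _; apply: eq_bigr => c _.
by rewrite vE !mxE hornerD hornerC hornerZ hornerX mulrC.
Qed.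

Lemma dSV_line l J : dSV d (v l) z 0 J = (SVm (curve V0 z) J)^`().[s l].
Proof.
rewrite mxE (_ : SVm _ J = SVm (curve V0 z) J \Po ('X + (s l)%:P)).
  rewrite deriv_comp derivD derivX derivC addr0 mulr1 horner_comp.
  by rewrite hornerD hornerX hornerC add0r.
rewrite /SVm rmorph_prod; apply: eq_bigr => j _; rewrite rmorph_prod.
apply: eq_bigr => c _; rewrite rmorphXn /=; congr (_ ^+ _).
rewrite /curve vE !mxE comp_polyD comp_polyC comp_polyZ comp_polyX polyCD polyCM -!mul_polyC.
by ring.
Qed.

Lemma tangent_dependent : ~~ directv (\sum_l T l).
Proof.
pose D := (d i).+1.
(* A confluent Vandermonde matrix: the rows of A and B give the value and the derivative at [s l] of
   a polynomial of size at most D. For e = 0 the multiplicity 0 neutralizes e.-1. There are 2r rows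
   and fewer columns, hence a relation. *)
pose A := \matrix_(l < r, e < D) s l ^+ e.
pose B := \matrix_(l < r, e < D) (s l ^+ e.-1 *+ e).
have : kermx (col_mx A B) != 0.
  by rewrite kermx_eq0 /row_free neq_ltn (leq_ltn_trans (rank_leq_col _) dr).
case/rowV0Pn => g /sub_kermxP; rewrite -[g]hsubmxK mul_row_col.
set a := lsubmx g; set b := rsubmx g => gAB g0.
have gJ (J : 'I_N.+1) : \sum_l (a 0 l * (SVm (curve V0 z) J).[s l] +
    b 0 l * (SVm (curve V0 z) J)^`().[s l]) = 0.
  pose p := SVm (curve V0 z) J; have pD : (size p <= D)%N := size_curve_SVm J.
  rewrite -/p.
  transitivity (\sum_(e < D) p`_e * (a *m A + b *m B) 0 e); last first.
    by rewrite gAB big1 // => e _; rewrite mxE mulr0.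
  under [RHS]eq_bigr => e _.
    rewrite !mxE -big_split mulr_sumr /=; under eq_bigr => l _ do rewrite !mxE mulrDr.
    over.
  rewrite exchange_big; apply: eq_bigr => l _ /=.
  rewrite (horner_coef_wide _ pD) (horner_deriv_wide _ pD) !mulr_sumr -big_split.
  rewrite [a 0 l]mxE [b 0 l]mxE; apply: eq_bigr => e _ /=.
  by congr (_ + _); rewrite mulrCA.
apply/negP => /directv_sum_independent dir.
have ab l : a 0 l *: SV_vector d (v l) + b 0 l *: dSV d (v l) z = 0.
  apply: (dir (fun l => a 0 l *: SV_vector d (v l) + b 0 l *: dSV d (v l) z)) => // [l' _|].
    by apply: memvD; apply: memvZ; [exact: SV_tangent|exact: dSV_tangent].
  apply/rowP => J; rewrite summxE mxE -[RHS](gJ J); apply: eq_bigr => l' _.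
  by rewrite -SV_line -dSV_line !mxE.
have v0 l j : v l j != 0 by case: (vx l j).
(* Directness makes the relation vanish point by point. A form that kills [v l i] but not [z i] then
   isolates the coefficient of the derivative. *)
have b0 l : b 0 l = 0.
  have [m [mz mv]] := separating_form (zv l).
  have [||m' [c c0 [mSV mdSV _]]] := @separating_functional K k n d d_gt0 (v l) i [::] m (v0 l).
  - by move=> j; case: (j == i); rewrite /= ?d_gt0.
  - by [].
  have {}mv := mv _ (memv_line _).
  have := congr1 (fun w => (w *m m') 0 0) (ab l).
  rewrite /= mulmxDl -!scalemxAl mul0mx mxE [in RHS]mxE [X in X + _]mxE [X in _ + X]mxE.
  rewrite mSV mdSV // mv mul0r mulr0 add0r => /eqP.
  by rewrite !mulf_eq0 (negbTE mz) (negbTE c0) !orbF => /eqP.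
have a0 l : a 0 l = 0.
  have /eqP := ab l; rewrite b0 scale0r addr0 scaler_eq0.
  by rewrite (negbTE (SV_vector_neq0 _ (v0 l))) orbF => /eqP.
case/eqP: g0; apply/rowP => l.
by rewrite [RHS]mxE mxE; case: splitP => l' _; rewrite ?a0 ?b0.
Qed.

End Dependence.

Lemma dim_addv_vline (K : fieldType) (vT : vectType K) (u w : vT) :
  u != 0 -> w \notin <[u]>%VS -> \dim (<[u]> + <[w]>)%VS = 2%N.
Proof.
move=> u0 wu; apply/eqP; rewrite eqn_leq; apply/andP; split.
  by apply: leq_trans (dimv_add_leqif _ _) _; rewrite !dim_vline; case: (_ != 0); case: (_ != 0).
rewrite ltn_neqAle; have [le eq] := dimv_leqif_sup (addvSl <[u]>%VS <[w]>%VS).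
move: le eq; rewrite dim_vline u0 /= => -> ->; rewrite andbT.
apply: contra wu => /subvP; apply; rewrite (subvP (addvSr _ _)) //.
exact: memv_line.
Qed.

(** * Products of linear forms with prescribed double zeros *)

Section Configurations.
Context {K : closedFieldType} {k : nat} (n d : 'I_k -> nat).
Hypothesis d_gt0 : forall i, (0 < d i)%N.
Local Notation N := (SV_N n d).
Local Notation vectors := (forall i, 'rV[K]_(n i).+1).
Local Notation X := (SV K n d).
Local Notation linform := {i : 'I_k & 'rV[K]_(n i).+1}.

Definition on_line r (x : 'I_r -> multiproj K n) (i : 'I_k) : Prop :=
  (forall j, j != i -> forall l l', x l j = x l' j) /\
  \dim (\sum_l line (x l i))%VS = 2%N.

Section Cover.
Variables (r : nat) (x : 'I_r -> multiproj K n) (v : 'I_r -> vectors).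
Hypotheses (x_inj : injective x) (vx : forall l, represents (v l) (x l)).

Lemma neq_notin l l' j : x l j != x l' j -> v l j \notin <[v l' j]>%VS.
Proof.
apply: contra => vl; have [_ lE] := vx l j; have [_ lE'] := vx l' j.
apply/eqP/val_inj => /=; rewrite -lE -lE'; apply/eqP; rewrite eqEdim -memvE vl.
by rewrite !dim_vline !(vx _ _).1.
Qed.

Definition double_forms (P : pred 'I_r) (phi : 'I_r -> linform) : seq linform :=
  flatten [seq [:: phi l; phi l] | l <- enum P].

Lemma count_double_forms (P : pred 'I_r) phi (A : pred linform) :
  count A (double_forms P phi) = (2 * #|[pred l | P l & A (phi l)]|)%N.
Proof.
rewrite /double_forms count_flatten -map_comp sumnE big_map big_enum_cond /=.
rewrite -sum1_card big_distrr [LHS]big_mkcond [RHS]big_mkcond; apply: eq_bigr => l _ /=.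
by rewrite !inE andbT unfold_in; case: (P l); case: (A _).
Qed.

Lemma all_double_forms (P : pred 'I_r) phi (A : pred linform) :
  (forall l, P l -> A (phi l)) -> all A (double_forms P phi).
Proof.
move=> PA; apply/allP => y /flattenP[_ /mapP[l + ->]].
by rewrite mem_enum => /PA Al; rewrite !inE orbb => /eqP->.
Qed.

Lemma double_forms_count (P : pred 'I_r) phi (A : pred linform) l :
  P l -> A (phi l) -> (1 < count A (double_forms P phi))%N.
Proof.
move=> Pl Al; rewrite count_double_forms (cardD1 l) inE Pl Al /=; lia.
Qed.

Lemma cover_form l l' j : x l j != x l' j -> exists y : linform,
  [/\ tag y = j, linval y (v l) != 0 & linval y (v l') = 0].
Proof.
move=> /neq_notin/separating_form[c [cl cl']]; exists (Tagged (fun i => 'rV[K]_(n i).+1) c); split=> //.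
by apply: cl'; exact: memv_line.
Qed.

(** [al] names, for each point to be separated from x l, a factor where the two differ; the square
    of a separating form costs 2 degrees in that factor. *)
Lemma cover_by l (P : pred 'I_r) (al : 'I_r -> 'I_k) :
  (forall l', P l' -> x l (al l') != x l' (al l')) -> exists s,
  [/\ forall i, tags i s = (2 * #|[pred l' | P l' & al l' == i]|)%N,
      all (fun y => linval y (v l) != 0) s &
      forall l', P l' -> (1 < count (fun y => linval y (v l') == 0%R) s)%N].
Proof.
move=> xP; have /fin_all_exists[phi phiP] l' : exists y : linform, P l' ->
    [/\ tag y = al l', linval y (v l) != 0 & linval y (v l') = 0].
  have [/xP/cover_form[y yP]|_] := boolP (P l'); first by exists y.
  by exists (Tagged (fun i => 'rV[K]_(n i).+1) (0 : 'rV_(n (al l')).+1)).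
exists (double_forms P phi); split=> [i||l' Pl'].
- rewrite /tags count_double_forms; congr (2 * _)%N; apply: eq_card => l'.
  by rewrite !inE; case Pl': (P l') => //=; have [-> _ _] := phiP l' Pl'.
- by apply: all_double_forms => l' /= Pl'; have [] := phiP l' Pl'.
- by apply: (@double_forms_count _ _ _ l') => //=; have [_ _ ->] := phiP l' Pl'.
Qed.

Hypotheses (r_le : forall i, (r <= SV_bound (d i))%N) (r_gt1 : (1 < r)%N)
  (d_eq1 : (#|[pred i | d i == 1%N]| <= 1)%N)
  (not_line : forall i, SV_bound (d i) = r -> ~ on_line x i).

(** With one degree in reserve, a factor can pay for the separation of r - 2 points; by the next
    lemma, for r - 1 points when it is not in J. *)
Lemma r_le_d i : (2 * (r - 2) <= d i - 1)%N.
Proof.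
have := r_le i; have := d_gt0 i; have := uphalf_half (d i + 2).
by have := odd_double_half (d i + 2); rewrite /SV_bound -mul2n; case: (odd _) => /=; lia.
Qed.

Lemma r_lt_d i : SV_bound (d i) <> r -> (2 * (r - 1) <= d i - 1)%N.
Proof.
have := r_le i; have := d_gt0 i; have := uphalf_half (d i + 2).
by have := odd_double_half (d i + 2); rewrite /SV_bound -mul2n; case: (odd _) => /=; lia.
Qed.

(** Some q' lies off the line through x l and q, since otherwise the whole configuration would be on
    that line; then x l is off the line through q and q'. *)
Lemma noncollinear l j0 : SV_bound (d j0) = r ->
  (forall l' j, j != j0 -> x l' j = x l j) ->
  exists q q', [/\ q != l, q' != l, q != q' & v l j0 \notin (<[v q j0]> + <[v q' j0]>)%VS].
Proof.
move=> Jj0 xj0; have xl l' l'' : l' != l'' -> x l' j0 != x l'' j0.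
  apply: contra => /eqP E; apply/eqP/x_inj/ffunP => j.
  by have [->//|jj0] := eqVneq j j0; rewrite xj0 // [RHS]xj0.
have [q ql] : exists q, q != l.
  have : (0 < #|predC1 l|)%N by rewrite cardC1 card_ord; lia.
  by case/card_gt0P => q; rewrite inE; exists q.
have vlq : v l j0 \notin <[v q j0]>%VS by apply/neq_notin/xl; rewrite eq_sym.
have [q' vq'] : exists q', v q' j0 \notin (<[v l j0]> + <[v q j0]>)%VS.
  apply: contrapT => /forallNP inlq; apply: (not_line Jj0); split.
    by move=> j jj0 l' l''; rewrite xj0 // [RHS]xj0.
  apply/eqP; rewrite eqn_leq; apply/andP; split.
    apply: (@leq_trans (\dim (<[v l j0]> + <[v q j0]>)%VS)).
      apply: dimvS; apply/subv_sumP => l' _; have [_ <-] := vx l' j0.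
      by rewrite -memvE; apply/negPn/negP; exact: inlq.
    by rewrite addvC dim_addv_vline //; case: (vx q j0).
  apply: (@leq_trans (\dim (<[v q j0]> + <[v l j0]>)%VS)).
    by rewrite dim_addv_vline //; case: (vx q j0).
  rewrite (vx l j0).2 (vx q j0).2; apply: dimvS; rewrite subv_add.
  by rewrite (sumv_sup q) ?(sumv_sup l).
exists q, q'; split=> //.
- by apply: contraNneq vq' => ->; rewrite (subvP (addvSl _ _)) // memv_line.
- by apply: contraNneq vq' => <-; rewrite (subvP (addvSr _ _)) // memv_line.
apply: contra vq' => /memv_addP[_ /vlineP[a ->] [_ /vlineP[b ->]] E].
have [b0|b0] := eqVneq b 0.
  case/negP: vlq; by rewrite E b0 scale0r addr0 memvZ // memv_line.
have -> : v q' j0 = b^-1 *: v l j0 + (- (b^-1 * a)) *: v q j0.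
  rewrite E scalerDr !scalerA mulVf // scale1r addrAC -scalerDl.
  by rewrite subrr scale0r add0r.
by rewrite memv_add // memvZ // memv_line.
Qed.

(* If the other points differ from x l in several factors, or are not collinear
   with it, then no factor needs to take care of all of them. *)
Lemma double_cover l i0 : exists s,
  [/\ forall i, (tags i s + (i == i0) <= d i)%N, all (fun y => linval y (v l) != 0) s &
      forall l', l' != l -> (1 < count (fun y => linval y (v l') == 0%R) s)%N].
Proof.
have d1 i (c : nat) : (c <= d i - 1)%N -> (c + (i == i0) <= d i)%N.
  by have := d_gt0 i; case: (i == i0) => /=; lia.
have [[j0 xj0]|nC1] := pselect (exists j0, forall l' j, j != j0 -> x l' j = x l j).
  have xl l' : l' != l -> x l j0 != x l' j0.
    apply: contra => /eqP E; apply/eqP/x_inj/ffunP => j.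
    by have [->|/xj0] := eqVneq j j0.
  have [Jj0|/eqP nJj0] := eqVneq (SV_bound (d j0)) r; last first.
    (* As j0 is not in J, it can pay for all r - 1 other points. *)
    have [s [st sv sl]] := @cover_by l (predC1 l) (fun=> j0) xl.
    exists s; split=> // i; apply: d1; rewrite st.
    have [<-|ij0] := eqVneq j0 i; last first.
      by rewrite eq_card0 ?muln0 // => l'; rewrite !inE andbF.
    apply: leq_trans (r_lt_d nJj0); rewrite leq_mul2l /=.
    rewrite subn1; have := cardC1 l; rewrite card_ord => <-; apply: subset_leq_card.
    by apply/fintype.subsetP => l'; rewrite !inE => /andP[].
  (* The square of one hyperplane through q and q' deals with two points for 2 degrees, and the r -
     3 others cost 2 each: 2 * (r - 2) in all. *)
  have [q [q' [ql q'l qq' /separating_form[c [cl cq]]]]] := noncollinear Jj0 xj0.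
  pose P := [pred l' | l' \notin [set l; q; q']%SET].
  have [|s [st sv sl]] := @cover_by l P (fun=> j0).
    by move=> l'; rewrite !inE !negb_or -!andbA => /and3P[/xl].
  pose y : linform := Tagged (fun i => 'rV[K]_(n i).+1) c.
  have card3 : #|[set l; q; q']%SET| = 3%N.
    by rewrite finset.setUC cardsU1 cards2 !inE negb_or q'l (eq_sym q' q) qq' (eq_sym l q) ql.
  exists ([:: y; y] ++ s); split.
  - move=> i; apply: d1; apply: leq_trans (r_le_d i).
    rewrite /tags count_cat -/(tags i s) st /=.
    have [_|ij0] := eqVneq j0 i; last first.
      by rewrite eq_card0 ?muln0 // => l'; rewrite !inE andbF.
    have : (3 + #|[pred l' | l' \notin [set l; q; q']%SET & true]| = r)%N.
      have := cardsC [set l; q; q']%SET; rewrite card3 card_ord => E.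
      rewrite -[RHS]E; congr (3 + _)%N.
      by apply: eq_card => l'; rewrite !inE andbT.
    by set p := #|_| => <-; rewrite -[(true + _)%N]/2%N; lia.
  - by rewrite all_cat sv /= !andbT andbb; exact: cl.
  - move=> l' l'l; rewrite count_cat.
    have [Pl'|] := boolP (P l'); first by apply: leq_trans (sl l' Pl') _; rewrite leq_addl.
    rewrite !inE negbK (negbTE l'l) /= => qq.
    have yl' : linval y (v l') == 0.
      apply/eqP; apply: cq; case/orP: qq => /eqP->.
        by rewrite (subvP (addvSl _ _)) // memv_line.
      by rewrite (subvP (addvSr _ _)) // memv_line.
    by rewrite /= yl'.
have {}nC1 j0 : exists l' j, j != j0 /\ x l j != x l' j.
  apply: contrapT => H; apply: nC1; exists j0 => l' j jj0; apply/eqP/negPn/negP => lj.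
  by apply: H; exists l', j; split=> //; rewrite eq_sym.
have r2 l' l'' : r = 2%N -> l' != l -> l'' != l -> l' = l''.
  move=> r2 l'l l''l; apply/eqP/negPn/negP => ll.
  have := max_card (mem [set l; l'; l'']%SET); rewrite finset.setUC cardsU1 cards2.
  by rewrite !inE negb_or l''l (eq_sym l'' l') ll (eq_sym l l') l'l card_ord r2.
have neq_l l' j : x l j != x l' j -> l' != l by apply: contraNneq => ->.
have [r_gt2|r_le2] := ltnP 2 r.
  (* When the assignment of factors is not constant, no factor pays for more than r - 2 points. *)
  have [al [alP alC]] : exists al : 'I_r -> 'I_k,
      (forall l', l' != l -> x l (al l') != x l' (al l')) /\
      forall j, exists2 l', l' != l & al l' != j.
    have /fin_all_exists[al alP] l' : exists j, l' != l -> x l j != x l' j.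
      have [->|l'l] := eqVneq l' l; first by exists i0.
      apply: contrapT => /forallNP H; case/eqP: l'l; apply/x_inj/ffunP => j.
      by apply/eqP/negPn/negP => jl; apply: (H j) => _; rewrite eq_sym.
    have [alC|/existsNP[j1 alj1]] := pselect (forall j, exists2 l', l' != l & al l' != j).
      by exists al.
    (* All points were assigned j1; one that also differs from x l in j2 is reassigned. Since r > 2,
       another one keeps j1. *)
    have [l1 [j2 [j21 xj2]]] := nC1 j1; have l1l := neq_l _ _ xj2.
    exists (fun l' => if l' == l1 then j2 else al l'); split=> [l' l'l|j].
      by case: (l' =P l1) => [->//|_]; exact: alP.
    have [->|jj2] := eqVneq j j2; last by exists l1 => //; rewrite eqxx eq_sym.
    have [l2] : exists l2, l2 \in ~: [set l; l1]%SET.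
      apply/set0Pn; rewrite -card_gt0; have := cardsC [set l; l1]%SET.
      by rewrite card_ord cards2; case: (l != l1) => /=; lia.
    rewrite !inE negb_or => /andP[l2l l21]; exists l2 => //.
    rewrite (negbTE l21); apply/eqP => al2; apply: alj1; exists l2 => //.
    by rewrite al2.
  have [s [st sv sl]] := @cover_by l (predC1 l) al alP.
  exists s; split=> // i; apply: d1; apply: leq_trans (r_le_d i); rewrite st.
  have [l1 l1l al1] := alC i; rewrite leq_mul2l /=.
  have := cardsC [set l; l1]%SET; rewrite card_ord cards2 eq_sym l1l /= => E.
  have {}E : (2 + #|~: [set l; l1]%SET| = r)%N := E.
  apply: (@leq_trans #|~: [set l; l1]%SET|); last by rewrite leq_subRL ?E // ltnW.
  apply: subset_leq_card; apply/fintype.subsetP => l'; rewrite !inE negb_or => /andP[->] /=.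
  by apply: contraTneq => ->.
have {}r2 := r2 _ _ (_ : r = 2%N); have {}r2 l' l'' : l' != l -> l'' != l -> l' = l''.
  by apply: r2; apply/eqP; rewrite eqn_leq r_le2.
(* For r = 2 there is a single other point, and a square in a factor other than i0 leaves the spare
   degree in i0 untouched. *)
have one j1 l1 : j1 != i0 -> (1 < d j1)%N -> x l j1 != x l1 j1 -> exists s,
  [/\ forall i, (tags i s + (i == i0) <= d i)%N, all (fun y => linval y (v l) != 0) s &
      forall l', l' != l -> (1 < count (fun y => linval y (v l') == 0%R) s)%N].
  move=> j1i0 dj1 xj1; have [l'|s [st sv sl]] := @cover_by l (predC1 l) (fun=> j1).
    by move=> /= l'l; rewrite (r2 l' l1 l'l (neq_l _ _ xj1)).
  exists s; split=> // i; rewrite st; have [<-|ij1] := eqVneq j1 i.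
    rewrite (negbTE j1i0) addn0; apply: leq_trans dj1; rewrite -[leqRHS]muln1 leq_mul2l /=.
    apply: (@leq_trans #|predC1 l|); last by rewrite cardC1 card_ord; lia.
    by apply: subset_leq_card; apply/fintype.subsetP => l'; rewrite !inE => /andP[].
  rewrite eq_card0 ?muln0 => [|l']; last by rewrite !inE andbF.
  by have := d_gt0 i; case: (i == i0).
have [l1 [j1 [j1i0 xj1]]] := nC1 i0.
have [dj1|dj1] := ltnP 1 (d j1); first exact: one dj1 xj1.
have [l2 [j2 [j21 xj2]]] := nC1 j1.
have dj2 : (1 < d j2)%N.
  rewrite ltnNge; apply/negP => dj2; have : ([set j1; j2]%SET \subset [pred i | d i == 1%N]).
    apply/fintype.subsetP => i; rewrite !inE.
    by case/orP => /eqP->; rewrite eqn_leq d_gt0 ?dj1 ?dj2.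
  by move/subset_leq_card; rewrite cards2 eq_sym j21 => /leq_trans/(_ d_eq1).
have [j2i0|] := eqVneq j2 i0; last by move=> j2i0; exact: one dj2 xj2.
(* Here j1 has degree 1 and j2 = i0 has degree at least 2: one form in each gives the double zero
   and leaves a degree in i0. *)
have [y1 [t1 y1l y1l1]] := cover_form xj1; have [y2 [t2 y2l y2l2]] := cover_form xj2.
exists [:: y1; y2]; split.
- move=> i; rewrite /tags /= t1 t2 addn0 -j2i0.
  have [<-|ij1] := eqVneq j1 i; first by rewrite [j1 == j2]eq_sym (negbTE j21) d_gt0.
  by rewrite [i == j2]eq_sym; case: (j2 =P i) => [<-|_].
- by rewrite /= y1l y2l.
- move=> l' l'l; rewrite /= (r2 l' l1 l'l (neq_l _ _ xj1)) y1l1 eqxx.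
  by rewrite (r2 l1 l2 (neq_l _ _ xj1) (neq_l _ _ xj2)) y2l2 eqxx.
Qed.

End Cover.
End Configurations.

Lemma vectors_with (K : fieldType) k (n : 'I_k -> nat) (V : forall i, 'rV[K]_(n i).+1) i
    (u : 'rV[K]_(n i).+1) :
  exists V' : forall i, 'rV[K]_(n i).+1, V' i = u /\ forall j, j != i -> V' j = V j.
Proof.
exists (fun j => if @eqP _ i j is ReflectT E then eq_rect i (fun j => 'rV[K]_(n j).+1) u j E
  else V j); split; first by case: eqP => // E; rewrite eq_axiomK.
by move=> j ji; case: eqP => // ij; rewrite ij eqxx in ji.
Qed.

(** * Normal form of collinear configurations *)

Section Lines.
Context {K : closedFieldType} {k : nat} (n : 'I_k -> nat).
Local Notation vectors := (forall i, 'rV[K]_(n i).+1).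

(** The form with coefficients 1, t, t^2, ... sends v l to the value at t of the polynomial whose
    coefficients are the entries of v l; any t that is not a root of the product of these
    polynomials will do. *)
Lemma avoiding_form m r (v : 'I_r -> 'rV[K]_m) : (forall l, v l != 0) ->
  exists c : 'rV[K]_m, forall l, \sum_a c 0 a * v l 0 a != 0.
Proof.
move=> v0; have : \prod_l rVpoly (v l) != 0.
  apply/prodf_neq0 => l _; apply: contra (v0 l) => /eqP p0.
  by rewrite -[v l]rVpolyK p0 linear0.
case/poly_nonroot => t; rewrite horner_prod => /prodf_neq0 pt.
exists (\row_a t ^+ a) => l; have := pt l isT; rewrite (horner_coef_wide _ (size_poly _ _)).
by congr (_ != 0); apply: eq_bigr => a _; rewrite coef_rVpoly_ord mxE mulrC.
Qed.

(** Representatives normalized by a form that is nonzero at all the points lie on an affine line u +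
    s w. The form vanishes at w, the point at infinity, which is therefore independent of each of
    them. *)
Lemma line_form r (x : 'I_r -> multiproj K n) i : injective x -> (1 < r)%N ->
  on_line x i -> exists (u w : 'rV[K]_(n i).+1) (s : 'I_r -> K),
    [/\ forall l, <[u + s l *: w]>%VS = line (x l i),
        forall l, w \notin <[u + s l *: w]>%VS & w \notin <[u]>%VS].
Proof.
move=> x_inj r_gt1 [xj dimL]; set L := (\sum_l line (x l i))%VS in dimL.
have [c cP] := avoiding_form (fun l => coords_neq0 (x l i)).
pose f (v : 'rV[K]_(n i).+1) := \sum_a c 0 a * v 0 a.
have fD v w a : f (v + a *: w) = f v + a * f w.
  rewrite /f mulr_sumr -big_split; apply: eq_bigr => b _ /=.
  by rewrite !mxE mulrDr mulrCA.
have fZ a w : f (a *: w) = a * f w.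
  by rewrite /f mulr_sumr; apply: eq_bigr => b _; rewrite !mxE mulrCA.
pose v l := (f (coords (x l i)))^-1 *: coords (x l i).
have fv l : f (v l) = 1 by rewrite fZ mulVf // cP.
have vL l : <[v l]>%VS = line (x l i).
  apply/eqP; rewrite eqEdim -memvE -line_coords memvZ ?memv_line //=.
  by rewrite !dim_vline scaler_eq0 invr_eq0 (negbTE (cP l)) coords_neq0.
have vinL l : v l \in L by apply: (subvP (sumv_sup l _ _)) (memv_line _); rewrite ?vL.
pose l0 : 'I_r := Ordinal (ltnW r_gt1); pose l1 : 'I_r := Ordinal r_gt1.
pose w := v l1 - v l0.
have fw : f w = 0 by rewrite /w -scaleN1r fD !fv mulN1r subrr.
have w0 : w != 0.
  rewrite subr_eq0; apply/eqP => vv; have /x_inj // : x l1 = x l0.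
  apply/ffunP => j; have [->|ji] := eqVneq j i; last exact: xj.
  by apply: val_inj; rewrite /= -!vL vv.
have wv u : f u != 0 -> w \notin <[u]>%VS.
  move=> fu; apply/vlineP => -[a wu]; case/eqP: w0.
  move: fw; rewrite wu fZ => /eqP; rewrite mulf_eq0 (negbTE fu) orbF => /eqP->.
  by rewrite scale0r.
have f1 : 1 != 0 :> K := oner_neq0 K.
have v0 l : v l != 0 by apply: contra_neq f1 => E; rewrite -(fv l) E /f big1 // => a _; rewrite mxE mulr0.
have LE : L = (<[v l0]> + <[w]>)%VS.
  apply/esym/eqP; rewrite eqEdim subv_add -!memvE vinL memvB //=.
  by rewrite dimL dim_addv_vline // wv // fv.
have /fin_all_exists[s sP] l : exists s, v l = v l0 + s *: w.
  have := vinL l; rewrite LE => /memv_addP[_ /vlineP[a ->] [_ /vlineP[b ->] E]].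
  exists b; suff a1 : a = 1 by rewrite E a1 scale1r.
  by have := fv l; rewrite E fD fZ fv fw mulr1 mulr0 addr0.
exists (v l0), w, s; split=> [l|l|]; rewrite -?sP; [exact: vL|apply: wv|apply: wv].
  by rewrite fv.
by rewrite fv.
Qed.

End Lines.

Section DirectIff.
Context {K : closedFieldType} {k : nat} (n d : 'I_k -> nat).
Hypothesis d_gt0 : forall i, (0 < d i)%N.

Lemma line_vectors r (x : 'I_r -> multiproj K n) i : injective x -> (1 < r)%N ->
  on_line x i -> exists (V z : forall i, 'rV[K]_(n i).+1) (s : 'I_r -> K),
    [/\ forall j, j != i -> z j = 0,
        forall l, represents (fun j => V j + s l *: z j) (x l),
        forall l, z i \notin <[V i + s l *: z i]>%VS &
        z i \notin <[V i]>%VS].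
Proof.
move=> x_inj r_gt1 xi; have [u [w [s [lE wl wu]]]] := line_form x_inj r_gt1 xi.
pose l0 : 'I_r := Ordinal (ltnW r_gt1).
have [V [Vi Vj]] := vectors_with (fun j => coords (x l0 j)) u.
have [z [zi zj]] := vectors_with (fun j => 0 : 'rV[K]_(n j).+1) w.
exists V, z, s; rewrite Vi zi; split=> // l j.
have [->|ji] := eqVneq j i; last first.
  by rewrite Vj // zj // scaler0 addr0 coords_neq0 line_coords (xi.1 j ji l0 l).
rewrite Vi zi lE; split=> //.
apply/eqP => E; have := dim_line (x l i).
by rewrite -lE E dim_vline eqxx.
Qed.

Lemma tangent_direct_iff r (x : 'I_r -> multiproj K n) : 'I_k -> injective x ->
  (forall i, (r <= SV_bound (d i))%N) -> (1 < r)%N ->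
  (#|[pred i | d i == 1%N]| <= 1)%N ->
  directv (\sum_l tangent_space (SV K n d) (SV_map d (x l))) <->
  forall i, SV_bound (d i) = r -> ~ on_line x i.
Proof.
move=> i0 x_inj r_le r_gt1 d_eq1; split=> [dir i ri xi|not_line].
  have [V [z [s [zj vx zv _]]]] := line_vectors x_inj r_gt1 xi.
  apply/negP: dir; apply: (tangent_dependent d_gt0 vx zj (fun _ _ => erefl) zv).
  (* From r = ceil((d i + 2) / 2) follows 2 r >= d i + 2, one more than the dimension of the span of
     the curve. *)
  have := odd_double_half (d i + 2); have := uphalf_half (d i + 2).
  by rewrite -[uphalf _]/(SV_bound (d i)) ri -mul2n; case: (odd _) => /=; lia.
apply: (tangent_independent d_gt0 (fun l => represents_coords (x l)) i0) => l i1.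
exact: (@double_cover K k n d d_gt0 r x (fun l i => coords (x l i)) x_inj
  (fun l => represents_coords (x l)) r_le r_gt1 d_eq1 not_line l i1).
Qed.

End DirectIff.

(** * The dimension of the variety *)

Lemma irreducible_chain_le (T : topologicalType) (Z : set T) m m' C :
  (m' <= m)%N -> irreducible_chain Z m C -> irreducible_chain Z m' C.
Proof.
move=> mm [irr sub]; split=> i im; first by apply: irr; exact: leq_trans mm.
by apply: sub; exact: leq_trans mm.
Qed.

(** The dimension chosen by [krull_dim] is the only one, because chains can be truncated. *)
Lemma has_dim_krull (T : topologicalType) (Z : set T) m : has_dim Z m -> krull_dim Z = m.
Proof.
move=> Zm; have [C' nC'] : has_dim Z (krull_dim Z) := @xgetPex _ 0%N [set m | has_dim Z m] (ex_intro _ m Zm).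
have [C nC] := Zm; apply/eqP; rewrite eqn_leq; apply/andP; split; rewrite leqNgt; apply/negP => lt.
  by apply: nC; have [B cB] := C'; exists B; exact: irreducible_chain_le cB.
by apply: nC'; have [B cB] := C; exists B; exact: irreducible_chain_le cB.
Qed.

Section Charts.
Context {K : closedFieldType} {k : nat} (n d : 'I_k -> nat).
Hypothesis d_gt0 : forall i, (0 < d i)%N.
Local Notation N := (SV_N n d).
Local Notation vectors := (forall i, 'rV[K]_(n i).+1).
Local Notation X := (SV K n d).
Local Notation Q := {i : 'I_k & 'I_(n i)}.
Implicit Types (v z : vectors) (y : Q -> K) (q : Q).

Definition piv i : 'I_(n i).+1 := ord0.
Definition qvar q : 'I_(n (tag q)).+1 := lift ord0 (tagged q).

Lemma qvar_neq q : qvar q != piv (tag q). Proof. by []. Qed.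

Lemma SV_pivotE v (J : 'I_N.+1) : (forall j c, expo J j c = pivot_exp d piv j c) ->
  SV_vector d v 0 J = \prod_j v j 0 ord0 ^+ d j.
Proof.
move=> JE; rewrite SV_vectorE; apply: eq_bigr => j _; rewrite (bigD1 ord0) //= JE.
rewrite /pivot_exp eqxx big1 ?mulr1 // => c c0.
by rewrite JE /pivot_exp (negbTE c0).
Qed.

Lemma SV_nearE v q (J : 'I_N.+1) :
  (forall j c, expo J j c = near_exp d piv (qvar q) j c) ->
  SV_vector d v 0 J = v (tag q) 0 (qvar q) *
    (v (tag q) 0 ord0 ^+ (d (tag q)).-1 * \prod_(j | j != tag q) v j 0 ord0 ^+ d j).
Proof.
move=> JE; rewrite SV_vectorE /SVm (bigD1 (tag q)) //= mulrA; congr (_ * _).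
  rewrite (bigD1 (qvar q)) //= JE near_expE ?qvar_neq // eqxx expr1; congr (_ * _).
  rewrite (bigD1 ord0) //= JE near_expE ?qvar_neq // eq_Tagged /= eqxx big1 ?mulr1 //.
  move=> c /andP[cq c0]; rewrite JE near_expE ?qvar_neq // !eq_Tagged /=.
  by rewrite (negbTE cq) (negbTE c0).
apply: eq_bigr => j jq; rewrite (bigD1 ord0) //= JE near_expE ?qvar_neq //.
have tF c b : (tgt (c : 'I_(n j).+1) == tgt (b : 'I_(n (tag q)).+1)) = false.
  by apply/eqP => /(congr1 tag)/= E; rewrite E eqxx in jq.
rewrite !tF eqxx big1 ?mulr1 // => c c0.
by rewrite JE near_expE ?qvar_neq // !tF (negbTE c0).
Qed.

(** On the chart the monomial J0 is 1 and J1 q is the parameter q ([SV_chart0], [SV_chart1]): their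
    ratio reads the parameters off a point whatever its homogeneous coordinates. *)
Lemma chart_coords : exists J0 : 'I_N.+1, exists J1 : Q -> 'I_N.+1,
  (forall j c, expo J0 j c = pivot_exp d piv j c) /\
  (forall q j c, expo (J1 q) j c = near_exp d piv (qvar q) j c).
Proof.
have [J0 J0E] := expo_ex (pivot_exp_sum d piv).
have /fin_all_exists[J1 J1E] q : exists J : 'I_N.+1, forall j c,
    expo J j c = near_exp d piv (qvar q) j c.
  by apply: expo_ex; exact: near_exp_sum.
by exists J0, J1.
Qed.

Definition chart_vector y : vectors := fun i =>
  \row_c (if unlift ord0 c is Some b then y (Tagged (fun i => 'I_(n i)) b) else 1).

Lemma chart_vector0 y i : chart_vector y i 0 ord0 = 1.
Proof. by rewrite mxE unlift_none. Qed.

Lemma chart_vector_q y q : chart_vector y (tag q) 0 (qvar q) = y q.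
Proof. by rewrite mxE /qvar liftK; case: q. Qed.

Lemma chart_vector_neq0 y i : chart_vector y i != 0.
Proof. by apply/rV0Pn; exists ord0; rewrite chart_vector0 oner_neq0. Qed.

Definition chart_point y : multiproj K n := [ffun i => proj_point (chart_vector_neq0 y i)].

Lemma chart_represents y : represents (chart_vector y) (chart_point y).
Proof. by move=> i; rewrite ffunE chart_vector_neq0. Qed.

Lemma chart_of v : (forall i, v i 0 ord0 != 0) ->
  represents v (chart_point (fun q => v (tag q) 0 (qvar q) / v (tag q) 0 ord0)).
Proof.
move=> v0 i; split; first by apply/rV0Pn; exists ord0.
rewrite -(chart_represents _ i).2; set y := fun q => _.
have -> : v i = v i 0 ord0 *: chart_vector y i.
  apply/rowP => c; rewrite !mxE; case: (unliftP ord0 c) => [b ->|->]; last by rewrite mulr1.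
  by rewrite /y /= mulrC divfK.
apply/eqP; rewrite eqEdim -memvE memvZ ?memv_line //=.
by rewrite !dim_vline scaler_eq0 (negbTE (v0 i)) chart_vector_neq0.
Qed.

Lemma SV_chart0 y J : (forall j c, expo J j c = pivot_exp d piv j c) ->
  SV_vector d (chart_vector y) 0 J = 1.
Proof. by move/SV_pivotE->; rewrite big1 // => j _; rewrite chart_vector0 expr1n. Qed.

Lemma SV_chart1 y q J : (forall j c, expo J j c = near_exp d piv (qvar q) j c) ->
  SV_vector d (chart_vector y) 0 J = y q.
Proof.
move/SV_nearE->; rewrite chart_vector_q chart_vector0 expr1n mul1r big1 ?mulr1 //.
by move=> j _; rewrite chart_vector0 expr1n.
Qed.

Lemma SV_polyfun (I : finType) D (V : (I -> K) -> vectors) :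
  (forall i a, polyfun D (fun t => V t i 0 a)) ->
  forall J, polyfun ((\sum_i d i) * D) (fun t => SV_vector d (V t) 0 J).
Proof.
move=> VD J; apply: (polyfun_ext (fun t => esym (SV_vectorE (V t) J))).
have -> : ((\sum_i d i) * D = \sum_i \sum_(a < (n i).+1) expo J i a * D)%N.
  rewrite big_distrl; apply: eq_bigr => i _ /=.
  by rewrite -(expo_sum J i) big_distrl.
apply: polyfun_prod => i _; apply: polyfun_prod => a _.
exact: polyfunX.
Qed.

Lemma chart_polyfun i a : polyfun 1 (fun y => chart_vector y i 0 a).
Proof.
case: (unliftP ord0 a) => [b ->|->].
  apply: polyfun_ext (polyfun_var (Tagged (fun i => 'I_(n i)) b)) => y.
  by rewrite mxE liftK.
by apply: polyfun_ext (polyfunC 1 1) => y; rewrite chart_vector0.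
Qed.

Lemma SV_chart_param :
  parametrization (@pform K N) (fun y => SV_map d (chart_point y)) setT.
Proof.
split; first by exists 0%N, (fun=> 1); split=> [|y]; [exact: polyfunC|rewrite oner_neq0].
have /choice[u uP] : forall y, exists c, c != 0 /\
    SV_vector d (chart_vector y) = c *: coords (SV_map d (chart_point y)).
  by move=> y; have [c ? ?] := SV_vector_scale d (chart_represents y); exists c.
exists (\sum_i d i)%N, u; split=> [y _|e f [F hF fF]]; first by case: (uP y).
exists (fun y => F.@[fun j => SV_vector d (chart_vector y) 0 j]) => [|y _].
  rewrite mulnC; apply: (polyfun_meval (G := fun j y => SV_vector d (chart_vector y) 0 j)).
    by move=> j; rewrite -[X in polyfun X]muln1; apply: SV_polyfun; exact: chart_polyfun.
  by move=> m mF; have /dhomogP/(_ m mF)/= <- := hF.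
by rewrite fF -(pvalue_scale hF (uP y).2).
Qed.

(** Adding t to the first coordinate in every factor brings any point into the chart for almost all
    t; a form that vanishes on the chart then vanishes at t = 0 as well. *)
Lemma SV_chart_dense : X `<=` closure ((fun y => SV_map d (chart_point y)) @` setT).
Proof.
move=> _ [x _ <-]; apply: contrapT => ncl; set A := _ @` _ in ncl.
have [e [f [[F hF fF] f0 fx]]] := form_sep pform_system (@closed_closure _ A) ncl.
pose v i := coords (x i); pose z : vectors := fun i => delta_mx 0 ord0.
have [q qE] := meval_horner F (fun J => SVm (d := d) (curve v z) J).
have vt t i c : (curve v z (i := i) c).[t] = (v i + t *: z i) 0 c.
  by rewrite hornerD hornerC hornerZ hornerX mulrC !mxE.
have qt t : q.[t] = F.@[fun J => SV_vector d (fun i => v i + t *: z i) 0 J].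
  rewrite qE; apply: meval_eq => J; rewrite SVm_horner SV_vectorE.
  by apply: eq_bigr => i _; apply: eq_bigr => c _; rewrite vt.
have q0 : q != 0.
  have vx0 : represents (fun i => v i + 0 *: z i) x.
    by move=> i; rewrite scale0r addr0; exact: represents_coords.
  apply: (@horner_neq0 _ _ 0); rewrite qt; have [c c0 E] := SV_vector_scale d vx0.
  by rewrite (pvalue_scale hF E) mulf_neq0 ?expf_neq0 // -fF.
have g0 : \prod_i curve v z (i := i) ord0 != 0.
  apply/prodf_neq0 => i _; rewrite /curve mxE !eqxx scale1r addrC -size_poly_eq0.
  by rewrite size_XaddC.
have [t] := poly_nonroot (mulf_neq0 q0 g0); rewrite hornerM mulf_eq0 negb_or horner_prod.
move=> /andP[qt0 /prodf_neq0 gt]; case/eqP: qt0.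
have vt0 i : (v i + t *: z i) 0 ord0 != 0 by rewrite -vt gt.
have [c c0 E] := SV_vector_scale d (chart_of vt0).
rewrite qt (pvalue_scale hF E) -fF f0 ?mulr0 //; apply: subset_closure.
by eexists.
Qed.

Lemma has_dim_SV : has_dim X (\sum_i n i)%N.
Proof.
have <- : #|{: Q}| = (\sum_i n i)%N.
  by rewrite card_tagged sumnE big_map big_enum; apply: eq_bigr => i _; rewrite card_ord.
have [J0 [J1 [J0E J1E]]] := chart_coords.
apply: (param_has_dim pform_system SV_chart_param (x0 := fun=> 0)) => //; last 2 first.
- by move=> _ [y _ <-]; exists (chart_point y).
- exact: SV_chart_dense.
move=> q; exists [set p | pvalue 'X_(J1 q) p = 0]; split.
- by apply: (@closed_zeros _ _ 1); rewrite dhomogX; apply/eqP; exact: mdeg1.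
- move=> y _ yq /=; have [c c0 E] := SV_vector_scale d (chart_represents y).
  apply: (mulfI c0); rewrite /pvalue mevalXU mulr0; have := SV_chart1 y (J1E q).
  by rewrite E mxE yq.
- exists 1; split=> // /=; have [c c0 E] := SV_vector_scale d (chart_represents (upd (fun=> 0) q 1)).
  have := SV_chart1 (upd (fun=> 0) q 1) (J1E q); rewrite E mxE /upd eqxx /pvalue mevalXU => + p0.
  by rewrite p0 mulr0 => /eqP; rewrite eq_sym oner_eq0.
Qed.

Lemma krull_dim_SV : krull_dim X = (\sum_i n i)%N.
Proof. exact: has_dim_krull has_dim_SV. Qed.

Lemma dim_tangent_SV x : \dim (tangent_space X (SV_map d x)) = (\sum_i n i).+1.
Proof.
have /fin_all_exists[a va] i : exists b, coords (x i) 0 b != 0.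
  by apply/rV0Pn; exact: coords_neq0.
exact: (dim_tangent d_gt0 (represents_coords x) va).
Qed.

Lemma smooth_points_SV : smooth_points X = X.
Proof.
apply/seteqP; split=> [p []//|_ [x _ <-]]; split; first by exists x.
by rewrite /pdim dim_tangent_SV krull_dim_SV -addn1 PoszD addrK.
Qed.

End Charts.

(** * The families of collinear configurations *)

Section SumLines.
Context {K : fieldType} {m : nat}.

Lemma pspan_sub (A : {fset projspace K m}) (U : {vspace 'rV[K]_m.+1}) :
  reflect (forall p, p \in A -> (line p <= U)%VS) (pspan A <= U)%VS.
Proof.
apply: (iffP idP) => [AU p pA|AU]; last first.
  rewrite /pspan big_seq; elim/big_ind: _ => [|V W VU WU|p /AU//]; first exact: sub0v.
  by rewrite subv_add VU.
apply: subv_trans AU; rewrite /pspan (big_rem p) //=; exact: addvSl.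
Qed.

End SumLines.

Section Enumerations.
Context {T : choiceType} {r : nat}.

Lemma conf_of_tuple (t : r.-tuple T) : uniq t -> exists A : conf T r, conf_fset A =i t.
Proof.
move=> ut; have cA : #|` [fset p in (t : seq T)]%fset| == r.
  by rewrite card_fseq undup_id // size_tuple.
by exists (Conf cA) => p; rewrite /= inE.
Qed.

Lemma conf_uniq (A : conf T r) (t : r.-tuple T) : conf_fset A =i t -> uniq t.
Proof.
move=> At; apply: (@leq_size_uniq _ (conf_fset A)); first exact: fset_uniq.
  by move=> p; rewrite At.
by rewrite size_tuple; have /eqP-> := card_conf A.
Qed.

End Enumerations.

Section Configurations.
Context {K : closedFieldType} {k : nat} (n d : 'I_k -> nat) (r : nat).
Local Notation N := (SV_N n d).
Local Notation X := (SV K n d).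
Local Notation cnf := (conf (projspace K N) r).
Implicit Types (x : 'I_r -> multiproj K n) (B : cnf).

Definition SV_tuple x : r.-tuple (projspace K N) := [tuple SV_map d (x l) | l < r].

Lemma SV_tuple_inj x B : enumerates (SV_tuple x) B -> injective x.
Proof.
by move=> [/tuple_uniqP ut _] l l' xx; apply: ut; rewrite !tnth_mktuple xx.
Qed.

Lemma conf_in_SV B : conf_in X B -> exists x, enumerates (SV_tuple x) B.
Proof.
move=> BX; have [t [ut tB]] := enumerates_ex B.
have /fin_all_exists[x xt] l : exists y, SV_map d y = tnth t l.
  have [|y _ <-] := BX (tnth t l); last by exists y.
  by rewrite tB mem_tnth.
exists x; suff -> : SV_tuple x = t by [].
by apply: eq_from_tnth => l; rewrite tnth_mktuple.
Qed.

Lemma enumerates_in_SV x B : enumerates (SV_tuple x) B -> conf_in X B.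
Proof.
move=> [_ xB] p; rewrite xB => /tnthP[l ->]; rewrite tnth_mktuple.
by exists (x l).
Qed.

Lemma SV_confP (i : 'I_k) B : (0 < r)%N ->
  SV_conf d (SV_T K n r i) B <-> exists2 x, enumerates (SV_tuple x) B & on_line x i.
Proof.
move=> r_gt0; split=> [[S [dimS Sj] BS]|[x xB [xj dimx]]].
  pose t : r.-tuple (multiproj K n) := Tuple (card_conf S).
  have BT : conf_fset B =i SV_tuple (tnth t).
    move=> p; rewrite BS; apply/imfsetP/tnthP => /=.
      move=> [y yS ->]; have /tnthP[l ->] : y \in t by [].
      by exists l; rewrite tnth_mktuple.
    move=> [l ->]; rewrite tnth_mktuple; exists (tnth t l) => //.
    exact: (mem_tnth l t).
  exists (tnth t); first by split=> //; exact: conf_uniq BT.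
  have inS l : tnth t l \in conf_fset S by exact: (mem_tnth l t).
  split=> [j ji l l'|].
    have [p pE] := Sj j ji.
    have pP l1 : tnth t l1 j = p.
      apply/eqP; rewrite -in_fset1 -pE; apply/imfsetP => /=.
      by exists (tnth t l1).
    by rewrite !pP.
  have -> : (\sum_l line (tnth t l i) = pspan (proj_set S i))%VS.
    apply/eqP; rewrite eqEsubv; apply/andP; split.
      apply/subv_sumP => l _; apply: (elimT (pspan_sub _ _)) (subvv _) _ _.
      by apply/imfsetP; exists (tnth t l).
    apply/pspan_sub => p /imfsetP[y /= yS ->].
    have /tnthP[l ->] : y \in t by [].
    exact: (sumv_sup l).
  by move: dimS; rewrite /pdim; lia.
have x_inj := SV_tuple_inj xB.
have ut : uniq [tuple x l | l < r] by rewrite map_inj_uniq ?enum_uniq.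
have [S St] := conf_of_tuple ut.
have xS l : x l \in conf_fset S by rewrite St -[x l](tnth_mktuple x) mem_tnth.
have Sx y : y \in conf_fset S -> exists l, y = x l.
  by rewrite St => /tnthP[l ->]; exists l; rewrite tnth_mktuple.
exists S; last first.
  apply/fsetP => p; rewrite xB.2; apply/tnthP/imfsetP => /=.
    by move=> [l ->]; rewrite tnth_mktuple; exists (x l).
  by move=> [y /Sx[l ->] ->]; exists l; rewrite tnth_mktuple.
split=> [|j ji].
  have -> : (pspan (proj_set S i) = \sum_l line (x l i))%VS.
    apply/eqP; rewrite eqEsubv; apply/andP; split.
      by apply/pspan_sub => p /imfsetP[y /= /Sx[l ->] ->]; exact: (sumv_sup l).
    apply/subv_sumP => l _; apply: (elimT (pspan_sub _ _)) (subvv _) _ _.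
    by apply/imfsetP; exists (x l).
  by rewrite /pdim dimx.
pose l0 := Ordinal r_gt0; exists (x l0 j); apply/fsetP => p; rewrite in_fset1.
apply/imfsetP/eqP => /= [[y /Sx[l ->] ->]|->]; first exact: xj.
by exists (x l0).
Qed.

End Configurations.

Lemma fresh_element (K : closedFieldType) (s : seq K) : exists a, a \notin s.
Proof.
have /poly_nonroot[a] : \prod_(b <- s) ('X - b%:P) != 0.
  by rewrite prodf_seq_neq0; apply/allP => b _; rewrite polyXsubC_eq0.
rewrite horner_prod prodf_seq_neq0 => /allP sa; exists a; apply/negP => /sa.
by rewrite !hornerE subrr eqxx.
Qed.

Lemma fresh_family (K : closedFieldType) r : exists c : 'I_r -> K, injective c.
Proof.
have [s us ss] : exists2 s : seq K, uniq s & size s = r.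
  elim: r => [|r [s us ss]]; first by exists [::].
  by have [a sa] := fresh_element s; exists (a :: s); rewrite /= ?sa ?us ?ss.
exists (fun l => nth 0 s l) => l l' /eqP; rewrite nth_uniq ?ss ?ltn_ord // => /eqP.
exact: val_inj.
Qed.

(** * Closed conditions on configurations *)

Section ClosedConfigurations.
Context {K : closedFieldType} {N r : nat}.
Local Notation cnf := (conf (projspace K N) r).
Implicit Types (A : cnf) (p : projspace K N).

(** The product of the same linear equation over all points vanishes when one of them satisfies
    it. *)
Lemma closed_ex_coords (J J' : 'I_N.+1) (c : K) :
  closed [set A : cnf | exists2 p, p \in conf_fset A & coords p 0 J = c * coords p 0 J'].
Proof.
pose F : {mpoly K[r * N.+1]} :=
  \prod_(l < r) ('X_(mxvec_index l J) + (- c) *: 'X_(mxvec_index l J')).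
have hF : multihomogeneous (fun i => \sum_(l < r) (i == l : nat))%N F.
  apply: multihomog_prod => l _; apply: multihomogD; first exact: multihomog_var.
  by apply: multihomogZ; exact: multihomog_var.
apply: closed_conf (closed_pwzeros hF) _ => t A [ut tA] /=.
rewrite /pwvalue rmorph_prod; split=> [[p]|].
  rewrite tA => /tnthP[l ->] E; rewrite (bigD1 l) //= mevalD mevalZ !mevalXU !mxvecE !mxE.
  by rewrite E mulNr subrr mul0r.
move=> /eqP; rewrite prodf_seq_eq0 => /hasP[l _ /=].
rewrite mevalD mevalZ !mevalXU !mxvecE !mxE mulNr subr_eq0 => /eqP E.
by exists (tnth t l) => //; rewrite tA mem_tnth.
Qed.

(** One equation per ordered pair of points; cross-multiplication expresses that a ratio of
    coordinates is constant on the configuration. *)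
Lemma closed_pair_coords (J J' : 'I_N.+1) :
  closed [set A : cnf | forall p p', p \in conf_fset A -> p' \in conf_fset A ->
    coords p 0 J * coords p' 0 J' = coords p' 0 J * coords p 0 J'].
Proof.
pose F (l : 'I_r * 'I_r) : {mpoly K[r * N.+1]} :=
  'X_(mxvec_index l.1 J) * 'X_(mxvec_index l.2 J') +
  (-1) *: ('X_(mxvec_index l.2 J) * 'X_(mxvec_index l.1 J')).
have FE l (t : proj_power K N r) : (pwvalue (F l) t = 0) <->
    (coords (tnth t l.1) 0 J * coords (tnth t l.2) 0 J' =
     coords (tnth t l.2) 0 J * coords (tnth t l.1) 0 J').
  rewrite /pwvalue /F mevalD mevalZ !mevalM !mevalXU !mxvecE !mxE mulN1r.
  by split=> [/eqP|->]; rewrite ?subrr // subr_eq0 => /eqP.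
have cF : closed (\bigcap_(l in [set: 'I_r * 'I_r])
    [set t : proj_power K N r | pwvalue (F l) t = 0]).
  apply: closed_bigI => l _.
  apply: (@closed_pwzeros _ _ _ (fun i => (i == l.1) + (i == l.2))%N).
  apply: multihomogD; first by apply: multihomogM; exact: multihomog_var.
  apply: multihomogZ; apply: (multihomog_ext (fun i => addnC _ _)).
  by apply: multihomogM; exact: multihomog_var.
apply: closed_conf cF _ => t A [ut tA]; split=> [tJ l _ /=|tJ p p'].
  by apply/FE; apply: tJ; rewrite tA mem_tnth.
rewrite !tA => /tnthP[l ->] /tnthP[l' ->].
exact: (FE (l, l') t).1 (tJ (l, l') I).
Qed.

End ClosedConfigurations.

(** * Affine parameters for a family of collinear configurations *)

Section LineParameters.
Context {K : closedFieldType} {k : nat} (n d : 'I_k -> nat) (r : nat) (i0 : 'I_k).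
Hypotheses (d_gt0 : forall i, (0 < d i)%N) (n_gt0 : (0 < n i0)%N) (r_gt1 : (1 < r)%N).
Local Notation N := (SV_N n d).
Local Notation vectors := (forall i, 'rV[K]_(n i).+1).
Local Notation X := (SV K n d).
Local Notation cnf := (conf (projspace K N) r).
Local Notation Q := {i : 'I_k & 'I_(n i)}.

Definition orig : Q := Tagged (fun i => 'I_(n i)) (Ordinal n_gt0).

(* A line of the i0-th factor transverse to the chart is parametrized by the
   coordinate orig; the other coordinates are affine functions of it, with
   constant terms in the first summand and slopes in the second. The values of
   the coordinate orig at the r points are the parameters of the third summand. *)
Definition lparam : finType :=
  ({q : Q | q != orig} + {q : Q | (tag q == i0) && (q != orig)} + 'I_r)%type.

Implicit Types (y : lparam -> K).

Definition const_term y q : K := oapp (fun z => y (inl (inl z))) 0 (insub q).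
(** The default 0 keeps the coordinates of the other factors constant along the line. *)
Definition slope y q : K := oapp (fun z => y (inl (inr z))) 0 (insub q).

Definition lpoint y (l : 'I_r) q : K :=
  if q == orig then y (inr l) else const_term y q + slope y q * y (inr l).

Definition lconf y l : multiproj K n := chart_point (lpoint y l).

Definition ldom y := injective (fun l => y (inr l)).

Lemma chart_point_coords (J0 : 'I_N.+1) (J1 : Q -> 'I_N.+1) (a : Q -> K) :
  (forall j c, expo J0 j c = pivot_exp d (@piv _ n) j c) ->
  (forall q j c, expo (J1 q) j c = near_exp d (@piv _ n) (qvar q) j c) ->
  let p := coords (SV_map d (chart_point a)) in
  p 0 J0 != 0 /\ forall q, p 0 (J1 q) = a q * p 0 J0.
Proof.
move=> J0E J1E p; have [c c0 E] := SV_vector_scale d (chart_represents a).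
have p0 : c * p 0 J0 = 1 by rewrite -(SV_chart0 a J0E) E mxE.
split=> [|q]; first by apply: contra_eqN p0 => /eqP->; rewrite mulr0 eq_sym oner_neq0.
apply: (mulfI c0); rewrite mulrCA p0 mulr1 -(SV_chart1 a (J1E q)) E mxE.
by [].
Qed.

Lemma lpoint_enum y : ldom y -> exists A : cnf, enumerates (SV_tuple d (lconf y)) A.
Proof.
move=> yI; have [J0 [J1 [J0E J1E]]] := @chart_coords k n d d_gt0.
have ut : uniq (SV_tuple d (lconf y)).
  apply/tuple_uniqP => l l'; rewrite !tnth_mktuple => E; apply: yI.
  have [p0 p1] := chart_point_coords (lpoint y l) J0E J1E.
  have [p0' p1'] := chart_point_coords (lpoint y l') J0E J1E.
  have := p1 orig; rewrite [in LHS]E p1' -E => /(mulIf p0).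
  by rewrite /lpoint eqxx => ->.
by have [A At] := conf_of_tuple ut; exists A.
Qed.

Lemma const_term_polyfun q : polyfun 1 (fun y => const_term y q).
Proof. by rewrite /const_term; case: insub => [z|] /=; [exact: polyfun_var|exact: polyfunC]. Qed.

Lemma slope_polyfun q : polyfun 1 (fun y => slope y q).
Proof. by rewrite /slope; case: insub => [z|] /=; [exact: polyfun_var|exact: polyfunC]. Qed.

Lemma lpoint_polyfun l q : polyfun 2 (fun y => lpoint y l q).
Proof.
rewrite /lpoint; case: eqP => _; first by apply: polyfunW (polyfun_var _).
apply: polyfunD; first by apply: polyfunW (const_term_polyfun q).
exact: (polyfunM (slope_polyfun q) (polyfun_var (inr l))).
Qed.

Lemma lpoint_chart_polyfun l i a : polyfun 2 (fun y => chart_vector (lpoint y l) i 0 a).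
Proof.
case: (unliftP ord0 a) => [b ->|->].
  apply: polyfun_ext (lpoint_polyfun l (Tagged (fun i => 'I_(n i)) b)) => y.
  by rewrite mxE liftK.
by apply: polyfun_ext (polyfunC 2 1) => y; rewrite chart_vector0.
Qed.

Lemma ldom_polyfun : exists D g, polyfun D g /\ forall y, ldom y <-> g y != 0.
Proof.
exists (\sum_(l < r) \sum_(l' < r | l' != l) 1)%N,
  (fun y => \prod_(l < r) \prod_(l' < r | l' != l) (y (inr l) + (-1) * y (inr l'))).
split=> [|y].
  apply: polyfun_prod => l _; apply: polyfun_prod => l' _.
  by apply: polyfunD; [exact: polyfun_var|apply: polyfunZ; exact: polyfun_var].
split=> [yI|/prodf_neq0 y0 l l' E].
  apply/prodf_neq0 => l _; apply/prodf_neq0 => l' l'l; rewrite mulN1r subr_eq0.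
  by apply: contra l'l => /eqP/yI->.
apply/eqP/negPn/negP => ll'; have /prodf_neq0/(_ l') := y0 l isT.
by rewrite eq_sym ll' mulN1r subr_eq0 E eqxx => /(_ isT).
Qed.

Variable A0 : cnf.
(** A0 is the value outside [ldom], where two of the points coincide. *)
Definition lmap y : cnf := xget A0 [set A | enumerates (SV_tuple d (lconf y)) A].

Lemma lmapP y : ldom y -> enumerates (SV_tuple d (lconf y)) (lmap y).
Proof. by move=> /lpoint_enum[A yA]; exact: (@xgetPex _ A0 [set A | enumerates _ A]) (ex_intro _ A yA). Qed.

Lemma pwvalue_SV e (F : {mpoly K[r * N.+1]}) (x : 'I_r -> multiproj K n) (v : 'I_r -> vectors)
    (c : 'I_r -> K) : multihomogeneous (fun=> e) F ->
  (forall l, SV_vector d (v l) = c l *: coords (SV_map d (x l))) ->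
  F.@[fun a => mxvec (\matrix_(l, J) SV_vector d (v l) 0 J) 0 a] =
  (\prod_l c l) ^+ e * pwvalue F (SV_tuple d x).
Proof.
move=> hF vE; rewrite (pwvalue_scale (t := SV_tuple d x) (c := c) hF) ?prodrXl // => l J.
by rewrite mxE vE tnth_mktuple mxE.
Qed.

Lemma lmap_param : parametrization (@cform K N r) lmap ldom.
Proof.
split; first exact: ldom_polyfun.
have /choice[u uP] : forall y, exists c : 'I_r -> K, forall l, c l != 0 /\
    SV_vector d (chart_vector (lpoint y l)) = c l *: coords (SV_map d (lconf y l)).
  move=> y; have /fin_all_exists[c cP] l : exists c, c != 0 /\
      SV_vector d (chart_vector (lpoint y l)) = c *: coords (SV_map d (lconf y l)).
    by have [c ? ?] := SV_vector_scale d (chart_represents (lpoint y l)); exists c.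
  by exists c.
(* The factor 2 is the degree of a slope times a parameter; the factor r is there because a form of
   degree e has degree e in each of the r blocks. *)
exists (r * ((\sum_i d i) * 2))%N, (fun y => \prod_l u y l).
split=> [y _|e f [F hF fF]]; first by apply/prodf_neq0 => l _; case: (uP y l).
exists (fun y => F.@[fun a => mxvec (\matrix_(l, J)
    SV_vector d (chart_vector (lpoint y l)) 0 J) 0 a]); last first.
  move=> y /lmapP yA; rewrite (fF _ _ yA); apply: pwvalue_SV hF _ => l.
  by case: (uP y l).
rewrite mulnAC; apply: (polyfun_meval (G := fun a y => mxvec (\matrix_(l, J)
    SV_vector d (chart_vector (lpoint y l)) 0 J) 0 a)) => [a|m mF].
  case/mxvec_indexP: a => l J.
  apply: polyfun_ext (SV_polyfun (lpoint_chart_polyfun l) J) => y.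
  by rewrite mxvecE [RHS]mxE.
rewrite mdegE big_mxvec (eq_bigr (fun=> e)) => [|l _]; last exact: hF.
by rewrite sum_nat_const card_ord.
Qed.

Lemma insubP_eq (P : pred Q) (T : Type) (f : {q | P q} -> T) t q (Pq : P q) :
  oapp f t (insub q) = f (exist _ q Pq).
Proof. by rewrite (insubT P Pq). Qed.

Lemma slope_other y q : tag q != i0 -> slope y q = 0.
Proof. by move=> qi; rewrite /slope insubF // (negbTE qi). Qed.

Lemma slope0 y q : (forall z, y (inl (inr z)) = 0) -> slope y q = 0.
Proof. by move=> y0; rewrite /slope; case: insub => [z|] /=. Qed.

Lemma const_term0 y q : (forall z, y (inl (inl z)) = 0) -> const_term y q = 0.
Proof. by move=> y0; rewrite /const_term; case: insub => [z|] /=. Qed.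

Lemma lpoint_other y l q : tag q != i0 -> lpoint y l q = const_term y q.
Proof.
move=> qi; rewrite /lpoint slope_other // mul0r addr0 ifF //.
by apply: contraNF qi => /eqP->.
Qed.

Lemma lmap_on_line y : ldom y -> SV_conf d (SV_T K n r i0) (lmap y).
Proof.
move=> yI; have yA := lmapP yI; apply/(@SV_confP K k n d r i0 _ (ltnW r_gt1)); exists (lconf y) => //.
have x_inj := SV_tuple_inj yA.
have xj j : j != i0 -> forall l l', lconf y l j = lconf y l' j.
  move=> ji l l'; apply: val_inj => /=.
  rewrite -(chart_represents _ j).2 -(chart_represents (lpoint y l') j).2; congr <[_]>%VS.
  apply/rowP => c; rewrite !mxE; case: unlift => [b|] //.
  by rewrite !lpoint_other.
split=> //.
pose A : 'rV[K]_(n i0).+1 :=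
  chart_vector (fun q => if q == orig then 0 else const_term y q) i0.
pose B : 'rV[K]_(n i0).+1 := \row_c (if unlift ord0 c is Some b then
  let q : Q := Tagged (fun i => 'I_(n i)) b in if q == orig then 1 else slope y q else 0).
have vE l : chart_vector (lpoint y l) i0 = A + y (inr l) *: B.
  apply/rowP => c; rewrite !mxE; case: unlift => [b|]; last by rewrite mulr0 addr0.
  by rewrite /lpoint; case: ifP => _; rewrite ?mulr1 ?add0r // mulrC.
pose l0 : 'I_r := Ordinal (ltnW r_gt1); pose l1 : 'I_r := Ordinal r_gt1.
have xl : lconf y l1 i0 != lconf y l0 i0.
  apply/eqP => E; have /x_inj// : lconf y l1 = lconf y l0.
  by apply/ffunP => j; have [->//|ji] := eqVneq j i0; exact: xj.
have vx l : represents (chart_vector (lpoint y l)) (lconf y l) by exact: chart_represents.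
have v1 := neq_notin vx xl.
apply/eqP; rewrite eqn_leq; apply/andP; split.
  apply: (@leq_trans (\dim (<[A]> + <[B]>)%VS)).
    apply: dimvS; apply/subv_sumP => l _; rewrite -(vx l i0).2 vE -memvE.
    by rewrite memv_add ?memvZ ?memv_line.
  apply: leq_trans (dimv_add_leqif _ _) _; rewrite !dim_vline.
  by case: (_ != 0); case: (_ != 0).
rewrite -(dim_addv_vline (chart_vector_neq0 (lpoint y l0) i0) v1); apply: dimvS.
by rewrite subv_add !(vx _ _).2 (sumv_sup l0) ?(sumv_sup l1).
Qed.

Lemma lmap_dense : SV_conf d (SV_T K n r i0) `<=` closure (lmap @` ldom).
Proof.
move=> B /(@SV_confP K k n d r i0 _ (ltnW r_gt1))[x xB xline]; apply: contrapT => ncl.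
have [e [f [[F hF fF] f0 fB]]] := form_sep cform_system (@closed_closure _ _) ncl.
have x_inj := SV_tuple_inj xB.
have [V [z [s [zj vx zv _]]]] := line_vectors x_inj r_gt1 xline.
have s_inj : injective s.
  move=> l l' ss; apply: x_inj; apply/ffunP => j; apply: val_inj => /=.
  by rewrite -(vx l j).2 -(vx l' j).2 ss.
pose e1 := qvar orig; rewrite /= in e1.
have [E1 [E1i E1j]] := vectors_with (fun j => 0 : 'rV[K]_(n j).+1) (delta_mx 0 e1).
pose v l j := V j + s l *: z j.
(* The perturbation moves V by t e_0 in every factor and z by t E1, so the points remain on a line
   ([vtE]). For almost all t they enter the chart, and the line becomes transverse to the coordinate
   [orig]. *)
pose dz l j : 'rV[K]_(n j).+1 := delta_mx 0 ord0 + s l *: E1 j.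
pose vt t l j := v l j + t *: dz l j.
have E10 j : E1 j 0 ord0 = 0.
  by have [->|ji] := eqVneq j i0; [rewrite E1i mxE|rewrite E1j // mxE].
have vt0 t l j : vt t l j 0 ord0 = t + v l j 0 ord0.
  by rewrite /vt /dz !mxE !eqxx E10 mulr0 addr0 mulr1 addrC.
pose G (a : 'I_(r * N.+1)) := mxvec (\matrix_(l < r, J < N.+1) SVm (d := d) (curve (v l) (dz l)) J) 0 a.
have [q qE] := meval_horner F G.
have qt t : q.[t] = F.@[fun a => mxvec (\matrix_(l, J) SV_vector d (vt t l) 0 J) 0 a].
  rewrite qE; apply: meval_eq => a; case/mxvec_indexP: a => l J; rewrite /G !mxvecE ![in LHS]mxE.
  rewrite [RHS]mxE SVm_horner SV_vectorE; apply: eq_bigr => j _; apply: eq_bigr => c _.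
  rewrite /curve hornerD hornerC hornerZ hornerX /vt; congr (_ ^+ _).
  by rewrite [RHS]mxE [X in _ = _ + X]mxE mulrC.
have vtx l : represents (vt 0 l) (x l).
  by move=> j; rewrite /vt scale0r addr0; exact: vx.
have q0 : q != 0.
  have /fin_all_exists[c cP] l : exists c, c != 0 /\
      SV_vector d (vt 0 l) = c *: coords (SV_map d (x l)).
    by have [c ? ?] := SV_vector_scale d (vtx l); exists c.
  apply: (@horner_neq0 _ _ 0); rewrite qt (pwvalue_SV hF (fun l => (cP l).2)).
  rewrite -(fF _ _ xB) mulf_neq0 ?expf_neq0 //.
  by apply/prodf_neq0 => l _; case: (cP l).
pose g := \prod_l \prod_j ('X + (v l j 0 ord0)%:P).
have g0 : g != 0.
  apply/prodf_neq0 => l _; apply/prodf_neq0 => j _.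
  by rewrite -size_poly_eq0 size_XaddC.
pose V0 := V i0 0 ord0; pose V1 := V i0 0 e1; pose z0 := z i0 0 ord0; pose z1 := z i0 0 e1.
(* The determinant of the perturbed V and z in the coordinates [ord0] and [e1], monic of degree 2 in
   t. Where it is nonzero, [orig] can serve as the parameter on the line. *)
pose M := ('X + V0%:P) * ('X + z1%:P) - (V1 * z0)%:P.
have M0 : M != 0.
  apply: (@monic_neq0 _ M); rewrite /M monicE lead_coefDl.
    by rewrite lead_coefM !lead_coefXaddC mulr1.
  rewrite size_polyN (leq_ltn_trans (size_polyC_leq1 _)) // size_mul -?size_poly_eq0 ?size_XaddC //.
have [t] := poly_nonroot (mulf_neq0 q0 (mulf_neq0 g0 M0)).
rewrite !hornerM !mulf_eq0 !negb_or => /and3P[qt0 gt Mt]; case/eqP: qt0.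
have vt_neq0 l j : vt t l j 0 ord0 != 0.
  move: gt; rewrite horner_prod => /prodf_neq0/(_ l isT); rewrite horner_prod.
  by move=> /prodf_neq0/(_ j isT); rewrite !hornerE vt0.
pose Vt j : 'rV[K]_(n j).+1 := V j + t *: delta_mx 0 ord0.
pose zt j : 'rV[K]_(n j).+1 := z j + t *: E1 j.
have vtE l j : vt t l j = Vt j + s l *: zt j.
  rewrite /vt /v /dz /Vt /zt; apply/rowP => c; rewrite !mxE; ring.
have e10 : (e1 == ord0) = false by [].
have Vt0 : Vt i0 0 ord0 = V0 + t by rewrite !mxE !eqxx mulr1.
have Vt1 : Vt i0 0 e1 = V1 by rewrite !mxE e10 andbF mulr0 addr0.
have zt0 : zt i0 0 ord0 = z0 by rewrite /zt E1i !mxE andbF mulr0 addr0.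
have zt1 : zt i0 0 e1 = z1 + t by rewrite /zt E1i !mxE !eqxx mulr1.
pose m := Vt i0 0 ord0 * zt i0 0 e1 - Vt i0 0 e1 * zt i0 0 ord0.
have m0 : m != 0.
  move: Mt; rewrite /M /m Vt0 Vt1 zt0 zt1 !hornerE.
  by rewrite [t + V0]addrC [t + z1]addrC.
pose Vq (q : Q) := Vt (tag q) 0 (qvar q); pose zq (q : Q) := zt (tag q) 0 (qvar q).
(* Cramer's rule: in the factor i0 the coordinate q of V + s z is a combination of the coordinates
   [ord0] and [e1], whose coefficients become the constant term and the slope after division by the
   coordinate [ord0]. *)
pose y (i : lparam) : K := match i with
  | inl (inl p) => let q := val p in if tag q == i0
      then (Vq q * zt i0 0 e1 - Vt i0 0 e1 * zq q) / m else Vq q / Vt (tag q) 0 ord0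
  | inl (inr p) => let q := val p in (Vt i0 0 ord0 * zq q - Vq q * zt i0 0 ord0) / m
  | inr l => vt t l i0 0 e1 / vt t l i0 0 ord0
  end.
have vtc l j c : vt t l j 0 c = Vt j 0 c + s l * zt j 0 c.
  by rewrite vtE [LHS]mxE [X in _ + X]mxE.
have ztj j c : j != i0 -> zt j 0 c = 0.
  by move=> ji; rewrite /zt zj // E1j // scaler0 addr0 mxE.
have yE l : lpoint y l = fun p => vt t l (tag p) 0 (qvar p) / vt t l (tag p) 0 ord0.
  apply/funext => p; rewrite /lpoint; case: eqP => [->//|/eqP po].
  rewrite /const_term (insubP_eq _ _ po) /=.
  have [pi|pi] := eqVneq (tag p) i0; last first.
    by rewrite slope_other // mul0r addr0 !vtc !ztj // mulr0 !addr0.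
  have pb : (tag p == i0) && (p != orig) by rewrite pi eqxx.
  rewrite /slope (insubP_eq _ _ pb) /= /Vq /zq.
  have := vt_neq0 l i0; rewrite !vtc.
  case: p pi {po pb} => [i b] /= ii; subst i => v0.
  by rewrite /m in m0 *; field; rewrite m0 v0.
(* The parameter of the l-th point is the image of [s l] under a homography of determinant m. *)
have yI : ldom y.
  move=> l l' /eqP; rewrite /= eqr_div ?vt_neq0 // !vtc => /eqP E; apply: s_inj.
  apply/eqP; rewrite -subr_eq0; apply: contraTT isT => ss.
  case/eqP: (mulf_neq0 ss m0); rewrite /m.
  by apply: (etrans _ (etrans (congr1 (fun a => a - (Vt i0 0 e1 + s l' * zt i0 0 e1) *
    (Vt i0 0 ord0 + s l * zt i0 0 ord0)) E) (subrr _))); ring.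
have vtl l : represents (vt t l) (lconf y l) by rewrite /lconf yE; exact: chart_of.
have /fin_all_exists[c cP] l : exists c, c != 0 /\
    SV_vector d (vt t l) = c *: coords (SV_map d (lconf y l)).
  by have [c ? ?] := SV_vector_scale d (vtl l); exists c.
rewrite qt (pwvalue_SV hF (fun l => (cP l).2)) -(fF _ _ (lmapP yI)) f0 ?mulr0 //.
by apply: subset_closure; exists y.
Qed.

Lemma closure_lines : closure (SV_conf d (SV_T K n r i0)) = closure (lmap @` ldom).
Proof.
apply/seteqP; split=> B; last by apply: closureS => _ [y yI <-]; exact: lmap_on_line.
have clcl : closure (closure (lmap @` ldom)) = closure (lmap @` ldom).
  by apply/esym/closure_id; exact: closed_closure.
by move=> clB; rewrite -clcl; apply: closureS clB; exact: lmap_dense.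
Qed.

(** The three summands contribute (sum of the n_i) - 1, n_(i0) - 1 and r. *)
Lemma card_lparam : #|lparam| = (\sum_i n i + n i0 + r - 2)%N.
Proof.
rewrite !card_sum card_ord !card_sig.
have cQ : #|{: Q}| = (\sum_i n i)%N.
  by rewrite card_tagged sumnE big_map big_enum; apply: eq_bigr => i _; rewrite card_ord.
have Q0 : (0 < #|{: Q}|)%N by apply/card_gt0P; exists orig.
have c1 : #|[pred q : Q | q != orig]| = #|{: Q}|.-1 := cardC1 orig.
pose f (b : 'I_(n i0)) : Q := Tagged (fun i => 'I_(n i)) b.
have f_inj : injective f by move=> b b' /eqP; rewrite /f eq_Tagged => /eqP.
have c2 : #|[pred q : Q | tag q == i0]| = n i0.
  rewrite -[RHS]card_ord -(fintype.card_image f_inj); apply: eq_card => q; rewrite inE.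
  apply/eqP/fintype.imageP => [qi|[b _ ->]//].
  by case: q qi => [i b] /= ii; subst i; exists b.
have := cardD1 orig [pred q : Q | tag q == i0]; rewrite c2 inE eqxx.
rewrite (@eq_card _ _ [pred q : Q | (tag q == i0) && (q != orig)]); last first.
  by move=> q; rewrite !inE andbC.
rewrite cQ in Q0 c1; set p := #|[pred q : Q | (tag q == i0) && (q != orig)]| => E.
rewrite -[LHS]/(#|[pred q : Q | q != orig]| +
  #|[pred q : Q | (tag q == i0) && (q != orig)]| + r)%N c1.
rewrite -/p; have {}E : n i0 = (1 + p)%N := E.
rewrite E; move: (\sum_i n i)%N Q0 => s Q0; lia.
Qed.

Lemma has_dim_lines Z : SV_conf d (SV_T K n r i0) `<=` Z ->
  Z `<=` closure (SV_conf d (SV_T K n r i0)) -> has_dim Z (\sum_i n i + n i0 + r - 2)%N.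
Proof.
rewrite closure_lines -card_lparam => TZ Zcl.
have [c c_inj] := fresh_family K r.
have [J0 [J1 [J0E J1E]]] := @chart_coords k n d d_gt0.
pose y0 (i : lparam) := if i is inr l then c l else 0.
have y0dom : ldom y0 by [].
have y0upd i v : ldom (upd y0 (inl i) v).
  by move=> l l'; rewrite /upd /=; exact: c_inj.
have mem y p : ldom y -> p \in conf_fset (lmap y) -> exists l, p = SV_map d (lconf y l).
  by move=> /lmapP[_ ->] /tnthP[l ->]; exists l; rewrite tnth_mktuple.
have memP y l : ldom y -> SV_map d (lconf y l) \in conf_fset (lmap y).
  by move=> /lmapP[_ ->]; rewrite -[SV_map d _](tnth_mktuple (fun l => SV_map d (lconf y l))) mem_tnth.
have c0 y l : coords (SV_map d (lconf y l)) 0 J0 != 0.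
  by have [] := chart_point_coords (lpoint y l) J0E J1E.
have c1 y l q : coords (SV_map d (lconf y l)) 0 (J1 q) =
    lpoint y l q * coords (SV_map d (lconf y l)) 0 J0.
  by have [_] := chart_point_coords (lpoint y l) J0E J1E.
pose l0 : 'I_r := Ordinal (ltnW r_gt1); pose l1 : 'I_r := Ordinal r_gt1.
have l10 : c l1 != c l0 by apply/eqP => /c_inj.
apply: (param_has_dim cform_system lmap_param y0dom) => //; last first.
  by move=> _ [y yI <-]; apply: TZ; exact: lmap_on_line.
case=> [[[q qo]|[q qb]]|l].
- have [qi|qi] := eqVneq (tag q) i0.
    (* Without constant term, q is proportional to [orig]. With constant term 1 and slope 0 it is
       not, because [orig] takes distinct values. *)
    exists [set A : cnf | forall p p', p \in conf_fset A -> p' \in conf_fset A ->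
      coords p 0 (J1 q) * coords p' 0 (J1 orig) = coords p' 0 (J1 q) * coords p 0 (J1 orig)].
    split; first exact: closed_pair_coords.
      move=> y yI yq p p' /(mem _ _ yI)[l ->] /(mem _ _ yI)[l' ->]; rewrite !c1.
      rewrite /lpoint (negbTE qo) eqxx /const_term (insubP_eq _ _ qo) yq /= !add0r.
      by ring.
    exists 1; split=> [|H]; first exact: y0upd.
    have := H _ _ (memP _ l1 (y0upd _ _)) (memP _ l0 (y0upd _ _)); rewrite !c1.
    rewrite /lpoint (negbTE qo) eqxx /const_term !(insubP_eq _ _ qo) slope0 //.
    rewrite /upd eqxx /= mul0r addr0 !mul1r => E.
    set y1 := fun j => _ in E; case/eqP: l10.
    apply: (mulIf (mulf_neq0 (c0 y1 l1) (c0 y1 l0))); rewrite mulrCA [RHS]mulrCA E; ring.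
  exists [set A : cnf | exists2 p, p \in conf_fset A & coords p 0 (J1 q) = 0 * coords p 0 J0].
  split; first exact: closed_ex_coords.
    move=> y yI yq; exists (SV_map d (lconf y l0)); first exact: memP.
    by rewrite c1 lpoint_other // /const_term (insubP_eq _ _ qo) yq.
  exists 1; split=> [|[p /(mem _ _ (y0upd _ _))[l ->]]]; first exact: y0upd.
  rewrite c1 lpoint_other // /const_term (insubP_eq _ _ qo) /upd eqxx mul1r mul0r => /eqP.
  by rewrite (negbTE (c0 _ _)).
- have qo : q != orig by case/andP: (qb).
  (* With slope 0, the coordinate q is the same at all points. *)
  exists [set A : cnf | forall p p', p \in conf_fset A -> p' \in conf_fset A ->
    coords p 0 (J1 q) * coords p' 0 J0 = coords p' 0 (J1 q) * coords p 0 J0].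
  split; first exact: closed_pair_coords.
    move=> y yI yq p p' /(mem _ _ yI)[l ->] /(mem _ _ yI)[l' ->]; rewrite !c1.
    by rewrite /lpoint (negbTE qo) /slope (insubP_eq _ _ qb) yq /= !mul0r addr0 mulrAC.
  exists 1; split=> [|H]; first exact: y0upd.
  have := H _ _ (memP _ l1 (y0upd _ _)) (memP _ l0 (y0upd _ _)); rewrite !c1.
  rewrite /lpoint (negbTE qo) const_term0 // /slope !(insubP_eq _ _ qb).
  rewrite /upd eqxx /= !add0r !mul1r => E.
  set y1 := fun j => _ in E; case/eqP: l10.
  by apply: (mulIf (mulf_neq0 (c0 y1 l1) (c0 y1 l0))); rewrite mulrA E; ring.
(* Points are unordered, so only the presence of the value [c l] can be required; the value v that
   replaces it must then avoid all the values of c. *)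
- exists [set A : cnf | exists2 p, p \in conf_fset A &
    coords p 0 (J1 orig) = c l * coords p 0 J0].
  split; first exact: closed_ex_coords.
    move=> y yI yl; exists (SV_map d (lconf y l)); first exact: memP.
    by rewrite c1 /lpoint eqxx yl.
  have [v vc] := fresh_element (codom c).
  have vcl l' : v != c l' by apply: contraNneq vc => ->; exact: codom_f.
  have yI : ldom (upd y0 (inr l) v).
    move=> l' l''; rewrite /upd /= -![inr _ == _]/(_ == l).
    have [->|l'l] := eqVneq l' l; have [->//|l''l] := eqVneq l'' l.
    - by move=> E; case/eqP: (vcl l'').
    - by move=> /esym E; case/eqP: (vcl l').
    - exact: c_inj.
  exists v; split=> // -[p /(mem _ _ yI)[l' ->]]; rewrite c1 /lpoint eqxx => /(mulIf (c0 _ _)).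
  rewrite /upd -![inr _ == _]/(_ == l); case: eqP => [_ /eqP|/eqP l'l /c_inj/eqP].
    by rewrite (negbTE (vcl l)).
  by rewrite (negbTE l'l).
Qed.

End LineParameters.

(** * Irreducible components of the Terracini locus *)

Lemma irreducible_sub_bigU (T : topologicalType) (I : finType) (J : set I) (F : I -> set T) A :
  irreducible_set A -> (forall i, closed (F i)) -> A `<=` \bigcup_(i in J) F i ->
  exists2 i, J i & A `<=` F i.
Proof.
move=> [[a Aa] irrA] cF AF; pose G i := if `[< J i >] then F i else set0.
have cG i : closed (G i) by rewrite /G; case: asboolP => _; [exact: cF|exact: closed0].
suff /(_ (enum I)) : forall s : seq I, A `<=` \big[setU/set0]_(i <- s) G i ->
    exists2 i, J i & A `<=` F i.
  apply=> x /AF[i Ji Fix]; rewrite -bigcup_seq; exists i; first by rewrite /= mem_enum.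
  by rewrite /G; case: asboolP.
elim=> [|i s IH]; first by rewrite big_nil => /(_ a Aa).
rewrite big_cons => /irrA[||AG|/IH//]; first exact: cG.
  by apply: closed_bigsetU.
exists i; first by have := AG a Aa; rewrite /G; case: asboolP.
by move=> x /AG; rewrite /G; case: asboolP.
Qed.

Lemma closure_in_bigU (T : topologicalType) (I : finType) (J : set I) (F : I -> set T) Y :
  closure_in Y (\bigcup_(i in J) F i) = \bigcup_(i in J) closure_in Y (F i).
Proof.
apply/seteqP; split=> x [].
  move=> clx Yx; have cl : closed (\bigcup_(i in J) closure (F i)).
    apply: closed_bigcup => [|i _]; last exact: closed_closure.
    by apply: finite_finset.
  have : closure (\bigcup_(i in J) closure (F i)) x.
    by apply: closureS clx => z [i Ji Fiz]; exists i => //; exact: subset_closure.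
  by rewrite -(closure_id _).1 // => -[i Ji cli]; exists i.
move=> i Ji [clx Yx]; split=> //; apply: closureS clx => z Fiz; by exists i.
Qed.

Section SumOfTangentSpaces.
Context {K : closedFieldType} {k : nat} (n d : 'I_k -> nat) (r : nat).
Hypothesis d_gt0 : forall i, (0 < d i)%N.
Local Notation N := (SV_N n d).
Local Notation X := (SV K n d).

Lemma sum_tangent_conf (x : 'I_r -> multiproj K n) (B : conf (projspace K N) r) :
  enumerates (SV_tuple d x) B ->
  (\sum_(p <- conf_fset B) tangent_space X p = \sum_l tangent_space X (SV_map d (x l)))%VS.
Proof.
move=> [ut xB]; have pB : perm_eq (conf_fset B) (SV_tuple d x).
  by apply: uniq_perm => //; exact: fset_uniq.
rewrite (perm_big _ pB) /= big_map big_enum /=.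
by [].
Qed.

Lemma tangent_directP (x : 'I_r -> multiproj K n) (B : conf (projspace K N) r) :
  enumerates (SV_tuple d x) B ->
  (pdim (\sum_(p <- conf_fset B) tangent_space X p)%VS < (r * (krull_dim X).+1)%:Z - 1)%R <->
  ~~ directv (\sum_l tangent_space X (SV_map d (x l))).
Proof.
move=> xB; rewrite (sum_tangent_conf xB) (krull_dim_SV n d_gt0) /pdim.
have dimE : (\sum_l \dim (tangent_space X (SV_map d (x l))) = r * (\sum_i n i).+1)%N.
  by rewrite (eq_bigr (fun=> (\sum_i n i).+1)) ?sum_nat_const ?card_ord // => l _;
    exact: dim_tangent_SV.
rewrite directvEgeq /= dimE -ltnNge; set a := \dim _; set b := (r * _)%N.
by split; lia.
Qed.

End SumOfTangentSpaces.

Section LineFamilies.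
Context {K : closedFieldType} {k : nat} (n d : 'I_k -> nat) (r : nat).
Hypotheses (d_gt0 : forall i, (0 < d i)%N) (n_gt0 : forall i, (0 < n i)%N) (r_gt1 : (1 < r)%N).
Local Notation N := (SV_N n d).
Local Notation X := (SV K n d).
Local Notation cnf := (conf (projspace K N) r).
Local Notation Ti i := (SV_conf d (SV_T K n r i)).

Lemma line_param_ex (i : 'I_k) (c : 'I_r -> K) : injective c ->
  exists2 y : lparam r (n_gt0 i) -> K, ldom y & forall l, y (inr l) = c l.
Proof. by move=> cI; exists (fun j => if j is inr l then c l else 0). Qed.

Lemma lines_in_SV i : Ti i `<=` conf_in X.
Proof.
move=> B /(@SV_confP K k n d r i _ (ltnW r_gt1))[x xB _]; exact: enumerates_in_SV xB.
Qed.

Lemma conf_inhabited (i : 'I_k) : exists A : cnf, True.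
Proof.
have [c cI] := fresh_family K r; have [y yI _] := line_param_ex i cI.
by have [A _] := lpoint_enum d_gt0 yI; exists A.
Qed.

Lemma has_dim_line_family i :
  has_dim (closure_in (conf_in X) (Ti i)) (\sum_j n j + n i + r - 2)%N.
Proof.
have [A0 _] := conf_inhabited i.
apply: (has_dim_lines d_gt0 (n_gt0 i) r_gt1 A0); last by move=> B [].
by move=> B BT; split; [exact: subset_closure|exact: lines_in_SV BT].
Qed.

Lemma irreducible_line_family i : irreducible_set (closure_in (conf_in X) (Ti i)).
Proof.
have [A0 _] := conf_inhabited i.
pose phi := @lmap K k n d r i (n_gt0 i) A0.
have -> : closure_in (conf_in X) (Ti i) = closure_in (conf_in X) (phi @` (setT `&` @ldom K k n r i (n_gt0 i))).
  by rewrite setTI /closure_in (closure_lines d_gt0 (n_gt0 i) r_gt1 A0).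
apply: irreducible_closure_in.
  rewrite setTI => _ [y yI <-]; apply: (@lines_in_SV i); exact: lmap_on_line.
have param := lmap_param d_gt0 (n_gt0 i) A0.
apply: (param_irreducible cform_system param) => //.
have [c cI] := fresh_family K r; have [y yI _] := line_param_ex i cI.
by exists y.
Qed.

(* On a configuration in the j-th family the i-th coordinate is constant. *)
Lemma line_family_sub i j : Ti i `<=` closure (Ti j) -> i = j.
Proof.
move=> sub; apply/eqP/negPn/negP => ij.
have [A0 _] := conf_inhabited i.
have [c cI] := fresh_family K r; have [y yI yc] := line_param_ex i cI.
have [J0 [J1 [J0E J1E]]] := @chart_coords k n d d_gt0.
pose o := orig (n_gt0 i).
(* W requires the coordinate [orig] of the factor i to be constant on the configuration; a general
   member of the i-th family violates this. *)
pose W := [set A : cnf | forall p p', p \in conf_fset A -> p' \in conf_fset A ->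
    coords p 0 (J1 o) * coords p' 0 J0 = coords p' 0 (J1 o) * coords p 0 J0].
have cW : closed W by exact: closed_pair_coords.
have TW : Ti j `<=` W.
  move=> B /(@SV_confP K k n d r j _ (ltnW r_gt1))[x [ux xB] [xj _]] p p'.
  rewrite !xB => /tnthP[l ->] /tnthP[l' ->]; rewrite !tnth_mktuple.
  have [a a0 aE] := SV_vector_scale d (represents_coords (x l)).
  have [b b0 bE] := SV_vector_scale d (represents_coords (x l')).
  have [aJ bJ] : (forall J, a * coords (SV_map d (x l)) 0 J = SV_vector d (fun i => coords (x l i)) 0 J) /\
      (forall J, b * coords (SV_map d (x l')) 0 J = SV_vector d (fun i => coords (x l' i)) 0 J).
    by rewrite aE bE; split=> J; rewrite [RHS]mxE.
  apply: (mulfI (mulf_neq0 a0 b0)); rewrite mulrACA [RHS]mulrACA aJ bJ.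
  (* On the right-hand side each scalar multiplies the coordinate of the other point; a / b and b /
     a put them back. *)
  rewrite [X in _ = X * _](_ : _ = a / b * (b * coords (SV_map d (x l')) 0 (J1 o))); last first.
    by rewrite mulrA divfK.
  rewrite [X in _ = _ * X](_ : _ = b / a * (a * coords (SV_map d (x l)) 0 J0)); last first.
    by rewrite mulrA divfK.
  rewrite aJ bJ !(SV_nearE _ (J1E o)) !(SV_pivotE _ J0E) ![\prod_j _ ^+ _](bigD1 (tag o)) //=.
  by rewrite (xj i ij l l'); field; rewrite a0 b0.
have yA := lmapP d_gt0 A0 yI; have /sub := lmap_on_line d_gt0 r_gt1 A0 yI.
move/(closureS TW); rewrite -(closure_id W).1 // => AW.
have mem l : SV_map d (lconf y l) \in conf_fset (@lmap K k n d r i (n_gt0 i) A0 y).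
  by rewrite yA.2 -[SV_map d _](tnth_mktuple (fun l => SV_map d (lconf y l))) mem_tnth.
pose l0 : 'I_r := Ordinal (ltnW r_gt1); pose l1 : 'I_r := Ordinal r_gt1.
have := AW _ _ (mem l1) (mem l0).
have [p0 p1] := chart_point_coords (lpoint y l0) J0E J1E.
have [q0 q1] := chart_point_coords (lpoint y l1) J0E J1E.
have lo l : lpoint y l o = c l by rewrite /lpoint eqxx yc.
rewrite p1 q1 !lo => E.
have /cI // : c l1 = c l0.
apply: (mulIf (mulf_neq0 p0 q0)); rewrite /lconf in E; apply: (etrans _ (etrans E _)); ring.
Qed.

End LineFamilies.

Lemma SV_r_le k (d : 'I_k.+1 -> nat) i : (SV_r d <= SV_bound (d i))%N.
Proof.
rewrite /SV_r; elim: (index_enum _) (mem_index_enum i) => // j s IH.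
by rewrite inE big_cons geq_min => /orP[/eqP<-|/IH->]; rewrite ?leqnn ?orbT.
Qed.

Lemma SV_r_gt1 k (d : 'I_k.+1 -> nat) : (forall i, (0 < d i)%N) -> (1 < SV_r d)%N.
Proof.
move=> d0; have b i : (1 < SV_bound (d i))%N.
  rewrite /SV_bound; have := d0 i; have := uphalf_half (d i + 2).
  by have := odd_double_half (d i + 2); rewrite -mul2n; case: (odd _) => /=; lia.
by rewrite /SV_r; elim/big_ind: _ => // a c; rewrite leq_min => ->.
Qed.

Theorem theorem7p10 (K : closedFieldType) (charK : [pchar K] =i pred0)
    (k : nat) (n d : 'I_k.+1 -> nat)
    (n_gt0 : forall i, (0 < n i)%N) (d_gt0 : forall i, (0 < d i)%N)
    (d_eq1 : (#|[pred i | d i == 1%N]| <= 1)%N) :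
  let X : set (projspace K (SV_N n d)) := SV K n d in
  let r := SV_r d in
  let J := SV_J d in
  Terracini r X =
    \bigcup_(i in J) closure_in (conf_in X) (SV_conf d (SV_T K n r i)) /\
  exists Z : 'I_k.+1 -> set (conf (projspace K (SV_N n d)) r),
    (forall i j, J i -> J j -> Z i = Z j -> i = j) /\
    (forall i, J i ->
      irreducible_component (Terracini r X) (Z i) /\
      has_dim (Z i) (\sum_(l < k.+1) n l + n i + r - 2)%N).
Proof.
move=> X r J; have r_gt1 : (1 < r)%N := SV_r_gt1 d_gt0.
pose T i := SV_conf d (SV_T K n r i); pose Z i := closure_in (conf_in X) (T i).
have TerE : Terracini r X = \bigcup_(i in J) Z i.
  rewrite -closure_in_bigU /Terracini (smooth_points_SV n d_gt0) -/X; congr closure_in.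
  apply/seteqP; split=> [B [BX dimB]|B [i Ji BT]].
    have [x xB] := conf_in_SV BX; apply: contrapT => nB.
    move/(tangent_directP d_gt0 xB): dimB => /negP; apply.
    apply/(tangent_direct_iff d_gt0 ord0 (SV_tuple_inj xB) (SV_r_le d) r_gt1 d_eq1).
    move=> i Ji xi; apply: nB; exists i => //.
    by apply/(@SV_confP K k.+1 n d r i _ (ltnW r_gt1)); exists x.
  have BX := lines_in_SV r_gt1 BT; split=> //.
  have [x xB xi] : exists2 x, enumerates (SV_tuple d x) B & on_line x i.
    by apply/(@SV_confP K k.+1 n d r i _ (ltnW r_gt1)).
  apply/(tangent_directP d_gt0 xB)/negP.
  move/(tangent_direct_iff d_gt0 ord0 (SV_tuple_inj xB) (SV_r_le d) r_gt1 d_eq1).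
  by move/(_ i Ji).
have TZ i : T i `<=` Z i.
  by move=> B BT; split; [exact: subset_closure|exact: lines_in_SV BT].
split; first exact: TerE.
exists Z; split=> [i j _ _ Zij|i Ji].
  apply: (line_family_sub d_gt0 n_gt0 r_gt1) => B /TZ; rewrite Zij.
  by case.
split; last exact: has_dim_line_family.
split; first by rewrite TerE => B ZB; exists i.
  exact: irreducible_line_family.
move=> Z' irrZ' ZZ' Z'Ter; apply/seteqP; split=> // B Z'B.
(* J is finite, so an irreducible Z' inside the union of the closures lies in one of them; that
   closure then contains T i, which forces its index to be i. *)
have [j Jj Z'j] : exists2 j, J j & Z' `<=` closure (T j).
  apply: (irreducible_sub_bigU irrZ') => [j|]; first exact: closed_closure.
  by move=> A /Z'Ter; rewrite TerE => -[j Jj [clA _]]; exists j.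
have ij : i = j.
  by apply: (line_family_sub d_gt0 n_gt0 r_gt1) => A /TZ/ZZ'/Z'j.
split; first by rewrite ij; exact: Z'j.
by have := Z'Ter _ Z'B; rewrite TerE => -[j' _ []].
Qed.
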